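(* Let $n\ge 3$ and $c\in\mathbb{R}$. Let $\Gamma\subset\mathbb{R}^n$ be an open convex symmetric cone with vertex at the origin such that $\Gamma_n\subset\Gamma\subset\Gamma_1$. Let $f\in C^\infty(\Gamma)\cap C^0(\overline{\Gamma})$ be a symmetric function with $f>0$ in $\Gamma$, such that $f$ is homogeneous of degree one on $\Gamma$, $f_i:=\partial f/\partial\lambda_i>0$ on $\Gamma$ for every $i$, and there is a constant $c_0>0$ with $\sum_i f_i(\lambda)\ge c_0$ for all $\lambda\in\Gamma$. Assume moreover that there exist positive constants $\varepsilon_1$ and $c_1$ such that for any $(\lambda,\xi)\in\Gamma\times\mathbb{R}^n$ satisfying $$f(\lambda)\le 1,\quad |\xi|\ge\varepsilon_1^{-1},\quad \left|\xi_i\left(\lambda_i-\tfrac12|\xi|^2\right)\right|\le\varepsilon_1|\xi|^3\ \text{ for } 1\le i\le n,$$ there holds $$\sum_i f_i(\lambda)\left\{\left(\lambda_i+\tfrac12|\xi|^2-\xi_i^2\right)^2+\xi_i^2\left(|\xi|^2-\xi_i^2\right)\right\}\ge c_1|\xi|^4\sum_i f_i(\lambda).$$ Let $(\mathcal{M}^n,g)$ be a smooth compact Riemannian manifold with nonempty smooth boundary $\partial\mathcal{M}$, let $\mathcal{O}_1$ be an open set of $\mathcal{M}$, let $\mathcal{O}_2$ be an open set of $\mathcal{M}$ with $\overline{\mathcal{O}}_2\subset\mathcal{O}_1$, and let $C_0$ be a constant. Then there is a positive constant $C$, depending only on $n$, $c$, $(f,\Gamma)$, $g$, $C_0$, $\mathcal{O}_1$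 and $\mathcal{O}_2$, such that every $u\in C^3(\mathcal{O}_1)$ satisfying $$\begin{cases} f(\lambda_g(U))=e^{-2u},\quad \lambda_g(U)\in\Gamma & \text{on } \mathcal{O}_1,\\ \dfrac{\partial u}{\partial\nu}=ce^{-u}-h_g & \text{on }\mathcal{O}_1\cap\partial\mathcal{M},\end{cases}\qquad U:=\nabla^2u+du\otimes du-\tfrac12|\nabla u|_g^2\,g+A_g,$$ and $u\ge -C_0$ on $\mathcal{O}_1$ satisfies $$|\nabla u|_g\le C\quad\text{on }\mathcal{O}_2 .$$
   Context: $\Gamma_1=\{\lambda\in\mathbb{R}^n:\sum_i\lambda_i>0\}$ and $\Gamma_n=\{\lambda\in\mathbb{R}^n:\lambda_i>0 \text{ for all } i\}$. ''Symmetric'' means invariant under permutations of the coordinates. Open sets of $\mathcal{M}$ are open in the topology of the manifold with boundary, so they may meet $\partial\mathcal{M}$. The Schouten tensor of $g$ is $A_g=\frac{1}{n-2}\left(Ric_g-\frac{1}{2(n-1)}R_g\,g\right)$, where $Ric_g$, $R_g$ are the Ricci tensor and scalar curvature of $g$. For a symmetric 2-tensor $U$, $\lambda_g(U)$ denotes its eigenvalues with respect to $g$. $\nabla$ is the Levi-Civita connection of $g$, and $\nu$ is the unit inward normal vector field to $\partial\mathcal{M}$ in $(\mathcal{M},g)$. The second fundamental form of $\partial\mathcal{M}$ is $\Pi(X,Y)=-g(\nabla_X\nu,Y)$ for $X,Y\in T(\partial\mathcal{M})$, and the mean curvature is $h_g=\frac{1}{n-1}\operatorname{tr}_g\Pi$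 (so a Euclidean ball has positive boundary mean curvature). *)

(* Defs.v *)
From HB Require Import structures.
From mathcomp Require Import all_boot all_order all_algebra.
From mathcomp Require Import all_classical all_reals all_analysis.

Set Implicit Arguments.
Unset Strict Implicit.
Unset Printing Implicit Defensive.

Import Order.TTheory GRing.Theory Num.Theory.
Import numFieldNormedType.Exports.

Local Open Scope classical_set_scope.
Local Open Scope ring_scope.

(** * Functions of class C^k on a subset of R^n

  The sets [A] below are open in R^n or relatively open in a closed half-space.
  Difference quotients only use points of [A], so that the derivative transverse
  to the boundary of a half-space is one-sided there; at interior points of [A]
  this is the usual partial derivative (lemma [partial_interior]). *)

Section differentiability.
Variables (R : realType) (n : nat).
Implicit Types (A : set 'rV[R]_n) (f : 'rV[R]_n -> R) (x : 'rV[R]_n).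

Definition basis_vec (i : 'I_n) : 'rV[R]_n := delta_mx 0 i.

Definition diff_quotient i f x (t : R) : R :=
  t^-1 * (f (x + t *: basis_vec i) - f x).

Definition punctured_line A i x : set_system R :=
  within [set t : R | A (x + t *: basis_vec i)] 0^'.

Definition partial A i f x : R :=
  lim (diff_quotient i f x @ punctured_line A i x).

Definition partial_ex A i f x : Prop :=
  cvg (diff_quotient i f x @ punctured_line A i x).

Definition iter_partial A (s : seq 'I_n) f : 'rV[R]_n -> R :=
  foldr (partial A) f s.

Definition class_C (k : nat) A f : Prop :=
  forall s : seq 'I_n,
    ((size s <= k)%N -> {within A, continuous (iter_partial A s f)}) /\
    ((size s < k)%N -> forall i x, A x -> partial_ex A i (iter_partial A s f) x).

Definition smooth A f : Prop := forall k, class_C k A f.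

Definition sqnorm x : R := \sum_i x 0 i ^+ 2.

(* The Euclidean norm; the library norm of ['rV[R]_n] is the sup norm. *)
Definition enorm x : R := Num.sqrt (sqnorm x).

Lemma partial_interior A i f x :
  nbhs x A -> partial A i f x = 'D_(basis_vec i) f x.
Proof.
move=> Ax; rewrite /partial /derive.
have lineA : \forall t \near 0^', A (x + t *: basis_vec i).
  have : x + t *: basis_vec i @[t --> 0] --> x + (0 : R) *: basis_vec i.
    apply: cvgD; first exact: cvg_cst.
    by apply: cvgZr_tmp; exact: cvg_id.
  rewrite scale0r addr0 => /(_ A Ax) /= lA.
  exact: (nbhs_dnbhs lA).
have -> : punctured_line A i x = 0^'.
  apply/seteqP; split=> P PP.
    by apply: (@filterS2 _ _ _ _ _ P _ lineA PP) => t At; exact.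
  by apply: (@filterS _ _ _ P) PP => t Pt _.
suff -> : diff_quotient i f x =
  (fun h => h^-1 *: ((f \o shift x) (h *: basis_vec i) - f x)) by [].
by apply/funext => t; rewrite /diff_quotient /= [_ *: _ + x]addrC.
Qed.

End differentiability.

(** * Smooth manifolds with boundary and Riemannian metrics *)

Section manifolds.
Variables (R : realType) (n : nat).

Definition half_space (N : 'I_n) : set 'rV[R]_n := [set x | 0 <= x 0 N].

(* A homeomorphism [fwd] from an open set [dom] of [T] onto a relatively open
   set [cod] of the half-space, with inverse [bwd]. *)
Record chart (T : topologicalType) (N : 'I_n) := Chart {
  dom : set T;
  cod : set 'rV[R]_n;
  fwd : T -> 'rV[R]_n;
  bwd : 'rV[R]_n -> T;
  dom_open : open dom;
  cod_open : exists2 W : set 'rV[R]_n, open W & cod = W `&` half_space N;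
  fwd_cod : forall p, dom p -> cod (fwd p);
  bwd_dom : forall x, cod x -> dom (bwd x);
  fwdK : forall p, dom p -> bwd (fwd p) = p;
  bwdK : forall x, cod x -> fwd (bwd x) = x;
  fwd_continuous : {within dom, continuous fwd};
  bwd_continuous : {within cod, continuous bwd} }.

Definition chart_img (T : topologicalType) N (phi : chart T N) (A : set T) :
  set 'rV[R]_n := cod phi `&` bwd phi @^-1` A.

Definition transition (T : topologicalType) N (phi psi : chart T N) (k : 'I_n)
  (x : 'rV[R]_n) : R := fwd psi (bwd phi x) 0 k.

(* The charts are modelled on the half-space [x_N >= 0], [N := bd_axis]. *)
Record smooth_structure (T : topologicalType) := SmoothStructure {
  bd_axis : 'I_n;
  atlas : set (chart T bd_axis);
  atlas_cover : forall p, exists2 phi, atlas phi & dom phi p;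
  atlas_smooth : forall phi psi, atlas phi -> atlas psi ->
    forall k, smooth (chart_img phi (dom psi)) (transition phi psi k) }.

Arguments atlas {T} s phi.

Definition boundary (T : topologicalType) (M : smooth_structure T) : set T :=
  [set p | exists phi, [/\ atlas M phi, dom phi p & fwd phi p 0 (bd_axis M) = 0]].

Definition class_C_on (T : topologicalType) (M : smooth_structure T) (k : nat)
  (A : set T) (u : T -> R) : Prop :=
  forall phi, atlas M phi -> class_C k (chart_img phi A) (u \o bwd phi).

Definition posdef (G : 'M[R]_n) : Prop :=
  G^T = G /\ forall v : 'rV[R]_n, v != 0 -> 0 < (v *m G *m v^T) 0 0.

(* [metric phi x i j] is the component g_ij in the chart [phi]; [metric_change]
   is the transformation law of covariant 2-tensors. *)
Record riemannian_metric (T : topologicalType) (M : smooth_structure T) :=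
  RiemannianMetric {
  metric : chart T (bd_axis M) -> 'rV[R]_n -> 'M[R]_n;
  metric_smooth : forall phi, atlas M phi -> forall i j,
    smooth (cod phi) (fun x => metric phi x i j);
  metric_posdef : forall phi, atlas M phi -> forall x, cod phi x ->
    posdef (metric phi x);
  metric_change : forall phi psi, atlas M phi -> atlas M psi ->
    forall x, chart_img phi (dom psi) x -> forall i j,
    let J k l := partial (chart_img phi (dom psi)) l (transition phi psi k) x in
    metric phi x i j =
      \sum_k \sum_l J k i * J l j * metric psi (fwd psi (bwd phi x)) k l }.

End manifolds.

Arguments atlas {R n T} s phi.

(** * Local formulas of Riemannian geometry

  [G] is the matrix of a metric over [A], [v] the expression of a function. *)

Section local_geometry.
Variables (R : realType) (n : nat).
Variables (A : set 'rV[R]_n) (G : 'rV[R]_n -> 'M[R]_n).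
Implicit Types (x : 'rV[R]_n) (v : 'rV[R]_n -> R) (i j k l m a b : 'I_n).

Local Notation "'d_ i" := (partial A i) (at level 8, i at level 2).

Definition ginv x : 'M[R]_n := invmx (G x).

(* Gamma^k_ij *)
Definition christoffel k i j x : R :=
  2^-1 * \sum_l ginv x k l *
    ('d_i (fun y => G y j l) x + 'd_j (fun y => G y i l) x
     - 'd_l (fun y => G y i j) x).

(* R(d_i, d_j) d_k = \sum_l riemann l k i j d_l, where
   R(X, Y) = [nabla_X, nabla_Y] - nabla_[X, Y] *)
Definition riemann l k i j x : R :=
  'd_i (christoffel l j k) x - 'd_j (christoffel l i k) x
  + \sum_m (christoffel l i m x * christoffel m j k x
            - christoffel l j m x * christoffel m i k x).

Definition ricci x : 'M[R]_n := \matrix_(j, k) \sum_i riemann i k i j x.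

Definition scalar_curvature x : R := \sum_i \sum_j ginv x i j * ricci x i j.

Definition schouten x : 'M[R]_n :=
  (n%:R - 2)^-1 *:
    (ricci x - (scalar_curvature x / (2 * (n%:R - 1))) *: G x).

Definition hessian v x : 'M[R]_n :=
  \matrix_(i, j) ('d_i ('d_j v) x - \sum_k christoffel k i j x * 'd_k v x).

Definition dtensor v x : 'M[R]_n := \matrix_(i, j) ('d_i v x * 'd_j v x).

Definition grad_sq v x : R := \sum_i \sum_j ginv x i j * ('d_i v x * 'd_j v x).

Definition grad_norm v x : R := Num.sqrt (grad_sq v x).

Definition U_tensor v x : 'M[R]_n :=
  hessian v x + dtensor v x - (2^-1 * grad_sq v x) *: G x + schouten x.

(* The boundary is [x_N = 0], with interior side [x_N > 0]. *)
Variable N : 'I_n.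

(* Contravariant components of the unit inward normal, i.e. of the normalized
   gradient of the coordinate x_N; see [inner_normal], [normal_inward]. *)
Definition unit_normal k x : R := ginv x k N / Num.sqrt (ginv x N N).

Definition normal_deriv v x : R := \sum_k unit_normal k x * 'd_k v x.

(* k-th component of nabla_(d_a) nu *)
Definition nabla_normal a k x : R :=
  'd_a (unit_normal k) x + \sum_l christoffel k a l x * unit_normal l x.

(* [lift N] enumerates the coordinates tangent to the boundary. *)
Definition second_fund x : 'M[R]_n.-1 :=
  \matrix_(a, b) - \sum_k nabla_normal (lift N a) k x * G x k (lift N b).

Definition bd_metric x : 'M[R]_n.-1 := row' N (col' N (G x)).

Definition mean_curvature x : R :=
  (n%:R - 1)^-1 * \tr (invmx (bd_metric x) *m second_fund x).

End local_geometry.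

(* [lam] lists, with multiplicity, the eigenvalues of the symmetric 2-tensor [U]
   with respect to the metric [G]. *)
Definition eigenvalues (R : realType) (n : nat) (G U : 'M[R]_n) (lam : 'rV[R]_n) :=
  char_poly (invmx G *m U) = \prod_i ('X - (lam 0 i)%:P).

(** * Characterization of the unit inward normal *)

Section normal_facts.
Variables (R : realType) (n : nat) (G : 'rV[R]_n -> 'M[R]_n) (N : 'I_n).
Variable x : 'rV[R]_n.
Hypothesis Gpos : posdef (G x).

Lemma posdef_unit : G x \in unitmx.
Proof.
case: Gpos => _ Gp; rewrite -row_free_unit -kermx_eq0.
apply/negP => /negP /rowV0Pn [v /sub_kermxP vG v0].
by have := Gp v v0; rewrite vG mul0mx mxE ltxx.
Qed.

Lemma ginv_NN_gt0 : 0 < ginv G x N N.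
Proof.
have [Gs Gp] := Gpos.
have Gu := posdef_unit.
pose v : 'rV[R]_n := row N (invmx (G x)).
have vG : v *m G x = delta_mx 0 N.
  by rewrite /v rowE -mulmxA mulVmx // mulmx1.
have v0 : v != 0.
  apply/eqP => v0; move: vG; rewrite v0 mul0mx => /matrixP /(_ 0 N).
  by rewrite !mxE !eqxx => /eqP; rewrite eq_sym oner_eq0.
have := Gp v v0; rewrite vG.
by rewrite -rowE !mxE.
Qed.

Lemma normal_inward : 0 < unit_normal G N N x.
Proof. by rewrite divr_gt0 ?sqrtr_gt0 ?ginv_NN_gt0. Qed.

(* g(nu, X) = X^N / sqrt(g^NN): thus nu is normal to [x_N = 0]. *)
Lemma inner_normal (X : 'I_n -> R) :
  \sum_k \sum_l G x k l * unit_normal G N k x * X l = X N / Num.sqrt (ginv G x N N).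
Proof.
have [Gs _] := Gpos; have Gu := posdef_unit.
rewrite exchange_big /= (bigD1 N) //= [X in _ + X]big1 ?addr0 => [|l lN].
all: rewrite -mulr_suml.
all: under eq_bigr do rewrite /unit_normal mulrA.
all: rewrite -mulr_suml.
  rewrite (_ : \sum_i _ = 1) ?mul1r 1?mulrC //.
  transitivity ((G x *m invmx (G x)) N N); last by rewrite mulmxV // mxE eqxx.
  by rewrite mxE; apply: eq_bigr => i _; rewrite -[in LHS]Gs mxE.
rewrite (_ : \sum_i _ = 0) ?mul0r //.
transitivity ((G x *m invmx (G x)) l N).
  by rewrite mxE; apply: eq_bigr => i _; rewrite -[in LHS]Gs mxE.
by rewrite mulmxV // mxE (negPf lN).
Qed.

Lemma normal_unit :
  \sum_k \sum_l G x k l * unit_normal G N k x * unit_normal G N l x = 1.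
Proof.
have g0 := ginv_NN_gt0.
rewrite inner_normal /unit_normal -mulrA -invfM -expr2 sqr_sqrtr ?ltW //.
by rewrite divff // gt_eqF.
Qed.

End normal_facts.

(* Main.v *)
(** Bernstein's method for the covector field [om := du - (c e^-u - h) nu^b], where
  [nu^b] is a smooth extension of the conormal of the boundary; the boundary
  condition says that [om] vanishes on the normal.  In a chart, let [eta] be a
  cutoff function and consider a maximum of [eta^2 |om|^2].

  At a boundary point, differentiating [om(nu) = 0] in tangential directions bounds
  the normal derivative of [|om|^2] by a multiple of [|om|^2], which excludes a
  maximum as soon as [eta] increases fast enough inwards.

  At an interior point, diagonalize [g] and [U] simultaneously.  The first order
  condition gives [om_l (lam_l - |om|^2 / 2) = O(|om|^2 / eta)], so the structural
  condition applies to [(lam, om)] unless [eta |om|] is bounded.  The second order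
  condition and the differentiated equation [sum_l f_l (nabla U)_ll = ...] bound
  [sum_l f_l |nabla_l om|^2] by [(sum_l f_l) O(|om|^3 / eta + |om|^2 / eta^2)],
  while the structural condition bounds it from below by a multiple of
  [(sum_l f_l) |om|^4].  Hence [eta |om|] is bounded, and compactness of the closure
  of [O2] globalizes the local estimates. *)

Require Import Defs.
From HB Require Import structures.
From mathcomp Require Import all_boot all_order perm all_algebra.
From mathcomp Require Import all_classical all_reals all_analysis.
From mathcomp Require Import ring lra.

Set Implicit Arguments.
Unset Strict Implicit.
Unset Printing Implicit Defensive.

Import Order.TTheory GRing.Theory Num.Theory.
Import numFieldNormedType.Exports.

Local Open Scope classical_set_scope.
Local Open Scope ring_scope.

(** * One-sided derivatives along a set of parameters *)

Section relative_derivative.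
Variable R : realType.
Implicit Types (D : set R) (f g : R -> R) (l m : R).

(** Second derivatives of [u] and the eigenvalues of [U] are not bounded beforehand. Contracted with
    [om], the Hessian is controlled by the first order condition; everything else must be absorbed
    by [|nabla om|^2]. The third derivatives of [u] in the second derivatives of [|om|^2] become,
    after contraction with [f_l], the equation differentiated once in the direction dual to [om].
    Eigenvalues need not be differentiable where they collide, so [f(lam)] is differentiated through
    traces of polynomials in a matrix. Removing the normal part from [du] makes the dual vector of
    [om] tangential at the boundary, so only mixed normal-tangential second derivatives of [u]
    appear there. All computations use coordinate derivatives at one point and a constant frame
    orthonormal at that point; Christoffel symbols only produce lower order errors. To keep
    constants independent of [u], of the point and of the frame, errors are compared with powers of
    [y = |om|] and [h = 1 / eta] over an index type ranging over all data at once. *)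

Definition has_der D f l :=
  t^-1 * (f t - f 0) @[t --> within D 0^'] --> l.

(** Clearing the denominator gives an inequality that is also true at [t = 0], so the puncture
    disappears from all later epsilon arguments. *)
Lemma has_der_near D f l :
  has_der D f l <-> forall e, 0 < e ->
    exists2 d : R, 0 < d & forall t, `|t| < d -> D t ->
      `|f t - f 0 - l * t| <= e * `|t|.
Proof.
split=> [fl e e0|fl].
  have /cvgrPdist_le/(_ _ e0) := fl.
  rewrite near_withinE => -[d /= d0 H]; exists d => // t td Dt.
  have [->|t0] := eqVneq t 0; first by rewrite subrr mulr0 subr0 normr0 mulr0.
  have := H t; rewrite /ball /= sub0r normrN => /(_ td t0 Dt) {}H.
  rewrite (_ : _ - _ = - t * (l - t^-1 * (f t - f 0))); last by field.
  by rewrite normrM normrN mulrC ler_wpM2r.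
apply/cvgrPdist_le => e e0; have [d d0 H] := fl e e0.
rewrite near_withinE; exists d => //= t.
rewrite /ball /= sub0r normrN => td t0 Dt.
rewrite (_ : _ - _ = - t^-1 * (f t - f 0 - l * t)); last by field.
rewrite normrM normrN normfV mulrC ler_pdivrMr ?normr_gt0 //.
exact: H.
Qed.

Lemma has_der_cst D a : has_der D (cst a) 0.
Proof.
apply/has_der_near => e e0; exists 1 => // t _ _.
by rewrite /cst subrr mul0r subrr normr0 mulr_ge0 // ltW.
Qed.

Lemma has_der_id D : has_der D id 1.
Proof.
apply/has_der_near => e e0; exists 1 => // t _ _.
by rewrite subr0 mul1r subrr normr0 mulr_ge0 // ltW.
Qed.

Lemma has_der_eq_near D f g l : f 0 = g 0 ->
  (exists2 d : R, 0 < d & forall t, `|t| < d -> D t -> f t = g t) ->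
  has_der D f l -> has_der D g l.
Proof.
move=> fg0 [d1 d10 fg] /has_der_near fl; apply/has_der_near => e e0.
have [d d0 H] := fl e e0; exists (Num.min d d1); first by rewrite lt_min d0.
by move=> t; rewrite lt_min => /andP[td td1] Dt; rewrite -fg // -fg0; exact: H.
Qed.

Lemma has_der_ext D f g l : f =1 g -> has_der D f l -> has_der D g l.
Proof. by move=> /funext ->. Qed.

Lemma has_der_sub D D' f l : (exists2 d : R, 0 < d & forall t, `|t| < d -> D' t -> D t) ->
  has_der D f l -> has_der D' f l.
Proof.
move=> [d1 d10 DD] /has_der_near fl; apply/has_der_near => e e0.
have [d d0 H] := fl e e0; exists (Num.min d d1); first by rewrite lt_min d0.
by move=> t; rewrite lt_min => /andP[td td1] Dt; apply: H => //; exact: DD.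
Qed.

Lemma has_der_cvg D f l : has_der D f l -> f t @[t --> within D 0^'] --> f 0.
Proof.
move=> fl.
have : t * (t^-1 * (f t - f 0)) + f 0 @[t --> within D 0^'] --> 0 * l + f 0.
  apply: cvgD; last exact: cvg_cst.
  apply: cvgM => //.
  apply: (@cvg_trans _ ((id : R -> R) @ 0^')); first exact: cvg_within_filter.
  exact: nbhs_dnbhs.
rewrite mul0r add0r; apply: cvg_trans; apply: near_eq_cvg.
rewrite near_withinE; apply: filterS (nbhs_dnbhs_neq (0 : R)) => t t0 _.
by field.
Qed.

Lemma has_derD D f g l m : has_der D f l -> has_der D g m ->
  has_der D (fun t => f t + g t) (l + m).
Proof.
move=> fl gm; rewrite /has_der.
under eq_fun do rewrite opprD addrACA mulrDr.
exact: cvgD.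
Qed.

Lemma has_derM D f g l m : has_der D f l -> has_der D g m ->
  has_der D (fun t => f t * g t) (l * g 0 + f 0 * m).
Proof.
move=> fl gm; rewrite /has_der.
have -> : (fun t => t^-1 * (f t * g t - f 0 * g 0)) =
  (fun t => t^-1 * (f t - f 0) * g t + f 0 * (t^-1 * (g t - g 0))).
  by apply/funext => t; ring.
apply: cvgD; first by apply: cvgM => //; exact: has_der_cvg gm.
by apply: cvgM => //; exact: cvg_cst.
Qed.

Lemma has_derZ D f l a : has_der D f l -> has_der D (fun t => a * f t) (a * l).
Proof.
move=> fl; have := has_derM (has_der_cst D a) fl.
by rewrite mul0r add0r.
Qed.

Lemma has_derN D f l : has_der D f l -> has_der D (fun t => - f t) (- l).
Proof.
move=> /(has_derZ (a := -1)); rewrite mulN1r.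
by apply: has_der_ext => t; rewrite mulN1r.
Qed.

Lemma has_der_sum D (I : Type) (r : seq I) (P : pred I) (f : I -> R -> R)
    (l : I -> R) :
  (forall i, P i -> has_der D (f i) (l i)) ->
  has_der D (fun t => \sum_(i <- r | P i) f i t) (\sum_(i <- r | P i) l i).
Proof.
move=> fl; elim: r => [|i r IH].
  rewrite big_nil; apply: has_der_ext (has_der_cst D 0) => t.
  by rewrite big_nil.
rewrite big_cons; case: ifPn => Pi; last first.
  by apply: has_der_ext IH => t; rewrite big_cons (negPf Pi).
apply: has_der_ext (has_derD (fl i Pi) IH) => t.
by rewrite big_cons Pi.
Qed.

Lemma has_der_comp D f l (phi : R -> R) d :
  is_derive (f 0) 1 phi d -> has_der D f l ->
  has_der D (fun t => phi (f t)) (d * l).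
Proof.
move=> [] /derivable_nbhs /= phid dE fl; rewrite -dE.
(* Difference quotient of [phi] filled in by the derivative at [f 0], so that the factorization
   below survives at times where [f t = f 0]. *)
pose q y := if y == f 0 then 'D_1 phi (f 0) else (y - f 0)^-1 * (phi y - phi (f 0)).
have qc : q y @[y --> f 0] --> 'D_1 phi (f 0).
  have /cvg_ex[/= k Hk] : derivable phi (f 0) 1 by exact/derivable_nbhsP.
  have kE : k = 'D_1 phi (f 0) by apply/esym/cvg_lim.
  rewrite -kE; apply/cvgrPdist_le => e e0.
  have /cvgrPdist_le/(_ _ e0) := Hk.
  move=> -[r /= r0 H]; exists r => //= y; rewrite /ball /= => yr.
  rewrite /q; case: eqVneq => [_|yf]; first by rewrite -kE subrr normr0 ltW.
  have := H (y - f 0); rewrite /ball /= sub0r opprB => /(_ yr).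
  rewrite subr_eq0 => /(_ yf).
  by rewrite [_ *: 1]mulr1 subrK.
rewrite /has_der.
have -> : (fun t => t^-1 * (phi (f t) - phi (f 0))) =
  (fun t => q (f t) * (t^-1 * (f t - f 0))).
  apply/funext => t; rewrite /q; case: eqVneq => [->|ft].
    by rewrite !subrr !mulr0.
  have a0 : f t - f 0 != 0 by rewrite subr_eq0.
  set a := f t - f 0 in a0 *; set b := phi _ - _.
  by rewrite mulrC [a^-1 * b]mulrC -mulrA [a^-1 * _]mulrCA mulVf // mulr1.
apply: cvgM => //; apply: cvg_comp qc; exact: has_der_cvg fl.
Qed.

(** Without such [t] the filter [within D 0^'] is trivial and every number is a derivative; this is
    what makes derivatives unique. *)
Definition adherent0 D := forall d, 0 < d -> exists t, [/\ t != 0, `|t| < d & D t].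

Lemma within_proper D : adherent0 D -> ProperFilter (within D (0 : R)^').
Proof.
move=> accD; split; last exact: within_filter.
move=> -[d /= d0 H]; have [t [t0 td Dt]] := accD d d0.
by apply: (H t) => //; rewrite /ball /= sub0r normrN.
Qed.

Lemma has_der_lim D f l : adherent0 D -> has_der D f l ->
  lim (t^-1 * (f t - f 0) @[t --> within D 0^']) = l.
Proof. by move=> /within_proper FD; exact: cvg_lim. Qed.

Lemma has_der_uniq D f l m : adherent0 D ->
  has_der D f l -> has_der D f m -> l = m.
Proof. by move=> aD fl fm; rewrite -(has_der_lim aD fl) (has_der_lim aD fm). Qed.

Lemma has_der_is_derive f t0 l (D : set R) :
  (exists2 d : R, 0 < d & forall t, `|t| < d -> D t) ->
  has_der D (fun t => f (t0 + t)) l -> is_derive t0 1 f l.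
Proof.
move=> [d1 d10 DD] /has_der_near fl.
have H : h^-1 *: ((f \o shift t0) (h *: 1) - f t0) @[h --> 0^'] --> l.
  apply/cvgrPdist_le => e e0; have [d d0 H] := fl e e0.
  exists (Num.min d d1) => /=; first by rewrite lt_min d0.
  move=> t; rewrite /ball /= sub0r normrN lt_min => /andP[td td1] tn0.
  have := H t td (DD t td1); rewrite addr0.
  rewrite [_ *: 1]mulr1 [t + t0]addrC => Ht.
  have -> : l - t^-1 *: (f (t0 + t) - f t0) = - t^-1 * (f (t0 + t) - f t0 - l * t).
    by rewrite /GRing.scale /=; field.
  by rewrite normrM normrN normfV mulrC ler_pdivrMr ?normr_gt0.
by split; [apply/cvg_ex; exists l | exact: cvg_lim].
Qed.

Lemma is_derive_has_der f (t0 l : R) (D : set R) :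
  is_derive t0 1 f l ->
  has_der D (fun t => f (t0 + t)) l.
Proof.
have : has_der D (fun t => t0 + t) 1.
  have := has_derD (has_der_cst D t0) (has_der_id D); rewrite add0r.
  exact: has_der_ext.
move=> H1 fl; rewrite -[l]mulr1; apply: has_der_comp H1.
by rewrite addr0.
Qed.

End relative_derivative.

(** * Differential calculus on relatively open subsets of a corner *)

Section partial_calculus.
Variables (R : realType) (n : nat).
Implicit Types (A B : set 'rV[R]_n) (f g : 'rV[R]_n -> R) (x y : 'rV[R]_n).
Implicit Types (i j : 'I_n) (l m : R).

Definition line A i x : set R := [set t : R | A (x + t *: basis_vec R i)].

Lemma lineE x i t j : (x + t *: basis_vec R i) 0 j = x 0 j + t * (j == i)%:R.
Proof. by rewrite !mxE eqxx. Qed.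

Lemma line_dist x i t j : `|(x + t *: basis_vec R i) 0 j - x 0 j| <= `|t|.
Proof.
rewrite lineE addrC addKr normrM ler_piMr ?normr_ge0 //.
by rewrite normr_nat lern1 leq_b1.
Qed.

Definition is_partial A i f x l :=
  has_der (line A i x) (fun t => f (x + t *: basis_vec R i)) l.

Lemma line0 x i : x + (0 : R) *: basis_vec R i = x.
Proof. by rewrite scale0r addr0. Qed.

Lemma is_partialE A i f x l :
  is_partial A i f x l = (diff_quotient i f x @ punctured_line A i x --> l).
Proof. by rewrite /is_partial /has_der line0. Qed.

Definition corner (L : pred 'I_n) : set 'rV[R]_n :=
  [set x | forall i, L i -> 0 <= x 0 i].

(* [L := pred0] gives the open sets, [L := pred1 N] the relatively open subsets of
   the half-space [x_N >= 0]. *)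
Definition corner_open (L : pred 'I_n) A :=
  exists2 W : set 'rV[R]_n, open W & A = W `&` corner L.

Lemma nbhs_coord x (W : set 'rV[R]_n) : nbhs x W <->
  exists2 d : R, 0 < d & forall y, (forall i, `|y 0 i - x 0 i| < d) -> W y.
Proof.
split=> [/nbhs_ballP[d /= d0 dW]|[d d0 dW]].
  exists d => // y yd; apply: dW; split=> // i j; rewrite ord1.
  by rewrite /ball /= distrC; exact: yd.
apply/nbhs_ballP; exists d => // y [_ yd]; apply: dW => i.
by have := yd 0 i; rewrite /ball /= distrC.
Qed.

Lemma corner_open_near L A x : corner_open L A -> A x ->
  exists2 d : R, 0 < d & forall y, (forall i, `|y 0 i - x 0 i| < d) -> corner L y -> A y.
Proof.
move=> [W oW ->] [Wx Lx].
have /nbhs_coord[d d0 H] : nbhs x W by exact: open_nbhs_nbhs.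
by exists d => // y yd Ly; split=> //; exact: H.
Qed.

Lemma corner_open_sub L A x : corner_open L A -> A x -> corner L x.
Proof. by move=> [W _ ->] []. Qed.

Lemma partial_congr A i f g x : (forall y, A y -> f y = g y) -> A x ->
  partial A i f x = partial A i g x.
Proof.
move=> fg Ax; rewrite /partial; congr (lim _).
by apply/seteqP; split=> P; apply: (@filterS _ (0 : R)^') => t Ht At; have := Ht At;
  rewrite /= /diff_quotient !fg.
Qed.

Lemma is_partial_congr A i f g x l : (forall y, A y -> f y = g y) -> A x ->
  is_partial A i f x l -> is_partial A i g x l.
Proof.
move=> fg Ax; apply: has_der_eq_near; first by rewrite line0; exact: fg.
by exists 1 => // t _ At; exact: fg.
Qed.

(** Partial derivatives are relative to a set, but only its germ at the point matters, so domains
    can be shrunk freely. *)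
Lemma punctured_line_local A B i x :
  (exists2 d : R, 0 < d & forall y, (forall j, `|y 0 j - x 0 j| < d) -> A y <-> B y) ->
  punctured_line A i x = punctured_line B i x.
Proof.
move=> [d d0 AB].
have H (t : R) : `|t| < d -> A (x + t *: basis_vec R i) <-> B (x + t *: basis_vec R i).
  by move=> td; apply: AB => j; exact: le_lt_trans (line_dist _ _ _ _) td.
apply/seteqP; split=> P [e /= e0 PP]; exists (Num.min e d) => /=;
  rewrite ?lt_min ?e0 // => t; rewrite /ball /= sub0r normrN lt_min => /andP[te td] t0 Ct;
  by apply: PP => //; rewrite /ball /= ?sub0r ?normrN //; apply/(H t td).
Qed.

Lemma partial_local A B i f x :
  (exists2 d : R, 0 < d & forall y, (forall j, `|y 0 j - x 0 j| < d) -> A y <-> B y) ->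
  partial A i f x = partial B i f x.
Proof. by move=> AB; rewrite /partial (punctured_line_local i AB). Qed.

Lemma withinP A f : {within A, continuous f} <->
  forall x, A x -> forall e, 0 < e -> exists2 d : R, 0 < d &
    forall y, (forall i, `|y 0 i - x 0 i| < d) -> A y -> `|f y - f x| <= e.
Proof.
split=> [/subspace_continuousP H x Ax e e0|H].
  have /cvgrPdist_le/(_ _ e0) := H x Ax.
  rewrite near_withinE => /nbhs_coord[d d0 K]; exists d => // y yd Ay.
  by rewrite distrC; exact: K.
apply/subspace_continuousP => x Ax; apply/cvgrPdist_le => e e0.
have [d d0 K] := H x Ax e e0; rewrite near_withinE; apply/nbhs_coord.
by exists d => // y yd Ay; rewrite distrC; exact: K.
Qed.

Lemma within_congr A f g : (forall y, A y -> f y = g y) ->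
  {within A, continuous f} -> {within A, continuous g}.
Proof.
by move=> fg; apply: subspace_eq_continuous => y; rewrite inE; exact: fg.
Qed.

Section corner_domain.
Variables (L : pred 'I_n) (A : set 'rV[R]_n).
Hypothesis HA : corner_open L A.

Lemma line_adherent i x : A x -> adherent0 (line A i x).
Proof.
move=> Ax d d0; have [e e0 H] := corner_open_near HA Ax.
pose t := Num.min d e / 2.
have m0 : 0 < Num.min d e by rewrite lt_min d0.
have t0 : 0 < t by rewrite divr_gt0.
have tm : t < Num.min d e by rewrite ltr_pdivrMr // ltr_pMr // ltr1n.
exists t; split; rewrite ?gt_eqF // ?gtr0_norm //.
  by apply: lt_le_trans tm _; rewrite ge_min lexx.
apply: H => j.
  apply: le_lt_trans (line_dist _ _ _ _) _; rewrite gtr0_norm //.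
  by apply: lt_le_trans tm _; rewrite ge_min lexx orbT.
move=> Lj; rewrite lineE addr_ge0 ?(mulr_ge0 (ltW t0) (ler0n _ _)) //.
exact: (corner_open_sub HA Ax).
Qed.

Lemma partial_eq i f x l : A x -> is_partial A i f x l -> partial A i f x = l.
Proof.
move=> Ax fl; rewrite -(has_der_lim (line_adherent i Ax) fl).
by rewrite line0.
Qed.

Lemma partial_exP i f x : partial_ex A i f x <-> is_partial A i f x (partial A i f x).
Proof. by rewrite is_partialE. Qed.

Lemma is_partial_ex i f x l : A x -> is_partial A i f x l -> partial_ex A i f x.
Proof. by move=> Ax fl; apply/partial_exP; rewrite (partial_eq Ax fl). Qed.

Lemma partial_ex_congr i f g x : (forall y, A y -> f y = g y) -> A x ->
  partial_ex A i f x -> partial_ex A i g x.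
Proof.
move=> fg Ax /partial_exP H.
exact: is_partial_ex Ax (is_partial_congr fg Ax H).
Qed.

Lemma class_C0 f : class_C 0 A f <-> {within A, continuous f}.
Proof.
split=> [/(_ [::])[] /(_ isT) //|cf s].
by split=> // /[!leqn0] /nilP ->.
Qed.

(** [iter_partial] applies the last index of the sequence first, so peeling with [rcons] exposes the
    innermost derivative. This recursion on [k] carries all closure properties of [class_C]. *)
Lemma class_CS k f : class_C k.+1 A f <->
  [/\ {within A, continuous f}, forall i x, A x -> partial_ex A i f x &
      forall i, class_C k A (partial A i f)].
Proof.
split=> [Hf|[cf pf Hf] s].
  split; [by have [/(_ isT)] := Hf [::] | by have [_ /(_ isT)] := Hf [::] |].
  move=> i s; have := Hf (rcons s i).
  by rewrite size_rcons !ltnS /iter_partial foldr_rcons.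
case/lastP: s => [|s i]; first by split.
by rewrite size_rcons !ltnS /iter_partial foldr_rcons; exact: Hf.
Qed.

Lemma class_C_continuous k f : class_C k A f -> {within A, continuous f}.
Proof. by move=> /(_ [::])[] /(_ isT). Qed.

Lemma class_C_partial_ex k f i x : class_C k.+1 A f -> A x -> partial_ex A i f x.
Proof. by move=> /class_CS[_ H _]; exact: H. Qed.

Lemma class_C_is_partial k f i x : class_C k.+1 A f -> A x ->
  is_partial A i f x (partial A i f x).
Proof. by move=> Hf Ax; apply/partial_exP; exact: class_C_partial_ex Hf Ax. Qed.

Lemma class_C_partial k f i : class_C k.+1 A f -> class_C k A (partial A i f).
Proof. by move=> /class_CS[]. Qed.

Lemma class_C_le k k' f : (k <= k')%N -> class_C k' A f -> class_C k A f.
Proof.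
move=> kk' Hf s; have [H1 H2] := Hf s.
by split=> sk; [apply: H1 | apply: H2]; apply: leq_trans kk'.
Qed.

Lemma class_CW k f : class_C k.+1 A f -> class_C k A f.
Proof. exact: class_C_le. Qed.

Lemma class_C_congr k f g : (forall y, A y -> f y = g y) ->
  class_C k A f -> class_C k A g.
Proof.
elim: k f g => [|k IH] f g fg.
  by rewrite !class_C0; exact: within_congr.
move=> /class_CS[cf pf Hf]; apply/class_CS; split.
- exact: within_congr cf.
- by move=> i x Ax; exact: partial_ex_congr fg Ax (pf i x Ax).
- by move=> i; apply: IH (Hf i) => y Ay; exact: partial_congr.
Qed.

Lemma class_C_build k f (df : 'I_n -> 'rV[R]_n -> R) :
  {within A, continuous f} ->
  (forall i x, A x -> is_partial A i f x (df i x)) ->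
  (forall i, class_C k A (df i)) -> class_C k.+1 A f.
Proof.
move=> cf Hd Hc; apply/class_CS; split=> //.
  by move=> i x Ax; exact: is_partial_ex Ax (Hd i x Ax).
by move=> i; apply: class_C_congr (Hc i) => y Ay; rewrite (partial_eq Ay (Hd i y Ay)).
Qed.

Lemma class_C_cst k (a : R) : class_C k A (cst a).
Proof.
elim: k a => [|k IH] a.
  by apply/class_C0; apply: continuous_subspaceT; exact: cst_continuous.
apply: (@class_C_build _ _ (fun=> cst 0)) => //.
  by apply: continuous_subspaceT; exact: cst_continuous.
by move=> i x _; exact: has_der_cst.
Qed.

Lemma is_partialD i f g x l m : is_partial A i f x l -> is_partial A i g x m ->
  is_partial A i (fun y => f y + g y) x (l + m).
Proof. exact: has_derD. Qed.

Lemma is_partialN i f x l : is_partial A i f x l ->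
  is_partial A i (fun y => - f y) x (- l).
Proof. exact: has_derN. Qed.

Lemma is_partialM i f g x l m : is_partial A i f x l -> is_partial A i g x m ->
  is_partial A i (fun y => f y * g y) x (l * g x + f x * m).
Proof. by move=> fl gm; have := has_derM fl gm; rewrite line0. Qed.

Lemma is_partial_comp i f x l (phi : R -> R) d : is_derive (f x) 1 phi d ->
  is_partial A i f x l -> is_partial A i (fun y => phi (f y)) x (d * l).
Proof. by move=> pd fl; apply: has_der_comp fl; rewrite line0. Qed.

Lemma is_partial_sum i (I : Type) (r : seq I) (P : pred I)
    (F : I -> 'rV[R]_n -> R) x (l : I -> R) :
  (forall k, P k -> is_partial A i (F k) x (l k)) ->
  is_partial A i (fun y => \sum_(k <- r | P k) F k y) x (\sum_(k <- r | P k) l k).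
Proof. exact: has_der_sum. Qed.

Lemma is_partial_coord i k x : is_partial A i (fun y => y 0 k) x (k == i)%:R.
Proof.
have -> : (k == i)%:R = 0 + (1 * (k == i)%:R + 0 * 0) :> R by ring.
apply: (has_der_ext (f := fun t => x 0 k + t * (k == i)%:R)).
  by move=> t; rewrite lineE.
apply: has_derD; first exact: has_der_cst.
by apply: has_derM; [exact: has_der_id | exact: has_der_cst].
Qed.

Lemma continuous_comp1 f (phi : R -> R) : {within A, continuous f} ->
  (forall x, A x -> {for f x, continuous phi}) ->
  {within A, continuous (fun y => phi (f y))}.
Proof.
move=> /subspace_continuousP cf cphi; apply/subspace_continuousP => x Ax.
exact: (cvg_comp _ _ (cf x Ax) (cphi x Ax)).
Qed.

Lemma continuous_coord k : {within A, continuous (fun y => y 0 k)}.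
Proof.
apply/withinP => x _ e e0; exists e => // y yd _; exact/ltW/yd.
Qed.

Lemma withinD f g : {within A, continuous f} -> {within A, continuous g} ->
  {within A, continuous (fun y => f y + g y)}.
Proof.
move=> /subspace_continuousP cf /subspace_continuousP cg.
by apply/subspace_continuousP => x Ax; apply: cvgD; [exact: cf | exact: cg].
Qed.

Lemma withinM f g : {within A, continuous f} -> {within A, continuous g} ->
  {within A, continuous (fun y => f y * g y)}.
Proof.
move=> /subspace_continuousP cf /subspace_continuousP cg.
by apply/subspace_continuousP => x Ax; apply: cvgM; [exact: cf | exact: cg].
Qed.

Lemma class_CD k f g : class_C k A f -> class_C k A g ->
  class_C k A (fun y => f y + g y).
Proof.
elim: k f g => [|k IH] f g; first by rewrite !class_C0; exact: withinD.
move=> Cf Cg.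
apply: (@class_C_build _ _ (fun i y => partial A i f y + partial A i g y)).
- by apply: withinD; exact: class_C_continuous (_ : class_C k.+1 A _).
- by move=> i x Ax; apply: is_partialD; exact: class_C_is_partial (_ : class_C k.+1 A _) Ax.
- by move=> i; apply: IH; exact: class_C_partial.
Qed.

Lemma class_CM k f g : class_C k A f -> class_C k A g ->
  class_C k A (fun y => f y * g y).
Proof.
elim: k f g => [|k IH] f g; first by rewrite !class_C0; exact: withinM.
move=> Cf Cg.
apply: (@class_C_build _ _ (fun i y => partial A i f y * g y + f y * partial A i g y)).
- by apply: withinM; exact: class_C_continuous (_ : class_C k.+1 A _).
- by move=> i x Ax; apply: is_partialM; exact: class_C_is_partial (_ : class_C k.+1 A _) Ax.
- by move=> i; apply: class_CD; apply: IH => //; solve [exact: class_C_partial | exact: class_CW].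
Qed.

Lemma class_C_coord k i : class_C k A (fun y => y 0 i).
Proof.
case: k => [|k]; first by apply/class_C0; exact: continuous_coord.
apply: (@class_C_build _ _ (fun j => cst (i == j)%:R)).
- exact: continuous_coord.
- by move=> j x _; exact: is_partial_coord.
- by move=> j; exact: class_C_cst.
Qed.

Lemma class_CN k f : class_C k A f -> class_C k A (fun y => - f y).
Proof.
move=> /(class_CM (class_C_cst k (-1))); apply: class_C_congr => y _.
by rewrite /cst mulN1r.
Qed.

Lemma class_CB k f g : class_C k A f -> class_C k A g ->
  class_C k A (fun y => f y - g y).
Proof. by move=> Cf Cg; apply: class_CD => //; exact: class_CN. Qed.

Lemma class_C_sum k (I : Type) (r : seq I) (P : pred I) (F : I -> 'rV[R]_n -> R) :
  (forall q, P q -> class_C k A (F q)) ->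
  class_C k A (fun y => \sum_(q <- r | P q) F q y).
Proof.
move=> CF; elim: r => [|j r IH].
  by apply: class_C_congr (class_C_cst k 0) => y _; rewrite big_nil.
have [Pj|Pj] := boolP (P j).
  by apply: class_C_congr (class_CD (CF j Pj) IH) => y _; rewrite big_cons Pj.
by apply: class_C_congr IH => y _; rewrite big_cons (negPf Pj).
Qed.

Lemma class_C_prod k (I : Type) (r : seq I) (F : I -> 'rV[R]_n -> R) :
  (forall q, class_C k A (F q)) -> class_C k A (fun y => \prod_(q <- r) F q y).
Proof.
move=> CF; elim: r => [|j r IH].
  by apply: class_C_congr (class_C_cst k 1) => y _; rewrite big_nil.
by apply: class_C_congr (class_CM (CF j) IH) => y _; rewrite big_cons.
Qed.

Lemma class_CV k f : (forall x, A x -> f x != 0) -> class_C k A f ->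
  class_C k A (fun y => (f y)^-1).
Proof.
move=> f0; elim: k => [|k IH].
  rewrite !class_C0 => cf; apply: continuous_comp1 => // x Ax.
  by apply: inv_continuous; exact: f0.
move=> Cf; have CV := IH (class_CW Cf).
apply: (@class_C_build _ _ (fun i y => - ((f y)^-1 * (f y)^-1) * partial A i f y)).
- apply: continuous_comp1 => [|x Ax]; first exact: class_C_continuous Cf.
  by apply: inv_continuous; exact: f0.
- move=> i x Ax.
  have pd : is_derive (f x) 1 (fun z : R => z^-1) (- ((f x)^-1 * (f x)^-1)).
    have := @is_deriveV _ id (f x) 1 1 (f0 x Ax) (is_derive_id _ _).
    by move=> H; apply: (is_derive_eq H); rewrite /GRing.scale /= expr2 invfM mulr1.
  exact: (is_partial_comp pd (class_C_is_partial Cf Ax)).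
- by move=> i; apply: class_CM; [apply/class_CN/class_CM | exact: class_C_partial].
Qed.

Lemma class_C_sqrt k f : (forall x, A x -> 0 < f x) -> class_C k A f ->
  class_C k A (fun y => Num.sqrt (f y)).
Proof.
move=> f0; elim: k => [|k IH].
  rewrite !class_C0 => cf; apply: continuous_comp1 => // x Ax.
  exact: sqrt_continuous.
move=> Cf; have CV := IH (class_CW Cf).
apply: (@class_C_build _ _
  (fun i y => (2 * Num.sqrt (f y))^-1 * partial A i f y)).
- apply: continuous_comp1 => [|x Ax]; first exact: class_C_continuous Cf.
  exact: sqrt_continuous.
- move=> i x Ax; have pd := is_derive1_sqrt (f0 x Ax).
  exact: (is_partial_comp pd (class_C_is_partial Cf Ax)).
- move=> i; apply: class_CM; last exact: class_C_partial.
  apply: class_CV => [x Ax|]; first by rewrite mulf_neq0 // gt_eqF // sqrtr_gt0 f0.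
  by apply: class_CM => //; exact: class_C_cst.
Qed.

Lemma class_C_exp k f : class_C k A f -> class_C k A (fun y => expR (f y)).
Proof.
elim: k => [|k IH].
  rewrite !class_C0 => cf; apply: continuous_comp1 => // x Ax.
  exact: continuous_expR.
move=> Cf; have CV := IH (class_CW Cf).
apply: (@class_C_build _ _ (fun i y => expR (f y) * partial A i f y)).
- apply: continuous_comp1 => [|x Ax]; first exact: class_C_continuous Cf.
  exact: continuous_expR.
- move=> i x Ax; have pd := is_derive_expR (f x).
  exact: (is_partial_comp pd (class_C_is_partial Cf Ax)).
- by move=> i; apply: class_CM => //; exact: class_C_partial.
Qed.

End corner_domain.
End partial_calculus.

Opaque partial.

(** * Mean values, total differentiability and symmetry of second derivatives up to the boundary *)

Section finite_differences.
Variables (R : realType) (n : nat).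
Implicit Types (f g : 'rV[R]_n -> R) (x y v : 'rV[R]_n) (i j k : 'I_n).

(** Often applied with [t] as a bare radius, the predicate quantifying over all points or values
    within [|t|]. *)
Lemma common_delta (I : finType) (P : I -> R -> Prop) :
  (forall q, exists2 d : R, 0 < d & forall t, `|t| < d -> P q t) ->
  exists2 d : R, 0 < d & forall t, `|t| < d -> forall q, P q t.
Proof.
move=> H; have K : \forall t \near (0 : R), forall q, P q t.
  apply: (@filter_forall _ _ (fun q t => P q t) _ (nbhs_filter _)) => q; have [d d0 dP] := H q.
  by exists d => //= t; rewrite /ball /= sub0r normrN; exact: dP.
have [d /= d0 dP] := K; exists d => // t td q; apply: dP.
by rewrite /ball /= sub0r normrN.
Qed.

Lemma has_der_lip (D : set R) (f : R -> R) l : has_der D f l ->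
  exists2 d : R, 0 < d & forall t, `|t| < d -> D t -> `|f t - f 0| <= (`|l| + 1) * `|t|.
Proof.
move=> /has_der_near /(_ 1 ltr01)[d d0 H]; exists d => // t td Dt.
rewrite -(subrK (l * t) (f t - f 0)) (le_trans (ler_normD _ _)) //.
by rewrite normrM mulrDl addrC lerD2l mul1r -[leRHS]mul1r H.
Qed.

Lemma has_der_scale (D D' : set R) (f : R -> R) l h :
  (exists2 d : R, 0 < d & forall s, `|s| < d -> D' s -> D (s * h)) ->
  has_der D f l -> has_der D' (fun s => f (s * h)) (l * h).
Proof.
move=> [d1 d10 DD] /has_der_near fl; apply/has_der_near => e e0.
have h0 : 0 < `|h| + 1 by rewrite ltr_wpDl.
have [d d0 H] := fl (e / (`|h| + 1)) (divr_gt0 e0 h0).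
exists (Num.min d1 (d / (`|h| + 1))); first by rewrite lt_min d10 divr_gt0.
move=> t; rewrite lt_min => /andP[t1 td] Dt; rewrite mul0r.
have th : `|t * h| <= `|t| * (`|h| + 1) by rewrite normrM ler_wpM2l // lerDl.
have tdh : `|t * h| < d.
  by apply: le_lt_trans th _; rewrite -ltr_pdivlMr.
rewrite mulrAC -mulrA; apply: le_trans (H _ tdh (DD _ t1 Dt)) _.
rewrite -mulrA ler_wpM2l ?(ltW e0) // mulrC ler_pdivrMr //.
Qed.

Section MVT.
Variables (A : set 'rV[R]_n).

Lemma line_add x i (s t : R) :
  x + (s + t) *: basis_vec R i = (x + s *: basis_vec R i) + t *: basis_vec R i.
Proof. by rewrite scalerDl addrA. Qed.

Lemma line_is_derive f i x h tau : partial_ex A i f (x + (tau * h) *: basis_vec R i) ->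
  (exists2 d : R, 0 < d & forall s, `|s| < d -> A (x + ((tau + s) * h) *: basis_vec R i)) ->
  is_derive tau 1 (fun s => f (x + (s * h) *: basis_vec R i))
    (partial A i f (x + (tau * h) *: basis_vec R i) * h).
Proof.
move=> /partial_exP pf [d d0 dA].
apply: (@has_der_is_derive _ _ _ _ [set s | `|s| < d]); first by exists d.
set y := x + _ in pf *.
apply: (@has_der_ext _ _ (fun s => f (y + (s * h) *: basis_vec R i))) => [s|].
  by rewrite mulrDl line_add.
apply: has_der_scale pf; exists d => // s sd _.
by have := dA s sd; rewrite mulrDl line_add.
Qed.

Lemma line_continuous f i x h : {within A, continuous f} ->
  (forall tau, 0 <= tau <= 1 -> A (x + (tau * h) *: basis_vec R i)) ->
  {within `[0, 1], continuous (fun s : R => f (x + (s * h) *: basis_vec R i))}.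
Proof.
move=> /withinP cf xA; apply/subspace_continuousP => s /=; rewrite in_itv /= => s01.
apply/cvgrPdist_le => e e0.
have [d d0 H] := cf _ (xA s s01) e e0.
have h0 : 0 < `|h| + 1 by rewrite ltr_wpDl.
rewrite near_withinE; exists (d / (`|h| + 1)) => /=; first by rewrite divr_gt0.
move=> r; rewrite /ball /= => sr; rewrite in_itv /= => r01.
rewrite distrC; apply: H; last exact: xA.
move=> j; rewrite !lineE opprD addrACA subrr add0r -mulrBl -mulrBl normrM.
apply: (@le_lt_trans _ _ (`|(r - s) * h|)).
  by rewrite ler_piMr // normr_nat lern1 leq_b1.
apply: (@le_lt_trans _ _ (`|s - r| * (`|h| + 1))).
  by rewrite normrM distrC ler_wpM2l // lerDl.
by rewrite -ltr_pdivlMr.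
Qed.

Lemma near_itv01 (tau : R) : tau \in `]0, 1[%R ->
  exists2 d : R, 0 < d & forall s, `|s| < d -> 0 <= tau + s <= 1.
Proof.
rewrite in_itv /= => /andP[t0 t1]; exists (Num.min tau (1 - tau)).
  by rewrite lt_min t0 subr_gt0.
move=> s; rewrite lt_min => /andP[]; rewrite !ltr_norml => /andP[s1 s2] /andP[s3 s4].
by apply/andP; split; lra.
Qed.

(** The segment is parametrized by [tau] in [[0, 1]] with speed [h], which treats both signs of [h]
    at once. *)
Lemma partial_MVT f i x h : {within A, continuous f} ->
  (forall y, A y -> partial_ex A i f y) ->
  (forall tau, 0 <= tau <= 1 -> A (x + (tau * h) *: basis_vec R i)) ->
  exists2 tau, 0 <= tau <= 1 &
    f (x + h *: basis_vec R i) - f x = partial A i f (x + (tau * h) *: basis_vec R i) * h.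
Proof.
move=> cf pf xA.
have [|c c01] := @MVT_segment _ (fun s : R => f (x + (s * h) *: basis_vec R i))
  (fun s => partial A i f (x + (s * h) *: basis_vec R i) * h) 0 1 ler01 _
  (line_continuous cf xA).
  move=> s s01; have [d d0 H] := near_itv01 s01.
  apply: line_is_derive.
    by apply/pf/xA; move: s01; rewrite in_itv /= => /andP[/ltW -> /ltW].
  by exists d => // t td; apply: xA; exact: H.
by rewrite mul1r mul0r line0 subr0 mulr1 => E; exists c.
Qed.

End MVT.

Section corner.
Variables (L : pred 'I_n) (A : set 'rV[R]_n).
Hypothesis HA : corner_open L A.

(** Move from [x] to [x + v] one coordinate at a time. Every intermediate coordinate is a convex
    combination of those of [x] and [x + v], so the path respects the corner constraints, and the
    mean value theorem with continuity of the partials controls each leg. *)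
Lemma frechet f x : class_C 1 A f -> A x ->
  forall e, 0 < e -> exists2 d : R, 0 < d & forall v, (forall i, `|v 0 i| < d) -> A (x + v) ->
    `|f (x + v) - f x - \sum_i v 0 i * partial A i f x| <= e * \sum_i `|v 0 i|.
Proof.
move=> /class_CS[cf pf cpf] Ax e e0.
have [d1 d10 HA1] := corner_open_near HA Ax.
have [d2 d20 Hd2] : exists2 d : R, 0 < d & forall t, `|t| < d ->
    forall i, (fun i (t : R) => forall y, (forall j, `|y 0 j - x 0 j| <= `|t|) -> A y ->
    `|partial A i f y - partial A i f x| <= e) i t.
  apply: common_delta => i; have /class_C0/withinP := cpf i.
  move=> /(_ x Ax e e0)[d d0 H]; exists d => // t td y yt Ay; apply: H => // j.
  exact: le_lt_trans td.
exists (Num.min d1 d2); first by rewrite lt_min d10.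
move=> v vd Av.
(* A positive number strictly below both radii that bounds all [v 0 i]: the maximum of the
   [|v 0 i|], or half the smaller radius when that maximum is zero. *)
have [d d0 [dd1 dd2 vd']] : exists2 d : R, 0 < d & [/\ d < d1, d < d2 & forall i, `|v 0 i| <= d].
  have [d0|d0] := ltP 0 (\big[Num.max/0]_i `|v 0 i|); last first.
    exists (Num.min d1 d2 / 2); first by rewrite divr_gt0 // lt_min d10.
    have m0 : 0 < Num.min d1 d2 by rewrite lt_min d10.
    have tm : Num.min d1 d2 / 2 < Num.min d1 d2 by rewrite ltr_pdivrMr // ltr_pMr // ltr1n.
    split; [by apply: lt_le_trans tm _; rewrite ge_min lexx|
      by apply: lt_le_trans tm _; rewrite ge_min lexx orbT|] => i.
    apply: (@le_trans _ _ 0); last by rewrite ltW // divr_gt0.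
    by apply: le_trans d0; exact: le_bigmax.
  exists (\big[Num.max/0]_i `|v 0 i|) => //; split; last by move=> i; exact: le_bigmax.
    apply/bigmax_ltP; split=> // i _; apply: lt_le_trans (vd i) _.
    by rewrite ge_min lexx.
  apply/bigmax_ltP; split=> // i _; apply: lt_le_trans (vd i) _.
  by rewrite ge_min lexx orbT.
have box (c : 'I_n -> R) y : (forall i, 0 <= c i <= 1) ->
    (forall i, y 0 i = x 0 i + c i * v 0 i) -> A y /\ forall i, `|y 0 i - x 0 i| <= `|d|.
  move=> c01 yE; have yd i : `|y 0 i - x 0 i| <= d.
    rewrite yE addrC addKr normrM; apply: le_trans (vd' i).
    have /andP[c0 c1] := c01 i.
    by rewrite ger0_norm // ler_piMl.
  split; last by move=> i; apply: le_trans (yd i) (ler_norm _).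
  apply: HA1 => i; first exact: le_lt_trans dd1.
  move=> Li; have x0 := corner_open_sub HA Ax Li.
  have := corner_open_sub HA Av Li; rewrite mxE yE => xv0.
  have /andP[c0 c1] := c01 i.
  have -> : x 0 i + c i * v 0 i = (1 - c i) * x 0 i + c i * (x 0 i + v 0 i) by ring.
  by rewrite addr_ge0 // mulr_ge0 // subr_ge0.
(* The first [k] coordinates have moved. *)
pose z (k : nat) : 'rV[R]_n := \row_i (x 0 i + (i < k)%:R * v 0 i).
have z0 : z 0%N = x by apply/rowP => i; rewrite mxE ltn0 mul0r addr0.
have zn : z n = x + v by apply/rowP => i; rewrite !mxE ltn_ord mul1r.
have zS (k : 'I_n) : z k.+1 = z k + v 0 k *: basis_vec R k.
  apply/rowP => i; rewrite lineE !mxE ltnS leq_eqVlt -val_eqE /=.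
  case: (ltngtP i k) => //= ik; rewrite ?mul0r ?mulr0 ?mul1r ?mulr1 ?addr0 //.
  by have -> : i = k by apply: val_inj.
have -> : f (x + v) - f x = \sum_(k < n) (f (z k.+1) - f (z k)).
  rewrite -[in LHS]zn -[in LHS]z0 -(telescope_sumr (fun k : nat => f (z k)) (leq0n n)).
  by rewrite big_mkord.
rewrite -sumrB (le_trans (ler_norm_sum _ _ _)) // mulr_sumr ler_sum // => k _.
have seg tau : 0 <= tau <= 1 -> A (z k + (tau * v 0 k) *: basis_vec R k) /\
    forall i, `|(z k + (tau * v 0 k) *: basis_vec R k) 0 i - x 0 i| <= `|d|.
  move=> t01.
  apply: (box (fun i => if i == k then tau else (i < k)%:R)) => i.
    by case: eqP => // _; rewrite ler0n lern1 leq_b1.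
  rewrite lineE mxE -addrA; congr (_ + _).
  case: eqVneq => [->|ik]; first by rewrite ltnn mul0r add0r mulr1.
  by rewrite mulr0 addr0.
rewrite zS.
have [|tau t01 ->] := partial_MVT cf (pf k) (x := z k) (h := v 0 k).
  by move=> tau /seg[].
rewrite mulrC -mulrBr normrM mulrC ler_wpM2r //.
have [Ay yd] := seg tau t01.
by apply: (Hd2 d) => //; rewrite gtr0_norm.
Qed.

(** Chain rule for curves differentiable only along [D], as coordinate lines pushed through a
    transition map are at the boundary. Subtracting the linear part leaves a remainder that is
    negligible by [frechet], since the coordinates move at most linearly in [t]. *)
Lemma has_der_curve (D : set R) (X : R -> 'rV[R]_n) (J : 'I_n -> R) f :
  class_C 1 A f -> A (X 0) -> (exists2 d : R, 0 < d & forall t, `|t| < d -> D t -> A (X t)) ->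
  (forall k, has_der D (fun t => X t 0 k) (J k)) ->
  has_der D (fun t => f (X t)) (\sum_k J k * partial A k f (X 0)).
Proof.
move=> Cf A0 [d0 d00 DA] XJ.
pose r t := f (X t) - \sum_k X t 0 k * partial A k f (X 0).
have r0 : has_der D r 0.
  apply/has_der_near => e e0.
  pose K := \sum_k (`|J k| + 1) + 1.
  have K0 : 0 < K by rewrite ltr_wpDl // sumr_ge0 // => k _; rewrite addr_ge0.
  have [d1 d10 H1] := frechet Cf A0 (divr_gt0 e0 K0).
  have [d2 d20 H2] : exists2 d : R, 0 < d & forall t, `|t| < d -> forall k, D t ->
      `|X t 0 k - X 0 0 k| <= (`|J k| + 1) * `|t|.
    by apply: common_delta => k; exact: has_der_lip.
  exists (Num.min d0 (Num.min d2 (d1 / K))); first by rewrite !lt_min d00 d20 divr_gt0.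
  move=> t; rewrite !lt_min => /and3P[t0 t2 t1] Dt; rewrite mul0r subr0.
  have tJ k : (`|J k| + 1) * `|t| <= K * `|t|.
    rewrite ler_wpM2r // /K (bigD1 k) //= -addrA lerDl addr_ge0 //.
    by apply: sumr_ge0 => j _; rewrite addr_ge0.
  have vd k : `|(X t - X 0) 0 k| < d1.
    rewrite !mxE (le_lt_trans (H2 t t2 k Dt)) // (le_lt_trans (tJ k)) //.
    by rewrite mulrC -ltr_pdivlMr.
  have := H1 (X t - X 0) vd; rewrite addrC subrK => /(_ (DA t t0 Dt)).
  have -> : \sum_i (X t - X 0) 0 i * partial A i f (X 0) =
      \sum_k X t 0 k * partial A k f (X 0) - \sum_k X 0 0 k * partial A k f (X 0).
    by rewrite -sumrB; apply: eq_bigr => k _; rewrite !mxE mulrBl.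
  have -> : f (X t) - f (X 0) - (\sum_k X t 0 k * partial A k f (X 0) -
      \sum_k X 0 0 k * partial A k f (X 0)) = r t - r 0 by rewrite /r; ring.
  move=> /le_trans; apply; rewrite -mulrA ler_wpM2l ?(ltW e0) //.
  rewrite mulrC ler_pdivrMr // mulrC.
  apply: (@le_trans _ _ (\sum_k (`|J k| + 1) * `|t|)).
    by apply: ler_sum => k _; rewrite !mxE; exact: H2.
  by rewrite -mulr_suml ler_wpM2r // lerDl.
have lin : has_der D (fun t => \sum_k X t 0 k * partial A k f (X 0))
    (\sum_k J k * partial A k f (X 0)).
  apply: has_der_sum => k _.
  have := has_derM (XJ k) (has_der_cst D (partial A k f (X 0))).
  by rewrite mulr0 addr0.
have := has_derD r0 lin; rewrite add0r; apply: has_der_ext => t.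
by rewrite /r subrK.
Qed.

(** Two mean values, the first one for the increment in direction [j] as a function of the
    coordinate [i]. Only nonnegative steps occur, so the square fits in a corner. *)
Lemma mixed_difference f i j x t : class_C 2 A f -> 0 <= t ->
  (forall a b, 0 <= a <= t -> 0 <= b <= t ->
     A (x + a *: basis_vec R i + b *: basis_vec R j)) ->
  exists a b, [/\ 0 <= a <= t, 0 <= b <= t &
    f (x + t *: basis_vec R i + t *: basis_vec R j) - f (x + t *: basis_vec R i)
      - f (x + t *: basis_vec R j) + f x =
    partial A j (partial A i f) (x + a *: basis_vec R i + b *: basis_vec R j) * t * t].
Proof.
move=> /class_CS[cf pf cpf] t0 xA.
have sc (s : R) : 0 <= s <= 1 -> 0 <= s * t <= t.
  by move=> /andP[s0 s1]; rewrite mulr_ge0 //= ler_piMl.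
pose y := x + t *: basis_vec R j.
have yE (s : R) : y + s *: basis_vec R i = x + s *: basis_vec R i + t *: basis_vec R j.
  by rewrite /y addrAC.
have tt : 0 <= t <= t by rewrite t0 lexx.
have oo : 0 <= (0 : R) <= t by rewrite lexx.
have yA s : 0 <= s <= 1 -> A (y + (s * t) *: basis_vec R i).
  by move=> /sc s1; rewrite yE; exact: xA.
have xA' s : 0 <= s <= 1 -> A (x + (s * t) *: basis_vec R i).
  by move=> /sc s1; rewrite -(line0 (x + _) j); exact: xA.
have [| |s s01 E] := @MVT_segment _
  (fun s : R => f (y + (s * t) *: basis_vec R i) - f (x + (s * t) *: basis_vec R i))
  (fun s => partial A i f (y + (s * t) *: basis_vec R i) * t -
            partial A i f (x + (s * t) *: basis_vec R i) * t) 0 1 ler01.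
- move=> s s01; have [d d0 H] := near_itv01 s01.
  have s01' : 0 <= s <= 1 by move: s01; rewrite in_itv /= => /andP[/ltW -> /ltW].
  apply: is_deriveB; apply: line_is_derive.
  + exact/pf/yA.
  + by exists d => // r rd; apply: yA; exact: H.
  + exact/pf/xA'.
  + by exists d => // r rd; apply: xA'; exact: H.
- by move=> s; apply: continuousB; exact: (line_continuous cf).
move: s01 E; rewrite in_itv /= => s01.
rewrite !mul1r !mul0r !line0 subr0 mulr1 -mulrBl yE => E.
have /class_CS[cpf0 ppf _] := cpf i.
have [|r r01 E2] := partial_MVT cpf0 (ppf j) (x := x + (s * t) *: basis_vec R i) (h := t).
  by move=> r /sc r1; apply: xA => //; exact: sc.
exists (s * t), (r * t); split; [exact: sc|exact: sc|].
rewrite -E2 -[x + (s * t) *: _ + t *: _]yE -E /y; ring.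
Qed.

(** The second difference over a small forward square is symmetric in [i] and [j], and each order of
    evaluation yields one mixed derivative at a nearby point; continuity concludes, also at boundary
    points. *)
Lemma partial_comm f i j x : class_C 2 A f -> A x ->
  partial A i (partial A j f) x = partial A j (partial A i f) x.
Proof.
move=> Cf Ax; have [->//|ij] := eqVneq i j.
have [d d0 HAd] := corner_open_near HA Ax.
apply/eqP; rewrite -subr_eq0 -normr_le0; apply/ler_addgt0Pl => e e0; rewrite addr0.
have e2 : 0 < e / 2 by rewrite divr_gt0.
have c2 a b : {within A, continuous (partial A a (partial A b f))}.
  by apply/class_C0; apply/class_C_partial/class_C_partial.
have /withinP/(_ x Ax _ e2)[d1 d10 H1] := c2 i j.
have /withinP/(_ x Ax _ e2)[d2 d20 H2] := c2 j i.
pose m := Num.min d (Num.min d1 d2).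
have m0 : 0 < m by rewrite !lt_min d0 d10.
(* Points of the square move each coordinate by at most [2 * t], which is strictly less than [m]. *)
pose t := m / 4.
have t0 : 0 < t by rewrite divr_gt0.
have near a b y : 0 <= a <= t -> 0 <= b <= t ->
    (y = x + a *: basis_vec R i + b *: basis_vec R j) ->
    [/\ A y, forall k, `|y 0 k - x 0 k| < d1 & forall k, `|y 0 k - x 0 k| < d2].
  move=> /andP[a0 at_] /andP[b0 bt] ->.
  have ym k : `|(x + a *: basis_vec R i + b *: basis_vec R j) 0 k - x 0 k| < m.
    rewrite !lineE (_ : _ - x 0 k = a * (k == i)%:R + b * (k == j)%:R); last by ring.
    rewrite (le_lt_trans (ler_normD _ _)) //.
    rewrite !normrM !normr_nat !ger0_norm //.
    have : a * (k == i)%:R <= t by rewrite (le_trans _ at_) // ler_piMr // lern1 leq_b1.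
    have : b * (k == j)%:R <= t by rewrite (le_trans _ bt) // ler_piMr // lern1 leq_b1.
    by rewrite /t; lra.
  split; last by move=> k; apply: lt_le_trans (ym k) _; rewrite !ge_min lexx !orbT.
    apply: HAd => k; first by apply: lt_le_trans (ym k) _; rewrite ge_min lexx.
    move=> Lk; rewrite !lineE !addr_ge0 ?mulr_ge0 //; exact: (corner_open_sub HA Ax).
  by move=> k; apply: lt_le_trans (ym k) _; rewrite !ge_min lexx !orbT.
have [a [b [aT bT E1]]] : exists a b, [/\ 0 <= a <= t, 0 <= b <= t & _] :=
  mixed_difference (i := i) (j := j) (x := x) Cf (ltW t0)
    (fun a b Ha Hb => let: And3 K _ _ := near a b _ Ha Hb erefl in K).
have [|b' [a' [bT' aT' E2]]] := mixed_difference (i := j) (j := i) (x := x) Cf (ltW t0).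
  by move=> b' a' Hb Ha; rewrite addrAC; have [] := near a' b' _ Ha Hb erefl.
have E12 : f (x + t *: basis_vec R i + t *: basis_vec R j) - f (x + t *: basis_vec R i)
      - f (x + t *: basis_vec R j) + f x =
    f (x + t *: basis_vec R j + t *: basis_vec R i) - f (x + t *: basis_vec R j)
      - f (x + t *: basis_vec R i) + f x.
  by rewrite [x + t *: basis_vec R j + _]addrAC [X in X + _ = _]addrAC.
have tn0 : t != 0 by rewrite gt_eqF.
have E := mulIf tn0 (mulIf tn0 (etrans (esym E1) (etrans E12 E2))).
have [Ay _ /(H2 _)/(_ Ay) K2] := near a b _ aT bT erefl.
have [Ay' /(H1 _)/(_ Ay') K1 _] := near a' b' _ aT' bT' erefl.
move: K1 K2; rewrite E [x + b' *: _ + _]addrAC => K1 K2.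
rewrite distrC in K1.
have -> : partial A i (partial A j f) x - partial A j (partial A i f) x =
  (partial A i (partial A j f) x - partial A i (partial A j f)
     (x + a' *: basis_vec R i + b' *: basis_vec R j)) +
  (partial A i (partial A j f)
     (x + a' *: basis_vec R i + b' *: basis_vec R j) - partial A j (partial A i f) x).
  by rewrite addrA subrK.
apply: le_trans (ler_normD _ _) _.
rewrite [leRHS](splitr e); exact: (lerD K1 K2).
Qed.

End corner.
End finite_differences.

(** * Derivatives in constant directions and the conditions at a maximum *)

Section directional.
Variables (R : realType) (n : nat).
Implicit Types (f g : 'rV[R]_n -> R) (x y v w : 'rV[R]_n) (i j k : 'I_n).

(** The coefficients of [v] are frozen: [dder A v (dder A v f)] is the pure second derivative,
    without terms from differentiating [v]. *)
Definition dder (A : set 'rV[R]_n) v f x : R := \sum_i v 0 i * partial A i f x.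

Definition local_max (A : set 'rV[R]_n) f x := exists2 d : R, 0 < d &
  forall y, (forall i, `|y 0 i - x 0 i| < d) -> A y -> f y <= f x.

Variables (L : pred 'I_n) (A : set 'rV[R]_n).
Hypothesis HA : corner_open L A.
Local Notation dv := (dder A).

Lemma dv_congr v f g x : (forall y, A y -> f y = g y) -> A x -> dv v f x = dv v g x.
Proof. by move=> fg Ax; apply: eq_bigr => i _; rewrite (partial_congr i fg Ax). Qed.

Lemma dv_basis k f x : dv (basis_vec R k) f x = partial A k f x.
Proof.
rewrite /dder (bigD1 k) //= big1 => [|i ik]; first by rewrite mxE !eqxx mul1r addr0.
by rewrite mxE eqxx (negPf ik) mul0r.
Qed.

Lemma dv_eq v f x l : A x -> (forall i, is_partial A i f x (l i)) ->
  dv v f x = \sum_i v 0 i * l i.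
Proof. by move=> Ax fl; apply: eq_bigr => i _; rewrite (partial_eq HA Ax (fl i)). Qed.

Lemma class_C_dv (k : nat) v f : class_C k.+1 A f -> class_C k A (dv v f).
Proof.
move=> Cf; apply: (class_C_sum HA) => i _; apply: (class_CM HA).
  exact: (class_C_cst HA).
exact: class_C_partial.
Qed.

Lemma dv_cst v (a : R) x : A x -> dv v (cst a) x = 0.
Proof.
move=> Ax; rewrite (@dv_eq _ _ _ (fun=> 0) Ax) => [|i]; last exact: has_der_cst.
by apply: big1 => i _; rewrite mulr0.
Qed.

Lemma dv_coord v k x : A x -> dv v (fun y => y 0 k) x = v 0 k.
Proof.
move=> Ax; rewrite (@dv_eq _ _ _ (fun i => (k == i)%:R) Ax) => [|i]; last exact: is_partial_coord.
rewrite (bigD1 k) //= eqxx mulr1 big1 ?addr0 // => i ik.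
by rewrite eq_sym (negPf ik) mulr0.
Qed.

Section rules.
Variables (x : 'rV[R]_n) (Ax : A x).
Let ip f (Cf : class_C 1 A f) i := class_C_is_partial (i := i) Cf Ax.

Lemma dvD v f g : class_C 1 A f -> class_C 1 A g ->
  dv v (fun y => f y + g y) x = dv v f x + dv v g x.
Proof.
move=> Cf Cg; rewrite (dv_eq _ Ax (fun i => is_partialD (@ip f Cf i) (@ip g Cg i))).
by rewrite -big_split /=; apply: eq_bigr => i _; rewrite mulrDr.
Qed.

Lemma dvN v f : class_C 1 A f -> dv v (fun y => - f y) x = - dv v f x.
Proof.
move=> Cf; rewrite (dv_eq _ Ax (fun i => is_partialN (@ip f Cf i))).
by rewrite -sumrN; apply: eq_bigr => i _; rewrite mulrN.
Qed.

Lemma dvB v f g : class_C 1 A f -> class_C 1 A g ->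
  dv v (fun y => f y - g y) x = dv v f x - dv v g x.
Proof. by move=> Cf Cg; rewrite dvD ?dvN //; exact: (class_CN HA). Qed.

Lemma dvM v f g : class_C 1 A f -> class_C 1 A g ->
  dv v (fun y => f y * g y) x = dv v f x * g x + f x * dv v g x.
Proof.
move=> Cf Cg; rewrite (dv_eq _ Ax (fun i => is_partialM (@ip f Cf i) (@ip g Cg i))).
rewrite mulr_suml mulr_sumr -big_split /=; apply: eq_bigr => i _; ring.
Qed.

Lemma dvZ v a f : class_C 1 A f -> dv v (fun y => a * f y) x = a * dv v f x.
Proof.
move=> Cf; rewrite (dvM v (class_C_cst HA 1 a) Cf) dv_cst // mul0r add0r //.
Qed.

Lemma dv_sum v (I : Type) (r : seq I) (P : pred I) (F : I -> 'rV[R]_n -> R) :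
  (forall q, P q -> class_C 1 A (F q)) ->
  dv v (fun y => \sum_(q <- r | P q) F q y) x = \sum_(q <- r | P q) dv v (F q) x.
Proof.
move=> CF; rewrite (@dv_eq _ _ _ (fun i => \sum_(q <- r | P q) partial A i (F q) x) Ax).
  rewrite exchange_big /=; apply: eq_bigr => i _; exact: mulr_sumr.
by move=> i; apply: is_partial_sum => q Pq; exact: (@ip _ (CF q Pq) i).
Qed.

Lemma dv_exp v f : class_C 1 A f ->
  dv v (fun y => expR (f y)) x = expR (f x) * dv v f x.
Proof.
move=> Cf; rewrite (dv_eq _ Ax (fun i => is_partial_comp (is_derive_expR (f x)) (@ip f Cf i))).
by rewrite mulr_sumr; apply: eq_bigr => i _; rewrite mulrCA.
Qed.

End rules.

Lemma ddM v f g x : A x -> class_C 2 A f -> class_C 2 A g ->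
  dv v (dv v (fun y => f y * g y)) x =
  dv v (dv v f) x * g x + 2 * dv v f x * dv v g x + f x * dv v (dv v g) x.
Proof.
move=> Ax Cf Cg; have Cf1 := class_CW Cf; have Cg1 := class_CW Cg.
have Cdf := class_C_dv v Cf; have Cdg := class_C_dv v Cg.
rewrite (@dv_congr _ _ (fun y => dv v f y * g y + f y * dv v g y) x _ Ax); last first.
  by move=> y Ay; exact: dvM.
rewrite dvD ?dvM //; [|exact: (class_CM HA) | exact: (class_CM HA)].
by rewrite -[2 * _ * _]mulrA mulr_natl mulr2n !addrA.
Qed.

Lemma dd_sum v (I : Type) (r : seq I) (P : pred I) (F : I -> 'rV[R]_n -> R) x :
  A x -> (forall q, P q -> class_C 2 A (F q)) ->
  dv v (dv v (fun y => \sum_(q <- r | P q) F q y)) x = \sum_(q <- r | P q) dv v (dv v (F q)) x.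
Proof.
move=> Ax CF.
rewrite (@dv_congr _ _ (fun y => \sum_(q <- r | P q) dv v (F q) y) x _ Ax); last first.
  by move=> y Ay; apply: dv_sum => // q Pq; apply/class_CW/CF.
by rewrite dv_sum // => q Pq; apply/class_C_dv/CF.
Qed.

Lemma dv_dv v w f x : A x -> class_C 2 A f ->
  dv v (dv w f) x = \sum_i \sum_j v 0 i * w 0 j * partial A i (partial A j f) x.
Proof.
move=> Ax Cf; rewrite [in LHS]/dv; apply: eq_bigr => i _; rewrite -dv_basis dv_sum //.
  rewrite mulr_sumr; apply: eq_bigr => j _.
  by rewrite dvZ // ?dv_basis ?mulrA //; exact: class_C_partial.
move=> j _; apply: (class_CM HA); [exact: (class_C_cst HA) | exact: class_C_partial].
Qed.

Lemma dv_comm v w f x : A x -> class_C 2 A f -> dv v (dv w f) x = dv w (dv v f) x.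
Proof.
move=> Ax Cf; rewrite !dv_dv // exchange_big /=.
apply: eq_bigr => i _; apply: eq_bigr => j _.
by rewrite (partial_comm HA _ _ Cf Ax) [v 0 j * _]mulrC.
Qed.

(** The sign of [s] encodes a side of the line on which [A] accumulates at [x]; a derivative of the
    same sign would make [f] increase there. *)
Lemma local_max_line f k x (s : R) : class_C 1 A f -> A x -> local_max A f x ->
  (forall d : R, 0 < d -> exists t, [/\ `|t| < d, 0 < s * t & line A k x t]) ->
  s * partial A k f x <= 0.
Proof.
move=> Cf Ax [d1 d10 H1] Hs; rewrite leNgt; apply/negP => l0.
have s0 : s != 0 by apply: contraTneq l0 => ->; rewrite mul0r ltxx.
have lam0 : partial A k f x != 0 by apply: contraTneq l0 => ->; rewrite mulr0 ltxx.
have /has_der_near := class_C_is_partial (i := k) Cf Ax; set l := partial A k f x in l0 lam0 *.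
have e0 : 0 < `|l| / 2 by rewrite divr_gt0 // normr_gt0.
move=> /(_ _ e0)[d d0 H].
have [|t [td st At]] := Hs (Num.min d d1); first by rewrite lt_min d0.
move: td; rewrite lt_min => /andP[td td1].
have := H t td At; rewrite line0 => Hl.
have Hf : f (x + t *: basis_vec R k) - f x <= 0.
  by rewrite subr_le0; apply: H1 => // j; apply: le_lt_trans (line_dist _ _ _ _) td1.
have lt0 : 0 < l * t.
  have : 0 < (s * l) * (s * t) by rewrite mulr_gt0.
  rewrite mulrACA pmulr_rgt0 // -expr2 lt_def sqr_ge0 andbT.
  by rewrite expf_neq0.
have E : `|l| / 2 * `|t| = l * t / 2.
  by rewrite mulrAC -normrM gtr0_norm.
move: Hl; rewrite E ler_norml => /andP[]; lra.
Qed.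

(** Increasing a coordinate never leaves the corner, so the forward direction is admissible even at
    boundary points. *)
Lemma local_max_partial_le0 f k x : class_C 1 A f -> A x -> local_max A f x ->
  partial A k f x <= 0.
Proof.
move=> Cf Ax fm; rewrite -[partial _ _ _ _]mul1r; apply: local_max_line => // d d0.
have [e e0 H] := corner_open_near HA Ax.
have m0 : 0 < Num.min d e by rewrite lt_min d0.
have tm : Num.min d e / 2 < Num.min d e by rewrite ltr_pdivrMr // ltr_pMr // ltr1n.
have t0 : 0 < Num.min d e / 2 by rewrite divr_gt0.
exists (Num.min d e / 2); split; rewrite ?mul1r // ?gtr0_norm //.
  by apply: lt_le_trans tm _; rewrite ge_min lexx.
apply: H => j.
  apply: le_lt_trans (line_dist _ _ _ _) _; rewrite gtr0_norm //.
  by apply: lt_le_trans tm _; rewrite ge_min lexx orbT.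
move=> Lj; rewrite lineE addr_ge0 // ?(mulr_ge0 (ltW t0) (ler0n _ _)) //.
exact: (corner_open_sub HA Ax).
Qed.

Lemma local_max_partial_eq0 f k x : class_C 1 A f -> A x -> local_max A f x ->
  (L k -> 0 < x 0 k) -> partial A k f x = 0.
Proof.
move=> Cf Ax fm xk; apply/eqP; rewrite eq_le local_max_partial_le0 //=.
rewrite -oppr_le0 -mulN1r; apply: local_max_line => // d d0.
have [e e0 H] := corner_open_near HA Ax.
(* Room for decreasing the coordinate [k]: down to the wall if it is constrained, any positive
   number otherwise. *)
pose r := if L k then x 0 k else 1.
have r0 : 0 < r by rewrite /r; case: ifP.
have m0 : 0 < Num.min r (Num.min d e) by rewrite !lt_min r0 d0.
have tm : Num.min r (Num.min d e) / 2 < Num.min r (Num.min d e).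
  by rewrite ltr_pdivrMr // ltr_pMr // ltr1n.
have t0 : 0 < Num.min r (Num.min d e) / 2 by rewrite divr_gt0.
set t := _ / 2 in tm t0.
exists (- t); split; rewrite ?mulrNN ?mul1r ?normrN // ?gtr0_norm //.
  by apply: lt_le_trans tm _; rewrite !ge_min lexx orbT.
apply: H => j.
  apply: le_lt_trans (line_dist _ _ _ _) _; rewrite normrN gtr0_norm //.
  by apply: lt_le_trans tm _; rewrite !ge_min lexx !orbT.
move=> Lj; rewrite lineE; case: eqVneq => [jk|_]; last first.
  by rewrite mulr0 addr0; exact: (corner_open_sub HA Ax).
rewrite mulr1 jk subr_ge0 ltW // (lt_le_trans tm) // ge_min /r -jk Lj lexx //.
Qed.

Definition interior_pt x := A x /\ forall i, L i -> 0 < x 0 i.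

Lemma interior_pt_near x : interior_pt x -> exists2 d : R, 0 < d &
  forall y, (forall i, `|y 0 i - x 0 i| < d) -> interior_pt y.
Proof.
move=> [Ax x0]; have [d d0 H] := corner_open_near HA Ax.
have [d1 d10 H1] : exists2 d : R, 0 < d & forall t, `|t| < d -> forall i,
    (fun i (t : R) => L i -> `|t| < x 0 i) i t.
  apply: common_delta => i; have [Li|_] := boolP (L i); last by exists 1.
  by exists (x 0 i) => //; exact: x0.
exists (Num.min d d1); first by rewrite lt_min d0.
move=> y yd.
have y0 i : L i -> 0 < y 0 i.
  move=> Li; have := yd i; rewrite lt_min => /andP[_ /H1 /(_ i Li)].
  by rewrite ?normr_id ltr_norml => /andP[]; lra.
split=> //; apply: H => i; last by move/y0/ltW.
by have := yd i; rewrite lt_min => /andP[].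
Qed.

Lemma interior_dir x v : interior_pt x ->
  exists2 d : R, 0 < d & forall t, `|t| < d -> interior_pt (x + t *: v).
Proof.
move=> /interior_pt_near[d d0 H].
have [d1 d10 H1] : exists2 d1 : R, 0 < d1 & forall t, `|t| < d1 -> forall i,
    (fun i (t : R) => `|t * v 0 i| < d) i t.
  apply: common_delta => i; have v0 : 0 < `|v 0 i| + 1 by rewrite ltr_wpDl.
  exists (d / (`|v 0 i| + 1)); first by rewrite divr_gt0.
  move=> t; rewrite ltr_pdivlMr // => td.
  by rewrite normrM (le_lt_trans _ td) // ler_wpM2l // lerDl.
exists d1 => // t td; apply: H => i; rewrite !mxE [x 0 i + _]addrC addrK; exact: H1.
Qed.

Lemma has_der_dir f x v : class_C 1 A f -> interior_pt x ->
  has_der setT (fun t => f (x + t *: v)) (dv v f x).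
Proof.
move=> Cf xi; have [d d0 H] := interior_dir v xi.
have := @has_der_curve _ _ _ _ HA setT (fun t => x + t *: v) (fun k => v 0 k) f Cf.
rewrite /= scale0r addr0; apply; first by case: xi.
  by exists d => // t td _; have [] := H t td.
move=> k; apply: (has_der_ext (f := fun t => x 0 k + v 0 k * t)) => [t|].
  by rewrite !mxE mulrC.
have := has_derD (has_der_cst setT (x 0 k)) (has_derZ (a := v 0 k) (has_der_id setT)).
by rewrite add0r mulr1.
Qed.

(** If the second derivative [c] were positive, the first derivative along the line, zero at [x],
    would be positive shortly after, and the mean value theorem would produce a larger value of
    [f]. *)
Lemma local_max_dd f x v : class_C 2 A f -> interior_pt x -> local_max A f x ->
  dv v (dv v f) x <= 0.
Proof.
move=> Cf xi [d0 d00 fm]; rewrite leNgt; apply/negP; set c := dv v _ x => c0.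
have [Ax _] := xi; have Cf1 := class_CW Cf.
have dv0 : dv v f x = 0.
  apply: big1 => i _; rewrite local_max_partial_eq0 ?mulr0 //; first by exists d0.
  by case: xi => _; exact.
have [d1 d10 H1] := interior_dir v xi.
have [d2 d20 H2] : exists2 d2 : R, 0 < d2 & forall t, `|t| < d2 -> forall i,
    (fun i (t : R) => `|t * v 0 i| < d0) i t.
  apply: common_delta => i; have v0 : 0 < `|v 0 i| + 1 by rewrite ltr_wpDl.
  exists (d0 / (`|v 0 i| + 1)); first by rewrite divr_gt0.
  move=> t; rewrite ltr_pdivlMr // => td.
  by rewrite normrM (le_lt_trans _ td) // ler_wpM2l // lerDl.
have /has_der_near := has_der_dir (v := v) (class_C_dv v Cf) xi; rewrite -/c.
have c2 : 0 < c / 2 by rewrite divr_gt0.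
move=> /(_ _ c2)[d3 d30 H3].
pose t := Num.min d1 (Num.min d2 d3) / 2.
have m0 : 0 < Num.min d1 (Num.min d2 d3) by rewrite !lt_min d10 d20.
have t0 : 0 < t by rewrite divr_gt0.
have : t < Num.min d1 (Num.min d2 d3) by rewrite ltr_pdivrMr // ltr_pMr // ltr1n.
rewrite !lt_min => /and3P[t1 t2 t3].
have sder (s : R) : `|s| < d1 -> is_derive s 1 (fun r => f (x + r *: v)) (dv v f (x + s *: v)).
  move=> sd; apply: (@has_der_is_derive _ _ _ _ setT); first by exists 1.
  apply: has_der_ext (has_der_dir (v := v) Cf1 (H1 s sd)) => r.
  by rewrite scalerDl addrA.
have [||s] := @MVT _ (fun s : R => f (x + s *: v)) (fun s => dv v f (x + s *: v)) 0 t t0.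
- move=> s; rewrite in_itv /= => /andP[s0 st]; apply: sder.
  by rewrite gtr0_norm // (lt_trans st).
- apply: derivable_within_continuous => s; rewrite in_itv /= => /andP[s0 st].
  by have [] := sder s _; rewrite // ger0_norm // (le_lt_trans st).
rewrite in_itv /= => /andP[s0 st]; rewrite subr0 scale0r addr0 => E.
have : f (x + t *: v) - f x <= 0.
  rewrite subr_le0; apply: fm => [i|]; last by have [] := H1 t _; rewrite // gtr0_norm.
  by rewrite !mxE [x 0 i + _]addrC addrK; apply: H2; rewrite gtr0_norm.
rewrite E pmulr_lle0 // leNgt => /negP; apply.
have := H3 s; rewrite scale0r addr0 dv0 subr0 gtr0_norm // => /(_ (lt_trans st t3) I).
rewrite ler_norml => /andP[h _]; have : 0 < c * s by rewrite mulr_gt0.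
lra.
Qed.

End directional.

(** * Eigenvalues of a symmetric tensor with respect to a metric *)

Section simultaneous_diagonalization.

Lemma char_poly_conj (F : fieldType) n (P g : 'M[F]_n) : P \in unitmx ->
  char_poly (invmx P *m g *m P) = char_poly g.
Proof.
move=> Pu; rewrite /char_poly /char_poly_mx.
have -> : 'X%:M - map_mx polyC (invmx P *m g *m P) =
    map_mx polyC (invmx P) *m ('X%:M - map_mx polyC g) *m map_mx polyC P.
  have PI : map_mx polyC (invmx P) *m map_mx polyC P = 1%:M.
    by rewrite -map_mxM mulVmx // map_mx1.
  by rewrite mulmxBr mulmxBl !map_mxM scalar_mxC -[_%:M *m _ *m _]mulmxA PI mulmx1.
rewrite !det_mulmx mulrAC -det_mulmx -map_mxM mulVmx // map_mx1 det1 mul1r //.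
Qed.

Variable R : realType.

Lemma posdef_conj n (E G : 'M[R]_n) : E \in unitmx -> posdef G ->
  posdef (E *m G *m E^T).
Proof.
move=> Eu [Gs Gp]; split=> [|v v0].
  by rewrite !trmx_mul trmxK Gs mulmxA.
have -> : v *m (E *m G *m E^T) *m v^T = (v *m E) *m G *m (v *m E)^T.
  by rewrite trmx_mul !mulmxA.
apply: Gp; apply: contra v0 => /eqP vE.
by rewrite -(mulmxK Eu v) vE mul0mx.
Qed.

Lemma posdef_unitmx n (G : 'M[R]_n) : posdef G -> G \in unitmx.
Proof. by move=> Gp; exact: (@posdef_unit _ _ (fun=> G) 0). Qed.

Lemma row_basis_completion n (w : 'rV[R]_n.+1) : w != 0 ->
  exists Q : 'M[R]_(n, 1 + n), @col_mx _ 1 n (1 + n) w Q \in unitmx.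
Proof.
move=> w0; have rw : \rank w = 1%N by apply/eqP; rewrite rank_rV w0.
pose P : 'M[R]_(1 + n) := row_ebase w.
have Pu : P \in unitmx := row_ebase_unit w.
have wE : w = (col_ebase w) 0 0 *: usubmx P.
  have wE := mulmx_ebase w; rewrite rw in wE; rewrite -[LHS]wE.
  rewrite {1}[col_ebase w]mx11_scalar -mulmxA mul_scalar_mx; congr (_ *: _).
  rewrite (_ : pid_mx 1 = row_mx 1%:M 0 :> 'rV[R]_(1 + n)); last by rewrite pid_mx_row.
  transitivity (row_mx 1%:M 0 *m col_mx (usubmx P) (dsubmx P)); first by rewrite vsubmxK.
  by rewrite mul_row_col mul1mx mul0mx addr0.
have a0 : (col_ebase w) 0 0 != 0.
  by apply: contra_neq w0 => a0; rewrite wE a0 scale0r.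
exists (dsubmx P).
have -> : col_mx w (dsubmx P) = block_mx ((col_ebase w) 0 0)%:M 0 0 1%:M *m P.
  rewrite -[in RHS](vsubmxK P) mul_block_col !mul0mx mul1mx mul_scalar_mx addr0 add0r.
  by rewrite -wE.
rewrite unitmx_mul Pu andbT unitmxE det_ublock det1 mulr1 det_scalar1.
by rewrite unitfE.
Qed.

(** Induction on the dimension. The given factorization supplies the real eigenvalue [lam 0 0]; the
    [G]-orthogonal complement of its eigenvector carries a pair of the same kind with the remaining
    eigenvalues in the given order. *)
Lemma simultaneous_diag n (G U : 'M[R]_n) lam :
  posdef G -> U^T = U -> eigenvalues G U lam ->
  exists E : 'M[R]_n, E *m G *m E^T = 1%:M /\ E *m U *m E^T = diag_mx lam.
Proof.
elim: n G U lam => [|n IH] G U lam.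
  by move=> _ _ _; exists 0; split; apply/matrixP => -[].
move: G U lam; rewrite -[n.+1]/(1 + n)%N => G U lam Gp Us ev.
have Gu := posdef_unitmx Gp; have [Gs Gpos] := Gp.
set a := lam 0 0.
have /eigenvalueP[v vE v0] : eigenvalue (invmx G *m U) a.
  rewrite eigenvalue_root_char ev rootE horner_prod (bigD1 0) //=.
  by rewrite hornerXsubC subrr mul0r.
(* [v] is a row eigenvector of [G^-1 U]; multiplying it by [G^-1] gives the pencil equation
   [w0 U = a w0 G]. *)
pose w0 := v *m invmx G.
have vw : v = w0 *m G by rewrite /w0 mulmxKV.
have w00 : w0 != 0 by apply: contra_neq v0 => w0E; rewrite vw w0E mul0mx.
have w0U : w0 *m U = a *: (w0 *m G) by rewrite -vw -vE /w0 mulmxA.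
pose s := (w0 *m G *m w0^T) 0 0.
have s0 : 0 < s := Gpos w0 w00.
pose w : 'rV[R]_(1 + n) := (Num.sqrt s)^-1 *: w0.
have ss0 : Num.sqrt s != 0 by rewrite gt_eqF // sqrtr_gt0.
have wn : w *m G *m w^T = 1%:M.
  rewrite /w linearZ /= -!scalemxAl -!scalemxAr scalerA [LHS]mx11_scalar mxE.
  by rewrite -/s -invfM -expr2 sqr_sqrtr ?ltW // mulVf ?gt_eqF.
have wU : w *m U = a *: (w *m G).
  by rewrite /w -!scalemxAl w0U scalerA mulrC -scalerA.
have wnz : w != 0 by rewrite scaler_eq0 invr_eq0 negb_or ss0.
have [Q Qu] := row_basis_completion wnz.
(* Gram-Schmidt step: the complement becomes [G]-orthogonal to [w], hence also [U]-orthogonal. *)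
pose Q' : 'M[R]_(n, 1 + n) := Q - Q *m G *m w^T *m w.
pose E1 : 'M[R]_(1 + n) := col_mx w Q'.
have E1u : E1 \in unitmx.
  have -> : E1 = block_mx 1%:M 0 (- (Q *m G *m w^T)) 1%:M *m col_mx w Q.
    rewrite mul_block_col mul1mx mul0mx addr0 mul1mx mulNmx addrC.
    by congr col_mx.
  by rewrite unitmx_mul Qu andbT unitmxE det_lblock !det1 mulr1 unitr1.
have QGw : Q' *m G *m w^T = 0.
  by rewrite /Q' mulmxBl mulmxBl -!mulmxA [w *m _]mulmxA wn mulmx1 subrr.
have wGQ : w *m G *m Q'^T = 0.
  by apply: trmx_inj; rewrite !trmx_mul trmxK Gs mulmxA QGw trmx0.
have wUQ : w *m U *m Q'^T = 0 by rewrite wU -scalemxAl wGQ scaler0.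
have QUw : Q' *m U *m w^T = 0.
  by apply: trmx_inj; rewrite trmx0 -wUQ !trmx_mul trmxK Us mulmxA.
have wUw : w *m U *m w^T = a%:M.
  by rewrite wU -scalemxAl wn scale_scalar_mx mulr1.
pose G' := Q' *m G *m Q'^T; pose U' := Q' *m U *m Q'^T.
have blockE (H : 'M[R]_(1 + n)) : E1 *m H *m E1^T =
    block_mx (w *m H *m w^T) (w *m H *m Q'^T) (Q' *m H *m w^T) (Q' *m H *m Q'^T).
  by rewrite /E1 tr_col_mx mul_col_mx mul_col_row.
have GE : E1 *m G *m E1^T = block_mx 1%:M 0 0 G' by rewrite blockE wn wGQ QGw.
have UE : E1 *m U *m E1^T = block_mx a%:M 0 0 U' by rewrite blockE wUw wUQ QUw.
have G'p : posdef G'.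
  have [Es Ep] := posdef_conj E1u Gp; rewrite GE in Es Ep; split=> [|x x0].
    by rewrite /G' !trmx_mul trmxK Gs mulmxA.
  have := Ep (row_mx 0 x); rewrite mul_row_block tr_row_mx mul_row_col !mul0mx !mulmx0 !add0r trmx0 mulmx0 add0r.
  apply; apply: contra x0 => /eqP H0; have := congr1 rsubmx H0.
  by rewrite row_mxKr linear0 => ->.
have U's : U'^T = U' by rewrite /U' !trmx_mul trmxK Us mulmxA.
have G'u := posdef_unitmx G'p.
have E1tu : E1^T \in unitmx by rewrite unitmx_tr.
(* In the new basis the pencil is block diagonal, so ['X - a] splits off and can be cancelled from
   the given factorization. *)
have cp : char_poly (invmx G *m U) = ('X - a%:P) * char_poly (invmx G' *m U').
  have -> : invmx G *m U =
      invmx (invmx E1^T) *m (invmx (block_mx 1%:M 0 0 G') *m block_mx a%:M 0 0 U') *m invmx E1^T.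
    have GI : G = invmx E1 *m block_mx 1%:M 0 0 G' *m invmx E1^T.
      by rewrite -GE -!mulmxA mulmxV // mulmx1 mulmxA mulVmx // mul1mx.
    have UI : U = invmx E1 *m block_mx a%:M 0 0 U' *m invmx E1^T.
      by rewrite -UE -!mulmxA mulmxV // mulmx1 mulmxA mulVmx // mul1mx.
    pose D0 : 'M[R]_(1 + n) := block_mx 1%:M 0 0 G'.
    have Du : D0 \in unitmx.
      by rewrite /D0 -GE !unitmx_mul E1u Gu E1tu.
    apply: (can_inj (mulKmx Gu)); rewrite (mulKVmx Gu).
    rewrite {1}UI {1}GI invmxK -!mulmxA; congr (_ *m _).
    rewrite [invmx E1^T *m _]mulmxA mulVmx // mul1mx.
    by rewrite -/D0 [D0 *m _]mulmxA mulmxV // mul1mx.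
  rewrite char_poly_conj ?unitmx_inv //.
  rewrite invmx_block_diag; last by rewrite -GE !unitmx_mul E1u Gu E1tu.
  rewrite mulmx_block !mul0mx !mulmx0 !addr0 !add0r invmx1 mul1mx.
  rewrite /char_poly /char_poly_mx map_block_mx (scalar_mx_block 1 n) opp_block_mx add_block_mx.
  rewrite !map_mx0 !oppr0 !addr0 det_ublock; congr (_ * _).
  by rewrite map_scalar_mx -raddfB det_scalar1.
have ev' : eigenvalues G' U' (\row_i lam 0 (lift 0 i)).
  have X0 : 'X - a%:P != 0 by rewrite polyXsubC_eq0.
  apply: (mulfI X0).
  rewrite -cp ev big_ord_recl; congr (_ * _); apply: eq_bigr => i _.
  by rewrite mxE.
have [E' [E'G E'U]] := IH _ _ _ G'p U's ev'.
pose E2 : 'M[R]_(1 + n) := block_mx 1%:M 0 0 E' *m E1; exists E2; rewrite /E2.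
have conj (H : 'M[R]_(1 + n)) : block_mx 1%:M 0 0 E' *m E1 *m H *m (block_mx 1%:M 0 0 E' *m E1)^T =
    block_mx 1%:M 0 0 E' *m (E1 *m H *m E1^T) *m (block_mx 1%:M 0 0 E')^T.
  by rewrite trmx_mul !mulmxA.
rewrite !conj GE UE tr_block_mx !trmx0 trmx1.
rewrite !mulmx_block !mul0mx !mulmx0 !addr0 !add0r !mul1mx !mulmx1 mul0mx E'G E'U; split.
  by rewrite -scalar_mx_block.
apply/matrixP => i j; rewrite [in RHS]mxE.
case: (split_ordP i) => i' ->; case: (split_ordP j) => j' ->;
  rewrite ?block_mxEul ?block_mxEur ?block_mxEdl ?block_mxEdr ?mxE ?eq_shift //.
  by rewrite !ord1 /a; congr (lam _ _ *+ _); apply: val_inj.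
by congr (lam _ _ *+ _); apply: val_inj.
Qed.

Lemma eigenvalues_similar n (G U : 'M[R]_n) lam :
  posdef G -> U^T = U -> eigenvalues G U lam ->
  exists2 P, P \in unitmx & invmx G *m U = invmx P *m diag_mx lam *m P.
Proof.
move=> Gp Us ev; have [E [EG EU]] := simultaneous_diag Gp Us ev.
have Gu := posdef_unitmx Gp.
have [Eu /mulmx1_unit[_ Etu]] : E \in unitmx /\ E *m G *m E^T = 1%:M.
  by split=> //; have := mulmx1_unit (etrans (mulmxA _ _ _) EG) => -[].
exists (invmx E^T); first by rewrite unitmx_inv.
rewrite invmxK -EU; apply: (can_inj (mulKmx Gu)); rewrite (mulKVmx Gu).
rewrite -!mulmxA mulmxV // mulmx1 mulmxA mulmxA.
have -> : G *m (E^T *m E) = 1%:M by rewrite mulmxA; apply: mulmx1C; rewrite mulmxA.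
by rewrite mul1mx.
Qed.

End simultaneous_diagonalization.

(** * First derivative of a symmetric function of the eigenvalues *)

Section eigenvalue_derivative.
Variable R : realType.

(** The correction at a new node is a multiple of a polynomial with double zeros at the nodes
    already treated; its affine factor has two free coefficients, one for the value and one for the
    slope. *)
Lemma hermite (s : seq R) (v d : R -> R) : uniq s ->
  exists q : {poly R}, forall a, a \in s -> q.[a] = v a /\ q^`().[a] = d a.
Proof.
elim: s => [|a s IH] /=; first by exists 0.
move=> /andP[as_ /IH[q Hq]].
have [P Pa Pb] : exists2 P : {poly R}, P.[a] != 0 &
    forall b, b \in s -> P.[b] = 0 /\ P^`().[b] = 0.
  exists ((\prod_(b <- s) ('X - b%:P)) ^+ 2).
    rewrite horner_exp expf_neq0 // horner_prod.
    rewrite big_seq prodf_seq_neq0; apply/allP => b bs; apply/implyP => _.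
    by rewrite hornerXsubC subr_eq0; apply: contraNneq as_ => ->.
  move=> b bs; have rb : (\prod_(b <- s) ('X - b%:P)).[b] = 0.
    by apply/eqP; rewrite -rootE root_prod_XsubC.
  rewrite expr2 derivM hornerM hornerD !hornerM; split; first by rewrite rb mul0r.
  by rewrite rb mulr0 mul0r addr0.
pose al := (v a - q.[a]) / P.[a].
pose be := (d a - q^`().[a] - al * P^`().[a]) / P.[a].
exists (q + (al%:P + be *: ('X - a%:P)) * P) => b.
rewrite derivD derivM derivD derivC derivZ derivXsubC !hornerE inE => /predU1P[->|bs].
  rewrite subrr mulr0 addr0; split; first by rewrite /al divfK // addrC subrK.
  by rewrite -[LHS]/(q^`().[a] + be * P.[a] + al * P^`().[a]) /be divfK //; ring.
have [-> ->] := Pb b bs; have [-> ->] := Hq b bs; split; first by rewrite mulr0 addr0.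
rewrite -[LHS]/(d b + be * 0 + (al + be * (b - a)) * 0).
by rewrite !mulr0 !addr0.
Qed.

Lemma poly_diff (q : {poly R}) (a e : R) : 0 < e -> exists2 d : R, 0 < d &
  forall x, `|x - a| <= d -> `|q.[x] - q.[a] - q^`().[a] * (x - a)| <= e * `|x - a|.
Proof.
move=> e0; have := is_derive_has_der setT (is_derive_poly q a).
move=> /has_der_near/(_ e e0)[d d0 H]; exists (d / 2); first by rewrite divr_gt0.
move=> x xd; have := H (x - a); rewrite addr0 [a + _]addrC subrK; apply=> //.
by rewrite (le_lt_trans xd) // ltr_pdivrMr // ltr_pMr // ltr1n.
Qed.

Variable n' : nat.
Local Notation n := n'.+1.

Definition mx_der (M : R -> 'M[R]_n) (B : 'M[R]_n) :=
  forall i j, has_der setT (fun t => M t i j) (B i j).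

Lemma mx_derM M N B C : mx_der M B -> mx_der N C ->
  mx_der (fun t => M t *m N t) (B *m N 0 + M 0 *m C).
Proof.
move=> MB NC i j; rewrite !mxE -big_split /=.
apply: (@has_der_ext _ _ (fun t => \sum_k M t i k * N t k j)) => [t|].
  by rewrite mxE.
by apply: has_der_sum => k _; exact: has_derM (MB i k) (NC k j).
Qed.

Lemma mx_derD M N B C : mx_der M B -> mx_der N C ->
  mx_der (fun t => M t + N t) (B + C).
Proof.
move=> MB NC i j; rewrite !mxE.
apply: (@has_der_ext _ _ (fun t => M t i j + N t i j)) => [t|].
  by rewrite mxE.
exact: has_derD.
Qed.

Lemma mx_der_cst M0 : mx_der (fun=> M0) 0.
Proof. by move=> i j; rewrite mxE; exact: has_der_cst. Qed.

Lemma mx_der_ext M N B : M =1 N -> mx_der M B -> mx_der N B.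
Proof. by move=> /funext ->. Qed.

(* tr (q(M))' = tr (q'(M) M'), with an extra factor h(M) to make the induction on q work. *)
Lemma mx_der_horner M B (q : {poly R}) : mx_der M B ->
  exists2 C, mx_der (fun t => horner_mx (M t) q) C &
    forall h, \tr (C *m horner_mx (M 0) h) = \tr (horner_mx (M 0) (q^`() * h) *m B).
Proof.
move=> MB; elim/poly_ind: q => [|q c [C HC HT]].
  exists 0; first by apply: mx_der_ext (mx_der_cst 0) => t; rewrite rmorph0.
  by move=> h; rewrite deriv0 mul0r mul0mx rmorph0 mul0mx.
exists (C *m M 0 + horner_mx (M 0) q *m B).
  have := mx_derD (mx_derM HC MB) (mx_der_cst c%:M); rewrite addr0.
  by apply: mx_der_ext => t; rewrite rmorphD rmorphM /= horner_mx_X horner_mx_C.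
move=> h; rewrite mulmxDl linearD /= -mulmxA.
have -> : M 0 *m horner_mx (M 0) h = horner_mx (M 0) ('X * h).
  by rewrite rmorphM /= horner_mx_X.
rewrite HT.
have -> : \tr (horner_mx (M 0) q *m B *m horner_mx (M 0) h) =
    \tr (horner_mx (M 0) (h * q) *m B).
  by rewrite -mulmxA mxtrace_mulC -mulmxA mxtrace_mulC rmorphM.
rewrite -linearD /= -mulmxDl -rmorphD /=; congr (\tr (horner_mx _ _ *m _)).
rewrite derivD derivC addr0 derivM derivX mulr1; ring.
Qed.

Lemma mx_der_trace M B (q : {poly R}) (lam : 'rV[R]_n) : mx_der M B ->
  M 0 = diag_mx lam ->
  has_der setT (fun t => \tr (horner_mx (M t) q)) (\sum_i q^`().[lam 0 i] * B i i).
Proof.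
move=> MB M0; have [C HC HT] := mx_der_horner q MB.
have -> : \sum_i q^`().[lam 0 i] * B i i = \tr C.
  have := HT 1; rewrite rmorph1 mulmx1 mulr1 => ->.
  rewrite M0 horner_mx_diag /mxtrace; apply: eq_bigr => i _.
  by rewrite mul_diag_mx !mxE.
by apply: has_der_sum => i _; exact: HC.
Qed.

(** Stated by similarity, so that polynomials in [M] act on the eigenvalues; [lam] is determined
    only up to order. *)
Definition spectrum (M : 'M[R]_n) (lam : 'rV[R]_n) :=
  exists2 P, P \in unitmx & M = invmx P *m diag_mx lam *m P.

Lemma horner_spectrum M lam q : spectrum M lam ->
  exists2 P, P \in unitmx &
    horner_mx M q = invmx P *m diag_mx (\row_i q.[lam 0 i]) *m P.
Proof.
move=> [P Pu ME]; exists P => //.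
have -> : diag_mx (\row_i q.[lam 0 i]) = horner_mx (diag_mx lam) q.
  by rewrite horner_mx_diag; congr diag_mx; apply/rowP => i; rewrite !mxE.
rewrite ME; elim/poly_ind: q => [|q c IH].
  by rewrite !rmorph0 mulmx0 mul0mx.
rewrite !rmorphD !rmorphM /= !horner_mx_X !horner_mx_C IH mulmxDr mulmxDl; congr (_ + _).
  by rewrite -!mulmxE -!mulmxA (mulmxA P) mulmxV // mul1mx.
by rewrite scalar_mxC -mulmxA mulVmx // mulmx1.
Qed.

Lemma trace_spectrum M lam q : spectrum M lam ->
  \tr (horner_mx M q) = \sum_i q.[lam 0 i].
Proof.
move=> /(horner_spectrum q)[P Pu ->].
rewrite mxtrace_mulC mulmxA mulmxV // mul1mx mxtrace_diag.
by apply: eq_bigr => i _; rewrite mxE.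
Qed.

Lemma spectrum_col_perm M lam (s : 'S_n) : spectrum M lam -> spectrum M (col_perm s lam).
Proof.
move=> [P Pu ME]; have Pu' : perm_mx s *m P \in unitmx by rewrite unitmx_mul unitmx_perm.
exists (perm_mx s *m P) => //; apply: (can_inj (mulKmx Pu')).
rewrite -[invmx _ *m _ *m _]mulmxA (mulKVmx Pu') ME -!mulmxA (mulKVmx Pu) !mulmxA.
congr (_ *m _); apply/matrixP => i j; rewrite mul_mx_diag mul_diag_mx !mxE mulrC.
by case: eqP => [->|]; rewrite ?mulr0.
Qed.

Section perturbation.
Variables (M : R -> 'M[R]_n) (B : 'M[R]_n) (lam0 : 'rV[R]_n).
Hypotheses (MB : mx_der M B) (M0 : M 0 = diag_mx lam0).

(** [q] kills the diagonal matrix [M 0], so the entries of [q(M t)] are [O(t)]. The squares of the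
    real numbers [q(lam_i)] add up to the trace of [q(M t)^2], which bounds each of them at a linear
    rate. *)
Lemma root_small (q : {poly R}) : (forall i, q.[lam0 0 i] = 0) ->
  exists2 K, 0 <= K & exists2 d : R, 0 < d & forall t lam, `|t| < d ->
    spectrum (M t) lam -> forall i, `|q.[lam 0 i]| <= K * `|t|.
Proof.
move=> q0; have [C HC _] := mx_der_horner q MB.
have qM0 : horner_mx (M 0) q = 0.
  rewrite M0 horner_mx_diag; apply/matrixP => i j; rewrite !mxE q0.
  by rewrite mul0rn.
pose K := \sum_i \sum_j (`|C i j| + 1).
have K0 : 0 <= K by rewrite sumr_ge0 // => i _; rewrite sumr_ge0 // => j _; rewrite addr_ge0.
exists K => //.
have [d d0 H] : exists2 d : R, 0 < d & forall t, `|t| < d -> forall ij : 'I_n * 'I_n,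
    `|horner_mx (M t) q ij.1 ij.2| <= (`|C ij.1 ij.2| + 1) * `|t|.
  apply: (@common_delta R _ (fun (ij : 'I_n * 'I_n) (t : R) =>
    `|horner_mx (M t) q ij.1 ij.2| <= (`|C ij.1 ij.2| + 1) * `|t|)) => -[i j] /=.
  have [d d0 H] := has_der_lip (HC i j); exists d => // t td.
  by have := H t td I; rewrite qM0 mxE subr0.
exists d => // t lam td Sp i.
have E : \sum_i q.[lam 0 i] ^+ 2 = \sum_i \sum_j horner_mx (M t) q i j * horner_mx (M t) q j i.
  transitivity (\tr (horner_mx (M t) (q * q))).
    by rewrite (trace_spectrum _ Sp); apply: eq_bigr => k _; rewrite hornerM expr2.
  by rewrite rmorphM /mxtrace; apply: eq_bigr => k _; rewrite mxE.
have Kij k j : `|horner_mx (M t) q k j| <= K * `|t|.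
  apply: le_trans (H t td (k, j)) _; rewrite ler_wpM2r //= /K.
  apply: (@le_trans _ _ (\sum_j' (`|C k j'| + 1))).
    by rewrite (bigD1 j) //= lerDl sumr_ge0 // => j' _; rewrite addr_ge0.
  rewrite [leRHS](bigD1 k) //= lerDl sumr_ge0 // => i' _.
  by rewrite sumr_ge0 // => j' _; rewrite addr_ge0.
have le2 : q.[lam 0 i] ^+ 2 <= (K * `|t|) ^+ 2.
  apply: (@le_trans _ _ (\sum_i q.[lam 0 i] ^+ 2)).
    by rewrite (bigD1 i) //= lerDl sumr_ge0 // => k _; exact: sqr_ge0.
  rewrite E; apply: (@le_trans _ _ (\sum_i \sum_j ((`|C i j| + 1) * `|t|) * (K * `|t|))).
    apply: ler_sum => k _; apply: ler_sum => j _.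
    apply: le_trans (ler_norm _) _; rewrite normrM.
    by apply: ler_pM => //; exact: (H t td (k, j)).
  rewrite (_ : \sum_i _ = (K * `|t|) * (K * `|t|)) // /K !mulr_suml.
  apply: eq_bigr => k _; rewrite !mulr_suml; apply: eq_bigr => j _ //.
by rewrite -ler_sqr ?nnegrE // ?mulr_ge0 // real_normK // num_real.
Qed.

(** Take the product of all ['X - lam0_j]: at a point farther than [e] from every root its size is
    at least [e ^+ n], which [root_small] forbids for small [t]. *)
Lemma spectrum_near e : 0 < e -> exists2 d : R, 0 < d &
  forall t lam, `|t| < d -> spectrum (M t) lam ->
    forall i, exists j, `|lam 0 i - lam0 0 j| <= e.
Proof.
move=> e0; pose q : {poly R} := \prod_j ('X - (lam0 0 j)%:P).
have qE x : q.[x] = \prod_j (x - lam0 0 j).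
  by rewrite horner_prod; apply: eq_bigr => j _; rewrite hornerXsubC.
have [|K K0 [d d0 H]] := @root_small q.
  by move=> i; rewrite qE (bigD1 i) //= subrr mul0r.
have K1 : 0 < K + 1 by rewrite ltr_wpDl.
exists (Num.min d (e ^+ n / (K + 1))).
  by rewrite lt_min d0 divr_gt0 // exprn_gt0.
move=> t lam; rewrite lt_min => /andP[td te] Sp i; apply: contrapT => Hn.
have := H t lam td Sp i; apply/negP; rewrite -ltNge.
apply: (@le_lt_trans _ _ ((K + 1) * `|t|)); first by rewrite ler_wpM2r // lerDl.
rewrite mulrC -ltr_pdivlMr //; apply: lt_le_trans te _.
rewrite ler_pM2r ?invr_gt0 // qE normr_prod -{1}(card_ord n) -prodr_const.
apply: ler_prod => j _; rewrite (ltW e0) /= leNgt; apply/negP => /ltW lt.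
by apply: Hn; exists j.
Qed.

(** Nearness ignores multiplicity. The polynomial [q k], equal to 1 at [lam0_k], to 0 at the other
    eigenvalues and flat at all of them, has a trace that nearly counts the eigenvalues close to
    [lam0_k]. The counts at [t] and at 0 differ by less than one, hence agree, and a permutation
    matches the two lists. *)
Lemma spectrum_matching e : 0 < e -> exists2 d : R, 0 < d &
  forall t lam, `|t| < d -> spectrum (M t) lam ->
    exists s : 'S_n, forall j, `|col_perm s lam 0 j - lam0 0 j| <= e.
Proof.
move=> e0; pose vals := undup [seq lam0 0 i | i <- enum 'I_n].
have vals_in i : lam0 0 i \in vals by rewrite mem_undup map_f // mem_enum.
have Hq (k : 'I_n) : exists q : {poly R}, forall j, q.[lam0 0 j] = (lam0 0 j == lam0 0 k)%:R /\ q^`().[lam0 0 j] = 0.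
  have [q Hq] := @hermite vals (fun a => (a == lam0 0 k)%:R) (fun=> 0) (undup_uniq _).
  by exists q => j; apply: Hq.
have [q {}Hq] := choice Hq.
(* An error [r] per eigenvalue costs at most [1 / 4] in the trace; the motion of the trace costs
   another [1 / 4]. *)
pose r : R := (4 * n%:R)^-1.
have r0 : 0 < r by rewrite invr_gt0 mulr_gt0 // ltr0n.
pose Pk (kj : 'I_n * 'I_n) (t : R) := forall x : R, `|x - lam0 0 kj.2| <= `|t| ->
  `|(q kj.1).[x] - (q kj.1).[lam0 0 kj.2]| <= r.
have [e1 e10 He1] : exists2 e1 : R, 0 < e1 & forall t, `|t| < e1 -> forall kj, Pk kj t.
  apply: common_delta.
  move=> [k j] /=; have [d d0 H] := poly_diff (q k) (lam0 0 j) ltr01.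
  exists (Num.min d r); first by rewrite lt_min d0.
  move=> t; rewrite lt_min => /andP[td tr] x xt.
  have := H x (le_trans xt (ltW td)); rewrite (Hq k j).2 mul0r subr0 mul1r.
  by move=> /le_trans; apply; exact: le_trans xt (ltW tr).
pose e2 := Num.min (e1 / 2) e.
have e20 : 0 < e2 by rewrite lt_min divr_gt0.
have e21 : `|e2| < e1.
  rewrite gtr0_norm //; apply: (@le_lt_trans _ _ (e1 / 2)); first by rewrite ge_min lexx.
  by rewrite ltr_pdivrMr // ltr_pMr // ltr1n.
have [d d0 H] := spectrum_near e20.
have [d1 d10 H1] : exists2 d1 : R, 0 < d1 & forall t, `|t| < d1 -> forall k,
    `|\tr (horner_mx (M t) (q k)) - \tr (horner_mx (M 0) (q k))| <= 1 / 4.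
  apply: (@common_delta R _ (fun k (t : R) =>
    `|\tr (horner_mx (M t) (q k)) - \tr (horner_mx (M 0) (q k))| <= 1 / 4)) => k.
  have /has_der_lip := mx_der_trace (q := q k) MB M0.
  have -> : \sum_i (q k)^`().[lam0 0 i] * B i i = 0.
    by apply: big1 => i _; rewrite (Hq k i).2 mul0r.
  move=> [d1 d10 H1]; exists (Num.min d1 (1 / 4)); first by rewrite lt_min d10 divr_gt0.
  move=> t; rewrite lt_min => /andP[td t4]; apply: le_trans (H1 t td I) _.
  by rewrite normr0 add0r mul1r ltW.
exists (Num.min d d1); first by rewrite lt_min d0.
move=> t lam; rewrite lt_min => /andP[td td1] Sp.
have [c Hc] := choice (H t lam td Sp).
have cnt k : (\sum_i ((lam0 0 (c i) == lam0 0 k)%R : nat) =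
    \sum_i ((lam0 0 i == lam0 0 k)%R : nat))%N.
  have := H1 t td1 k; rewrite (trace_spectrum _ Sp).
  have -> : \tr (horner_mx (M 0) (q k)) = \sum_i (lam0 0 i == lam0 0 k)%:R.
    rewrite M0 horner_mx_diag mxtrace_diag; apply: eq_bigr => i _.
    by rewrite mxE (Hq k i).1.
  have near4 : `|\sum_i (q k).[lam 0 i] - \sum_i (lam0 0 (c i) == lam0 0 k)%:R| <= 1 / 4.
    rewrite -sumrB; apply: le_trans (ler_norm_sum _ _ _) _.
    apply: (@le_trans _ _ (\sum_(i < n) r)).
      apply: ler_sum => i _; rewrite -(Hq k (c i)).1.
      by apply: (He1 e2 e21 (k, c i)); rewrite [leRHS]gtr0_norm //; exact: Hc.
    have nn0 : n%:R != 0 :> R by rewrite pnatr_eq0.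
    by rewrite sumr_const card_ord -[r *+ _]mulr_natr /r invfM -mulrA mulVf // mulr1 div1r.
  rewrite -!natr_sum in near4 *; set a := (\sum_i _)%N in near4 *; set b := (\sum_i _)%N in near4 *.
  move=> H2; have ab : `|a%:R - b%:R| < 1 :> R.
    move: near4 H2; rewrite !ler_norml ltr_norml => /andP[h1 h2] /andP[h3 h4].
    by apply/andP; split; lra.
  move: ab; rewrite ltr_norml => /andP[h1 h2]; apply/eqP; rewrite eqn_leq.
  by apply/andP; split; rewrite -ltnS -(ltr_nat R) -natr1; lra.
pose s1 := [tuple lam0 0 (c i) | i < n]; pose s2 := [tuple lam0 0 i | i < n].
have pe : perm_eq s1 s2.
  apply/allP => x xs.
  have [k ->] : exists k, x = lam0 0 k.
    by move: xs; rewrite mem_cat => /orP[] /mapP[k _ ->]; [exists (c k)|exists k].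
  have cE (h : 'I_n -> R) a : count_mem a [tuple h i | i < n] = (\sum_i ((h i == a) : nat))%N.
    rewrite /= count_map -sum1_count big_mkcond big_enum /=; apply: eq_bigr => i _.
    by case: eqP.
  by rewrite /= -/(tval s1) -/(tval s2) !cE; apply/eqP/cnt.
have /tuple_permP[s sE] := pe.
have sE' i : lam0 0 (c i) = lam0 0 (s i).
  have := congr1 (fun z => nth 0 z i) sE.
  by rewrite -!tnth_nth !tnth_mktuple.
exists s^-1%g => j; rewrite mxE.
have := Hc (s^-1%g j); rewrite sE' permKV => /le_trans; apply.
by rewrite ge_min lexx orbT.
Qed.

(* The Hermite polynomial with roots [lam0 0 i] and slopes [df i] there turns
   the trace of a function of [M t] into the linearization of [f]. *)
Lemma spectral_derivative (Gamma : set 'rV[R]_n) (f : 'rV[R]_n -> R) (phi : R -> R) :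
  corner_open pred0 Gamma -> class_C 1 Gamma f ->
  (forall (s : 'S_n) lam, Gamma lam -> Gamma (col_perm s lam)) ->
  (forall (s : 'S_n) lam, Gamma lam -> f (col_perm s lam) = f lam) ->
  Gamma lam0 ->
  (exists2 d : R, 0 < d & forall t, `|t| < d -> exists lam,
     [/\ spectrum (M t) lam, Gamma lam & f lam = phi t]) ->
  has_der setT phi (\sum_i partial Gamma i f lam0 * B i i).
Proof.
move=> HG Cf Gsym fsym G0 [d0 d00 Hphi].
pose df i := partial Gamma i f lam0.
(* Swapping equal entries fixes [lam0], so by symmetry the slope depends only on the value of the
   eigenvalue, as interpolation requires. *)
have dfE i j : lam0 0 i = lam0 0 j -> df i = df j.
  move=> ij; apply/esym/(partial_eq HG G0).
  have := class_C_is_partial (i := i) Cf G0; rewrite -/(df i).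
  have E (t : R) : lam0 + t *: basis_vec R j =
      col_perm (tperm i j) (lam0 + t *: basis_vec R i).
    apply/rowP => k; rewrite [RHS]mxE !lineE; case: tpermP => [->|->|/eqP ki /eqP kj].
    - by rewrite ij [j == i]eq_sym.
    - by rewrite ij !eqxx.
    - by rewrite (negPf ki) (negPf kj).
  have lE : line Gamma j lam0 = line Gamma i lam0.
    apply/seteqP; split=> t; rewrite /line /= => Gt; last by rewrite E; exact: Gsym.
    have := Gsym (tperm i j) _ Gt; rewrite E; congr Gamma.
    by apply/rowP => k; rewrite !mxE tpermK.
  rewrite /is_partial lE; apply: has_der_eq_near.
    by rewrite !line0.
  by exists 1 => // t _ Gt; rewrite E fsym.
pose vals := undup [seq lam0 0 i | i <- enum 'I_n].
have vals_in i : lam0 0 i \in vals by rewrite mem_undup map_f // mem_enum.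
(* Only the values at the nodes are read; 0 is a placeholder elsewhere. *)
pose dfun a := if [pick j | lam0 0 j == a] is Some j then df j else 0.
have dfunE i : dfun (lam0 0 i) = df i.
  rewrite /dfun; case: pickP => [j /eqP /dfE //|/(_ i)]; by rewrite eqxx.
(* [q1] has zeros of slope one at all eigenvalues of [M 0], so [|x - lam0_j| <= 2 |q1(x)|] nearby,
   and [root_small] upgrades the matching to a linear rate in [t]. *)
have [q1 Hq1] := @hermite vals (fun=> 0) (fun=> 1) (undup_uniq _).
have [qf Hqf] := @hermite vals (fun=> 0) dfun (undup_uniq _).
have [K K0 [d1 d10 H1]] := @root_small q1 (fun i => (Hq1 _ (vals_in i)).1).
have rate : exists2 d : R, 0 < d & forall t lam, `|t| < d -> spectrum (M t) lam ->
    forall s : 'S_n, (forall j, `|col_perm s lam 0 j - lam0 0 j| <= d) ->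
    forall j, `|col_perm s lam 0 j - lam0 0 j| <= 2 * K * `|t|.
  pose Pk (j : 'I_n) (t : R) := forall x : R, `|x - lam0 0 j| <= `|t| ->
     `|x - lam0 0 j| <= 2 * `|q1.[x]|.
  have [d2 d20 H2] : exists2 d2 : R, 0 < d2 & forall t, `|t| < d2 -> forall j, Pk j t.
    apply: common_delta => j; have h0 : 0 < 2^-1 :> R by rewrite invr_gt0.
    have [d2 d20 H2] := poly_diff q1 (lam0 0 j) h0.
    exists d2 => // t td x xt; have := H2 x (le_trans xt (ltW td)).
    have [-> ->] := Hq1 _ (vals_in j); rewrite subr0 mul1r distrC => H3.
    have := ler_normD (q1.[x]) (x - lam0 0 j - q1.[x]); rewrite addrC subrK.
    by rewrite -(distrC q1.[x]) => H4; rewrite distrC in H3; lra.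
  exists (Num.min d1 (d2 / 2)); first by rewrite lt_min d10 divr_gt0.
  move=> t lam; rewrite lt_min => /andP[td1 td2] Sp s Hs j.
  have d2d : `|d2 / 2| < d2 by rewrite gtr0_norm ?divr_gt0 // ltr_pdivrMr // ltr_pMr // ltr1n.
  apply: (@le_trans _ _ (2 * `|q1.[col_perm s lam 0 j]|)).
    apply: (H2 _ d2d j); apply: le_trans (Hs j) _.
    by rewrite gtr0_norm ?divr_gt0 // ge_min lexx orbT.
  by rewrite -mulrA ler_wpM2l // mxE; apply: H1.
have [d3 d30 H3] := rate.
have all_near e : 0 < e -> exists2 d : R, 0 < d & forall t, `|t| < d -> exists lam,
    [/\ spectrum (M t) lam, Gamma lam, f lam = phi t,
        forall j, `|lam 0 j - lam0 0 j| <= e &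
        forall j, `|lam 0 j - lam0 0 j| <= 2 * K * `|t|].
  move=> e0; have e30 : 0 < Num.min e d3 by rewrite lt_min e0.
  have [d4 d40 H4] := spectrum_matching e30.
  exists (Num.min d0 (Num.min d3 d4)); first by rewrite !lt_min d00 d30.
  move=> t; rewrite !lt_min => /and3P[t0 t3 t4].
  have [lam [Sp Gl fl]] := Hphi t t0; have [s Hs] := H4 t lam t4 Sp.
  exists (col_perm s lam); split; [|exact: Gsym|by rewrite fsym| |].
  - exact: spectrum_col_perm.
  - by move=> j; apply: le_trans (Hs j) _; rewrite ge_min lexx.
  - apply: H3 => // j; apply: le_trans (Hs j) _; by rewrite ge_min lexx orbT.
have phi0 : phi 0 = f lam0.
  have [d Hd0 Hd] := all_near 1 ltr01.
  have [|lam [_ _ <- _ HK]] := Hd 0; first by rewrite normr0.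
  congr f; apply/rowP => j; apply/eqP; rewrite -subr_eq0 -normr_le0.
  by apply: le_trans (HK j) _; rewrite normr0 mulr0.
apply/has_der_near => e e0.
(* [S |t|] bounds the total displacement of the eigenvalues; with [e1 = e / (3 S)] the Taylor errors
   of [f] and of [qf] and the error of the trace are each at most [e |t| / 3]. *)
pose S := n%:R * (2 * K) + 1.
have nK0 : 0 <= n%:R * (2 * K) :> R by rewrite mulr_ge0 ?ler0n // mulr_ge0.
have S0 : 0 < S by rewrite ltr_wpDl.
pose e1 := e / (3 * S).
have e10 : 0 < e1 by rewrite divr_gt0 // mulr_gt0.
have [d4 d40 H4] := frechet HG Cf G0 e10.
pose Pk (j : 'I_n) (t : R) := forall x : R, `|x - lam0 0 j| <= `|t| ->
  `|qf.[x] - df j * (x - lam0 0 j)| <= e1 * `|x - lam0 0 j|.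
have [d5 d50 H5] : exists2 d5 : R, 0 < d5 & forall t, `|t| < d5 -> forall j, Pk j t.
  apply: common_delta => j; have [d d0' H] := poly_diff qf (lam0 0 j) e10.
  exists d => // t td x xt; have := H x (le_trans xt (ltW td)).
  by have [-> ->] := Hqf _ (vals_in j); rewrite subr0 dfunE.
have e50 : 0 < Num.min (d4 / 2) (d5 / 2) by rewrite lt_min !divr_gt0.
have [d6 d60 H6] := all_near _ e50.
have e3 : 0 < e / 3 by rewrite divr_gt0.
have /has_der_near/(_ _ e3)[d7 d70 H7] := mx_der_trace (q := qf) MB M0.
exists (Num.min d6 d7); first by rewrite lt_min d60.
move=> t; rewrite lt_min => /andP[t6 t7] _.
have [lam [Sp Gl fl Hnear HK]] := H6 t t6.
have sumK : \sum_j `|lam 0 j - lam0 0 j| <= S * `|t|.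
  apply: (@le_trans _ _ (\sum_(j < n) 2 * K * `|t|)); first exact: ler_sum.
  by rewrite sumr_const card_ord -[_ *+ n]mulr_natl mulrA ler_wpM2r // lerDl.
have e1S : e1 * (S * `|t|) = e / 3 * `|t|.
  by rewrite /e1; field; rewrite gt_eqF.
have Hf : `|phi t - phi 0 - \sum_j (lam 0 j - lam0 0 j) * df j| <= e / 3 * `|t|.
  have := H4 (lam - lam0); rewrite [lam0 + _]addrC subrK => H.
  have {}H := H _ Gl.
  rewrite phi0 -fl -e1S.
  have sE : \sum_i (lam - lam0) 0 i * partial Gamma i f lam0 = \sum_j (lam 0 j - lam0 0 j) * df j.
    by apply: eq_bigr => j _; rewrite !mxE.
  have nE : \sum_i `|(lam - lam0) 0 i| = \sum_j `|lam 0 j - lam0 0 j|.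
    by apply: eq_bigr => j _; rewrite !mxE.
  rewrite sE nE in H; apply: le_trans (H _) _; last by rewrite ler_wpM2l // ltW.
  move=> j; rewrite !mxE; apply: le_lt_trans (Hnear j) _.
  rewrite gt_min; apply/orP; left; by rewrite ltr_pdivrMr // ltr_pMr // ltr1n.
have Hq : `|\sum_j qf.[lam 0 j] - \sum_j (lam 0 j - lam0 0 j) * df j| <= e / 3 * `|t|.
  rewrite -sumrB -e1S; apply: le_trans (ler_norm_sum _ _ _) _.
  apply: (@le_trans _ _ (\sum_j e1 * `|lam 0 j - lam0 0 j|)); last first.
    by rewrite -mulr_sumr ler_wpM2l // ltW.
  apply: ler_sum => j _; rewrite [_ * df j]mulrC.
  have d5d : `|d5 / 2| < d5 by rewrite gtr0_norm ?divr_gt0 // ltr_pdivrMr // ltr_pMr // ltr1n.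
  apply: (H5 _ d5d j); apply: le_trans (Hnear j) _.
  by rewrite gtr0_norm ?divr_gt0 // ge_min lexx orbT.
have := H7 t t7 I; rewrite (trace_spectrum _ Sp).
have -> : \tr (horner_mx (M 0) qf) = 0.
  rewrite M0 horner_mx_diag mxtrace_diag; apply: big1 => i _.
  by rewrite mxE (Hqf _ (vals_in i)).1.
rewrite subr0.
have -> : \sum_i qf^`().[lam0 0 i] * B i i = \sum_i df i * B i i.
  by apply: eq_bigr => i _; rewrite (Hqf _ (vals_in i)).2 dfunE.
rewrite -/(\sum_i df i * B i i).
set b := \sum_i df i * B i i * t.
move: Hf Hq; set A1 := \sum_j (_ - _) * _; set A2 := \sum_j _.[_].
rewrite !ler_norml => /andP[h1 h2] /andP[h3 h4] /andP[h5 h6].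
by apply/andP; split; lra.
Qed.

End perturbation.
End eigenvalue_derivative.

(** * Smoothness of the geometric coefficients *)

Lemma congrD (V : nmodType) (a b c d : V) : a = b -> c = d -> a + c = b + d.
Proof. by move=> -> ->. Qed.

Lemma congrB (V : zmodType) (a b c d : V) : a = b -> c = d -> a - c = b - d.
Proof. by move=> -> ->. Qed.

Lemma congrM (V : pzRingType) (a b c d : V) : a = b -> c = d -> a * c = b * d.
Proof. by move=> -> ->. Qed.

Section smooth_closure.
Variables (R : realType) (n : nat) (L : pred 'I_n) (A : set 'rV[R]_n).
Hypothesis HA : corner_open L A.
Implicit Types (f g : 'rV[R]_n -> R).

Lemma smooth_cst (a : R) : smooth A (fun=> a).
Proof. by move=> k; exact: (class_C_cst HA). Qed.

Lemma smoothD f g : smooth A f -> smooth A g -> smooth A (fun y => f y + g y).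
Proof. by move=> Sf Sg k; apply: (class_CD HA). Qed.

Lemma smoothB f g : smooth A f -> smooth A g -> smooth A (fun y => f y - g y).
Proof. by move=> Sf Sg k; apply: (class_CB HA). Qed.

Lemma smoothN f : smooth A f -> smooth A (fun y => - f y).
Proof. by move=> Sf k; apply: (class_CN HA). Qed.

Lemma smoothM f g : smooth A f -> smooth A g -> smooth A (fun y => f y * g y).
Proof. by move=> Sf Sg k; apply: (class_CM HA). Qed.

Lemma smoothV f : (forall x, A x -> f x != 0) -> smooth A f -> smooth A (fun y => (f y)^-1).
Proof. by move=> f0 Sf k; apply: (class_CV HA). Qed.

Lemma smooth_sqrt f : (forall x, A x -> 0 < f x) -> smooth A f ->
  smooth A (fun y => Num.sqrt (f y)).
Proof. by move=> f0 Sf k; apply: (class_C_sqrt HA). Qed.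

Lemma smooth_coord i : smooth A (fun y => y 0 i).
Proof. by move=> k; exact: (class_C_coord HA). Qed.

Lemma smooth_sum (I : Type) (r : seq I) (P : pred I) (F : I -> 'rV[R]_n -> R) :
  (forall q, P q -> smooth A (F q)) -> smooth A (fun y => \sum_(q <- r | P q) F q y).
Proof. by move=> SF k; apply: (class_C_sum HA) => q Pq; exact: SF. Qed.

Lemma smooth_prod (I : Type) (r : seq I) (F : I -> 'rV[R]_n -> R) :
  (forall q, smooth A (F q)) -> smooth A (fun y => \prod_(q <- r) F q y).
Proof. by move=> SF k; apply: (class_C_prod HA) => q; exact: SF. Qed.

Lemma smooth_partial i f : smooth A f -> smooth A (partial A i f).
Proof. by move=> Sf k; apply: class_C_partial. Qed.

Lemma smooth_congr f g : (forall y, A y -> f y = g y) -> smooth A f -> smooth A g.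
Proof. by move=> fg Sf k; apply: (class_C_congr HA fg). Qed.

Lemma smooth_det m (F : 'rV[R]_n -> 'M[R]_m) :
  (forall i j, smooth A (fun y => F y i j)) -> smooth A (fun y => \det (F y)).
Proof.
move=> SF; apply: smooth_sum => s _; apply: smoothM; first exact: smooth_cst.
by apply: smooth_prod => i.
Qed.

Lemma smooth_invmx m (F : 'rV[R]_n -> 'M[R]_m) :
  (forall i j, smooth A (fun y => F y i j)) ->
  (forall y, A y -> F y \in unitmx) ->
  forall i j, smooth A (fun y => invmx (F y) i j).
Proof.
move=> SF Fu i j.
apply: (@smooth_congr (fun y => (\det (F y))^-1 * cofactor (F y) j i)).
  by move=> y Ay; rewrite /invmx Fu // !mxE.
apply: smoothM.
  apply: smoothV; last exact: smooth_det.
  by move=> x Ax; have := Fu x Ax; rewrite unitmxE unitfE.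
apply: smoothM; first exact: smooth_cst.
apply: smooth_det => a b; apply: smooth_congr (SF (lift j a) (lift i b)) => y _.
by rewrite !mxE.
Qed.

End smooth_closure.

(** * Regularity and symmetries of the tensors built from a metric *)

Section metric_coefficients.
Variables (R : realType) (n : nat) (L : pred 'I_n) (A : set 'rV[R]_n).
Hypothesis HA : corner_open L A.
Variable G : 'rV[R]_n -> 'M[R]_n.
Hypothesis Gsm : forall i j, smooth A (fun x => G x i j).
Hypothesis Gpos : forall x, A x -> posdef (G x).

Lemma Gsym x i j : A x -> G x i j = G x j i.
Proof. by move=> /Gpos[Gs _]; rewrite -{1}Gs mxE. Qed.

Lemma Gunit x : A x -> G x \in unitmx.
Proof. by move=> /Gpos/posdef_unitmx. Qed.

Lemma ginv_sym x i j : A x -> ginv G x i j = ginv G x j i.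
Proof. by move=> Ax; rewrite /ginv; have [Gs _] := Gpos Ax; rewrite -{1}Gs -trmx_inv mxE. Qed.

Lemma smooth_ginv i j : smooth A (fun x => ginv G x i j).
Proof. exact: (smooth_invmx HA Gsm Gunit). Qed.

Lemma smooth_christoffel k i j : smooth A (christoffel A G k i j).
Proof.
apply: (smoothM HA); first exact: (smooth_cst HA).
apply: (smooth_sum HA) => l _; apply: (smoothM HA); first exact: smooth_ginv.
by apply: (smoothB HA); first apply: (smoothD HA); exact: smooth_partial.
Qed.

Lemma smooth_riemann l k i j : smooth A (riemann A G l k i j).
Proof.
apply: (smoothD HA).
  by apply: (smoothB HA); apply: smooth_partial; exact: smooth_christoffel.
apply: (smooth_sum HA) => m _.
by apply: (smoothB HA); apply: (smoothM HA); exact: smooth_christoffel.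
Qed.

Lemma smooth_ricci i j : smooth A (fun x => ricci A G x i j).
Proof.
apply: (smooth_congr HA (f := fun x => \sum_k riemann A G k j k i x)) => [y _|].
  by rewrite mxE.
by apply: (smooth_sum HA) => k _; exact: smooth_riemann.
Qed.

Lemma smooth_scalar_curvature : smooth A (scalar_curvature A G).
Proof.
apply: (smooth_sum HA) => i _; apply: (smooth_sum HA) => j _.
by apply: (smoothM HA); [exact: smooth_ginv | exact: smooth_ricci].
Qed.

Lemma smooth_schouten i j : smooth A (fun x => schouten A G x i j).
Proof.
apply: (smooth_congr HA (f := fun x => (n%:R - 2)^-1 *
   (ricci A G x i j - (scalar_curvature A G x * (2 * (n%:R - 1))^-1) * G x i j))) => [y _|].
  by rewrite !mxE.
apply: (smoothM HA); first exact: (smooth_cst HA).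
apply: (smoothB HA); first exact: smooth_ricci.
apply: (smoothM HA) => //; apply: (smoothM HA); first exact: smooth_scalar_curvature.
exact: (smooth_cst HA).
Qed.

Variable N : 'I_n.

Lemma ginvNN_gt0 x : A x -> 0 < ginv G x N N.
Proof. by move=> Ax; apply: ginv_NN_gt0; exact: Gpos. Qed.

Lemma smooth_sqrt_ginvNN : smooth A (fun x => (Num.sqrt (ginv G x N N))^-1).
Proof.
apply: (smoothV HA) => [x Ax|]; first by rewrite gt_eqF // sqrtr_gt0 ginvNN_gt0.
by apply: (smooth_sqrt HA) => [x|]; [exact: ginvNN_gt0 | exact: smooth_ginv].
Qed.

Lemma smooth_unit_normal k : smooth A (unit_normal G N k).
Proof. by apply: (smoothM HA); [exact: smooth_ginv | exact: smooth_sqrt_ginvNN]. Qed.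

Lemma smooth_nabla_normal a k : smooth A (nabla_normal A G N a k).
Proof.
apply: (smoothD HA); first by apply: smooth_partial; exact: smooth_unit_normal.
apply: (smooth_sum HA) => l _.
by apply: (smoothM HA); [exact: smooth_christoffel | exact: smooth_unit_normal].
Qed.

Lemma smooth_second_fund a b : smooth A (fun x => second_fund A G N x a b).
Proof.
apply: (smooth_congr HA (f := fun x => - \sum_k nabla_normal A G N (lift N a) k x * G x k (lift N b))) => [y _|].
  by rewrite mxE.
apply: (smoothN HA); apply: (smooth_sum HA) => k _.
by apply: (smoothM HA) => //; exact: smooth_nabla_normal.
Qed.

Lemma posdef_bd_metric x : A x -> posdef (bd_metric G N x).
Proof.
move=> Ax; have [Gs Gp] := Gpos Ax; split.
  by apply/matrixP => i j; rewrite !mxE Gsym.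
(* A boundary vector extended by 0 in the slot [N]; on such vectors the full metric is
   [bd_metric]. *)
move=> v v0; pose w : 'rV[R]_n := \row_i (if unlift N i is Some j then v 0 j else 0).
have wN : w 0 N = 0 by rewrite mxE unlift_none.
have wl j : w 0 (lift N j) = v 0 j by rewrite mxE liftK.
have w0 : w != 0.
  apply: contra_neq v0 => w0; apply/rowP => j; by rewrite -wl w0 !mxE.
have sumE (F : 'I_n -> R) : F N = 0 -> \sum_i F i = \sum_j F (lift N j).
  move=> FN; rewrite (bigD1 N) //= FN add0r.
  rewrite (reindex_omap (lift N) (unlift N)); last by move=> i iN; case: unliftP iN => [j ->|->] //; rewrite eqxx.
  by apply: eq_bigl => j; rewrite liftK eqxx andbT eq_sym neq_lift.
have := Gp w w0.
have -> : (w *m G x *m w^T) 0 0 = (v *m bd_metric G N x *m v^T) 0 0.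
  rewrite mxE sumE; last by rewrite [w^T _ _]mxE wN mulr0.
  rewrite [RHS]mxE; apply: eq_bigr => j _; apply: congrM; last by rewrite [LHS]mxE wl [RHS]mxE.
  rewrite mxE [RHS]mxE sumE; last by rewrite wN mul0r.
  by apply: eq_bigr => i _; rewrite wl !mxE.
by [].
Qed.

Lemma smooth_mean_curvature : smooth A (mean_curvature A G N).
Proof.
apply: (smoothM HA); first exact: (smooth_cst HA).
apply: (smooth_sum HA) => i _.
apply: (smooth_congr HA (f := fun x => \sum_j invmx (bd_metric G N x) i j * second_fund A G N x j i)) => [y _|].
  by rewrite mxE.
apply: (smooth_sum HA) => j _; apply: (smoothM HA); last exact: smooth_second_fund.
apply: (smooth_invmx HA) => [a b|y Ay]; last exact/posdef_unitmx/posdef_bd_metric.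
by apply: (smooth_congr HA _ (Gsm (lift N a) (lift N b))) => y _; rewrite !mxE.
Qed.

Lemma christoffel_sym k i j x : A x -> christoffel A G k i j x = christoffel A G k j i x.
Proof.
move=> Ax; apply: congrM; first by []; apply: eq_bigr => l _; apply: congrM; first by [].
apply: congrB; first by rewrite addrC.
by apply: partial_congr => // y Ay; exact: Gsym.
Qed.

Lemma sum_ginvG i k x : A x -> \sum_j ginv G x i j * G x j k = (i == k)%:R.
Proof.
move=> Ax; transitivity ((ginv G x *m G x) i k); first by rewrite mxE.
by rewrite /ginv mulVmx ?Gunit // mxE.
Qed.

Lemma sum_Gginv i k x : A x -> \sum_j G x i j * ginv G x j k = (i == k)%:R.
Proof.
move=> Ax; transitivity ((G x *m ginv G x) i k); first by rewrite mxE.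
by rewrite /ginv mulmxV ?Gunit // mxE.
Qed.

(** Differentiate [g^-1 g = 1] and multiply by [g^-1] on the right. *)
Lemma dder_ginv v i j x : A x -> dder A v (fun y => ginv G y i j) x =
  - \sum_a \sum_b ginv G x i a * dder A v (fun y => G y a b) x * ginv G x b j.
Proof.
move=> Ax.
have CG a b : class_C 1 A (fun y => G y a b) by exact: Gsm.
have CI a b : class_C 1 A (fun y => ginv G y a b) by exact: smooth_ginv.
have E b : \sum_a dder A v (fun y => ginv G y i a) x * G x a b =
    - \sum_a ginv G x i a * dder A v (fun y => G y a b) x.
  have H : dder A v (fun y => \sum_a ginv G y i a * G y a b) x = 0.
    rewrite (@dv_congr _ _ _ v _ (fun=> (i == b)%:R) x _ Ax) ?(dv_cst HA) //.
    by move=> y Ay; exact: sum_ginvG.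
  rewrite (dv_sum HA Ax) in H; last by move=> a _; apply: (class_CM HA).
  apply/eqP; rewrite -addr_eq0 -big_split /=; apply/eqP; rewrite -[RHS]H; apply: eq_bigr => a _.
  by rewrite (dvM HA Ax).
transitivity (\sum_b (\sum_a dder A v (fun y => ginv G y i a) x * G x a b) * ginv G x b j).
  under eq_bigr do rewrite mulr_suml.
  rewrite exchange_big /= (bigD1 j) //= [X in _ + X]big1 ?addr0 => [|a aj].
    under eq_bigr do rewrite -mulrA.
    by rewrite -mulr_sumr sum_Gginv // eqxx mulr1.
  under eq_bigr do rewrite -mulrA.
  by rewrite -mulr_sumr sum_Gginv // (negPf aj) mulr0.
under eq_bigr do rewrite E mulNr mulr_suml.
by rewrite sumrN exchange_big.
Qed.

Lemma partial_ginv k i j x : A x -> partial A k (fun y => ginv G y i j) x =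
  - \sum_a \sum_b ginv G x i a * partial A k (fun y => G y a b) x * ginv G x b j.
Proof.
move=> Ax; rewrite -dv_basis dder_ginv //; congr (- _).
by apply: eq_bigr => a _; apply: eq_bigr => b _; rewrite dv_basis.
Qed.

(** The right side is the derivative of [log (sqrt (det g))], written without the determinant. *)
Lemma christoffel_trace k x : A x -> \sum_i christoffel A G i i k x =
  2^-1 * \sum_i \sum_l ginv G x i l * partial A k (fun y => G y i l) x.
Proof.
move=> Ax; rewrite -mulr_sumr; congr (_ * _).
have -> : \sum_i \sum_l ginv G x i l *
    (partial A i (fun y => G y k l) x + partial A k (fun y => G y i l) x
     - partial A l (fun y => G y i k) x) =
  \sum_i \sum_l ginv G x i l * partial A i (fun y => G y k l) x +
  \sum_i \sum_l ginv G x i l * partial A k (fun y => G y i l) x -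
  \sum_i \sum_l ginv G x i l * partial A l (fun y => G y i k) x.
  rewrite -big_split -sumrB; apply: eq_bigr => i _.
  rewrite -big_split -sumrB; apply: eq_bigr => l _ /=; ring.
have -> : \sum_i \sum_l ginv G x i l * partial A l (fun y => G y i k) x =
    \sum_i \sum_l ginv G x i l * partial A i (fun y => G y k l) x.
  rewrite exchange_big /=; apply: eq_bigr => i _; apply: eq_bigr => l _.
  by rewrite ginv_sym //; congr (_ * _); apply: partial_congr => // y Ay; exact: Gsym.
by rewrite addrAC subrr add0r.
Qed.

(** The delicate term is [d_j Gamma^i_ik]. By [christoffel_trace] it is a second derivative in
    disguise: one part is symmetric because partials commute, the other because a trace is cyclic.
    The symmetry of [U], hence its diagonalization, rests on this. *)
Lemma ricci_sym j k x : A x -> ricci A G x j k = ricci A G x k j.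
Proof.
move=> Ax.
have CG a b : class_C 2 A (fun y => G y a b) by exact: Gsm.
have dT a b : \sum_i partial A a (christoffel A G i i b) x =
    2^-1 * \sum_i \sum_l (partial A a (fun y => ginv G y i l) x * partial A b (fun y => G y i l) x
       + ginv G x i l * partial A a (partial A b (fun y => G y i l)) x).
  transitivity (partial A a (fun y => \sum_i christoffel A G i i b y) x).
    rewrite -dv_basis (dv_sum HA Ax); last by move=> i _; exact: smooth_christoffel.
    by apply: eq_bigr => i _; rewrite dv_basis.
  rewrite (partial_congr a (fun y Ay => christoffel_trace b Ay)) // -dv_basis.
  have CI i l : class_C 1 A (fun y => ginv G y i l * partial A b (fun z => G z i l) y).
    apply: (class_CM HA); [exact: smooth_ginv | exact: class_C_partial].
  rewrite (dvZ HA Ax); last by apply: (class_C_sum HA) => i _; apply: (class_C_sum HA).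
  congr (_ * _); rewrite (dv_sum HA Ax); last by move=> i _; apply: (class_C_sum HA).
  apply: eq_bigr => i _; rewrite (dv_sum HA Ax) //; apply: eq_bigr => l _.
  rewrite (dvM HA Ax) ?dv_basis //; [exact: smooth_ginv | exact: class_C_partial].
have dTs : \sum_i partial A j (christoffel A G i i k) x = \sum_i partial A k (christoffel A G i i j) x.
  apply: (etrans (dT j k)); apply: (etrans _ (esym (dT k j))); apply: (congr1 (fun z => 2^-1 * z)).
  have S1 : \sum_i \sum_l ginv G x i l * partial A j (partial A k (fun y => G y i l)) x =
            \sum_i \sum_l ginv G x i l * partial A k (partial A j (fun y => G y i l)) x.
    by apply: eq_bigr => i _; apply: eq_bigr => l _; rewrite (partial_comm HA).
  have S2 : \sum_i \sum_l partial A j (fun y => ginv G y i l) x * partial A k (fun y => G y i l) x =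
            \sum_i \sum_l partial A k (fun y => ginv G y i l) x * partial A j (fun y => G y i l) x.
    have E a b : \sum_i \sum_l partial A a (fun y => ginv G y i l) x * partial A b (fun y => G y i l) x =
      - \sum_i \sum_l \sum_c \sum_d ginv G x i c * partial A a (fun y => G y c d) x * ginv G x d l
            * partial A b (fun y => G y i l) x.
      rewrite -sumrN; apply: eq_bigr => i _; rewrite -sumrN; apply: eq_bigr => l _.
      rewrite (partial_ginv a i l Ax) mulNr mulr_suml; apply: (congr1 (fun z => - z)).
      apply: eq_bigr => c _.
      by rewrite mulr_suml.
    rewrite !E; congr (- _).
    transitivity (\sum_c \sum_d \sum_i \sum_l ginv G x i c * partial A j (fun y => G y c d) x *
        ginv G x d l * partial A k (fun y => G y i l) x).
      rewrite (eq_bigr (fun i => \sum_c \sum_l \sum_d ginv G x i c * partial A j (fun y => G y c d) x *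
        ginv G x d l * partial A k (fun y => G y i l) x)); last by move=> i _; exact: exchange_big.
      rewrite exchange_big /=; apply: eq_bigr => c _.
      rewrite (eq_bigr (fun i => \sum_d \sum_l ginv G x i c * partial A j (fun y => G y c d) x *
        ginv G x d l * partial A k (fun y => G y i l) x)); last by move=> i _; exact: exchange_big.
      by rewrite exchange_big.
    apply: eq_bigr => c _; apply: eq_bigr => d _; apply: eq_bigr => i _; apply: eq_bigr => l _.
    have mulrACA' (p q r s : R) : p * q * r * s = p * s * r * q by ring.
    rewrite (ginv_sym i c Ax) (ginv_sym d l Ax); exact: mulrACA'.
  have spl a b : \sum_i \sum_l (partial A a (fun y => ginv G y i l) x * partial A b (fun y => G y i l) x
       + ginv G x i l * partial A a (partial A b (fun y => G y i l)) x) =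
     \sum_i \sum_l partial A a (fun y => ginv G y i l) x * partial A b (fun y => G y i l) x +
     \sum_i \sum_l ginv G x i l * partial A a (partial A b (fun y => G y i l)) x.
    by rewrite -big_split; apply: eq_bigr => i _; rewrite big_split.
  apply: (etrans (spl j k)); apply: (etrans _ (esym (spl k j))); exact: (congrD S2 S1).
rewrite !mxE /riemann.
have expand a b : \sum_i (partial A i (christoffel A G i a b) x - partial A a (christoffel A G i i b) x +
    \sum_m (christoffel A G i i m x * christoffel A G m a b x -
            christoffel A G i a m x * christoffel A G m i b x)) =
  \sum_i partial A i (christoffel A G i a b) x - \sum_i partial A a (christoffel A G i i b) x +
  (\sum_i \sum_m christoffel A G i i m x * christoffel A G m a b x -
   \sum_i \sum_m christoffel A G i a m x * christoffel A G m i b x).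
  rewrite big_split /= sumrB; congr (_ + _).
  by rewrite -sumrB; apply: eq_bigr => i _; rewrite sumrB.
rewrite !expand dTs; apply: congrD; first (apply: congrB; last by []); last apply: congrB.
- by apply: eq_bigr => i _; apply: partial_congr => // y Ay; exact: christoffel_sym.
- by apply: eq_bigr => i _; apply: eq_bigr => m _; apply: congrM; [by [] | exact: christoffel_sym].
rewrite exchange_big /=; apply: eq_bigr => i _; apply: eq_bigr => m _.
by rewrite mulrC; apply: congrM; exact: christoffel_sym.
Qed.

Lemma U_tensor_sym v x : class_C 2 A v -> A x -> (U_tensor A G v x)^T = U_tensor A G v x.
Proof.
move=> Cv Ax; apply/matrixP => i j; rewrite !mxE.
rewrite [G x j i]Gsym //; apply: congrD; first (apply: congrB; last by []).
- apply: congrD; last by rewrite mulrC.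
  rewrite (partial_comm HA _ _ Cv Ax); apply: congrB; first by [].
  by apply: eq_bigr => k _; rewrite christoffel_sym.
- apply: congrM; first by [].
  apply: congrB; last by [].
  by have := ricci_sym j i Ax; rewrite !mxE.
Qed.

End metric_coefficients.

(** * Independence of the local formulas from the domain *)

Section restriction.
Variables (R : realType) (n : nat) (L : pred 'I_n) (A B : set 'rV[R]_n).
Hypotheses (HA : corner_open L A) (HB : corner_open L B) (AB : A `<=` B).

Lemma restriction_near x : A x ->
  exists2 d : R, 0 < d &
    forall y : 'rV[R]_n, (forall j, `|y 0 j - x 0 j| < d) -> A y <-> B y.
Proof.
move=> Ax; have [d d0 H] := corner_open_near HA Ax; exists d => // y yd.
split; first exact: AB.
by move=> By; apply: H => //; exact: (corner_open_sub HB By).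
Qed.

(** The two functions need agree only on [A]; this is the situation of iterated derivatives, whose
    inner derivative is itself rewritten only there. *)
Lemma partial_restrict i f g x : (forall y, A y -> f y = g y) -> A x ->
  partial B i f x = partial A i g x.
Proof.
move=> fg Ax; rewrite -(partial_congr i fg Ax); apply/esym/partial_local.
exact: restriction_near.
Qed.

Lemma partial_restrict_id i f x : A x -> partial B i f x = partial A i f x.
Proof. exact: partial_restrict. Qed.

Lemma class_C_restrict k f : class_C k B f -> class_C k A f.
Proof.
elim: k f => [|k IH] f.
  rewrite !class_C0 => /withinP cf; apply/withinP => x Ax e e0.
  have [d d0 H] := cf x (AB Ax) e e0.
  by exists d => // y yd Ay; apply: H => //; exact: AB.
move=> /class_CS[cf pf Hf]; apply/class_CS; split.
- apply: class_C_continuous (IH f _); apply: class_CW; exact/class_CS.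
- move=> i x Ax; have := pf i x (AB Ax); rewrite /partial_ex.
  by rewrite -(punctured_line_local i (restriction_near Ax)).
- move=> i; apply: (class_C_congr HA _ (IH _ (Hf i))) => y Ay.
  exact: partial_restrict.
Qed.

Variables (G : 'rV[R]_n -> 'M[R]_n) (N : 'I_n).

Lemma christoffel_restrict k i j x : A x -> christoffel B G k i j x = christoffel A G k i j x.
Proof.
by move=> Ax; apply: congrM; first by []; apply: eq_bigr => l _; rewrite !partial_restrict_id.
Qed.

Lemma ricci_restrict x : A x -> ricci B G x = ricci A G x.
Proof.
move=> Ax; apply/matrixP => i j; rewrite !mxE; apply: eq_bigr => k _.
rewrite /riemann; apply: congrD; first apply: congrB.
- by apply: partial_restrict => // y Ay; exact: christoffel_restrict.
- by apply: partial_restrict => // y Ay; exact: christoffel_restrict.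
- by apply: eq_bigr => m _; rewrite !christoffel_restrict.
Qed.

Lemma grad_sq_restrict v x : A x -> grad_sq B G v x = grad_sq A G v x.
Proof.
move=> Ax; apply: eq_bigr => i _; apply: eq_bigr => j _.
by rewrite !partial_restrict_id.
Qed.

Lemma U_tensor_restrict v x : A x -> U_tensor B G v x = U_tensor A G v x.
Proof.
move=> Ax; rewrite /U_tensor /schouten /scalar_curvature ricci_restrict // grad_sq_restrict //.
apply: congrD; last by [].
apply: congrB; last by [].
apply: congrD; apply/matrixP => i j; rewrite !mxE.
  rewrite (@partial_restrict i _ (partial A j v)) //; last by move=> y Ay; exact: partial_restrict.
  apply: congrB; first by []; apply: eq_bigr => k _.
  by rewrite christoffel_restrict // partial_restrict_id.
by rewrite !partial_restrict_id.
Qed.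

Lemma normal_deriv_restrict v x : A x -> normal_deriv B G N v x = normal_deriv A G N v x.
Proof. by move=> Ax; apply: eq_bigr => k _; rewrite partial_restrict_id. Qed.

Lemma mean_curvature_restrict x : A x -> mean_curvature B G N x = mean_curvature A G N x.
Proof.
move=> Ax; apply: congrM; first by []; congr (\tr (_ *m _)); apply/matrixP => a b; rewrite !mxE; congr (- _).
apply: eq_bigr => k _; apply: congrM; last by []; apply: congrD; first exact: partial_restrict.
by apply: eq_bigr => l _; rewrite christoffel_restrict.
Qed.

End restriction.

(** * The final inequality *)

Section domination.
Variables (R : realType) (I : Type).
Implicit Types F H A B : I -> R.

(* [I] indexes all the data of an a priori estimate, so that the constant is
   uniform in them. *)
Definition dominated F H := exists2 K : R, 0 <= K & forall i, `|F i| <= K * H i.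

Lemma dominatedD F1 F2 H : dominated F1 H -> dominated F2 H ->
  dominated (fun i => F1 i + F2 i) H.
Proof.
move=> [K1 K10 H1] [K2 K20 H2]; exists (K1 + K2); first exact: addr_ge0.
by move=> i; rewrite mulrDl (le_trans (ler_normD _ _)) // lerD.
Qed.

Lemma dominatedN F H : dominated F H -> dominated (fun i => - F i) H.
Proof. by move=> [K K0 HK]; exists K => // i; rewrite normrN. Qed.

Lemma dominatedB F1 F2 H : dominated F1 H -> dominated F2 H ->
  dominated (fun i => F1 i - F2 i) H.
Proof. by move=> D1 D2; apply: dominatedD => //; exact: dominatedN. Qed.

Lemma dominatedM F1 F2 A B : dominated F1 A -> dominated F2 B ->
  dominated (fun i => F1 i * F2 i) (fun i => A i * B i).
Proof.
move=> [K1 K10 H1] [K2 K20 H2]; exists (K1 * K2); first exact: mulr_ge0.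
by move=> i; rewrite normrM mulrACA ler_pM.
Qed.

Lemma dominated0 H : (forall i, 0 <= H i) -> dominated (fun=> 0) H.
Proof. by move=> H0; exists 0 => // i; rewrite normr0 mul0r. Qed.

Lemma dominated_sum (J : Type) (r : seq J) (P : pred J) (F : J -> I -> R) H :
  (forall i, 0 <= H i) -> (forall j, dominated (F j) H) ->
  dominated (fun i => \sum_(j <- r | P j) F j i) H.
Proof.
move=> H0 DF; elim: r => [|j r IH].
  by have := dominated0 H0; congr dominated; apply/funext => i; rewrite big_nil.
have [Pj|Pj] := boolP (P j).
  have := dominatedD (DF j) IH; congr dominated.
  by apply/funext => i; rewrite big_cons Pj.
by have := IH; congr dominated; apply/funext => i; rewrite big_cons (negPf Pj).
Qed.

Lemma dominated_cst (c : R) : dominated (fun=> c) (fun=> 1).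
Proof. by exists `|c| => // i; rewrite mulr1. Qed.

Lemma dominated_trans F A B : dominated F A -> dominated A B -> dominated F B.
Proof.
move=> [K1 K10 H1] [K2 K20 H2]; exists (K1 * K2); first exact: mulr_ge0.
move=> i; apply: le_trans (H1 i) _; rewrite -mulrA ler_wpM2l //.
exact: le_trans (ler_norm _) (H2 i).
Qed.

Lemma dominated_ext F1 F2 A : F1 =1 F2 -> dominated F1 A -> dominated F2 A.
Proof. by move=> /funext ->. Qed.

End domination.

(** * The algebraic inequality at a maximum point *)

Section final_inequality.
Variable R : realType.

Lemma young (K y p : R) : K * y * `|p| *+ 2 <= p ^+ 2 + (K * y) ^+ 2.
Proof.
rewrite -(real_normK (num_real p)) -subr_ge0.
have -> : `|p| ^+ 2 + (K * y) ^+ 2 - K * y * `|p| *+ 2 = (`|p| - K * y) ^+ 2 by ring.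
exact: sqr_ge0.
Qed.

(* [p] is the covariant derivative of [om] in a frame where the tensor [U] has
   eigenvalues [lam]; the assumptions are the first and second order conditions
   at a maximum point. *)
Lemma gradient_inequality (n : nat) (K eps c1 c0 : R) :
  1 <= K -> 0 < eps -> 0 < c1 -> 0 < c0 ->
  exists2 C : R, 0 < C &
  forall (f lam om sg tau : 'I_n -> R) (p al : 'I_n -> 'I_n -> R) (rho y h : R),
  let a l m := (lam l + 2^-1 * y ^+ 2) * (l == m)%:R - om l * om m in
  let S := y ^+ 3 * h + y ^+ 2 * h ^+ 2 in
  (forall l, 0 < f l) -> c0 <= \sum_l f l ->
  1 <= y -> 0 < h -> 1 <= K * h ->
  y ^+ 2 = \sum_l om l ^+ 2 ->
  (forall l m, `|p l m - a l m| <= K * y) ->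
  (forall l, `|\sum_m om m * a l m| <= K * (y ^+ 2 * h)) ->
  (eps^-1 <= y -> (forall l, `|om l * (lam l - 2^-1 * y ^+ 2)| <= eps * y ^+ 3) ->
    c1 * y ^+ 4 * (\sum_l f l) <=
    \sum_l f l * ((lam l + 2^-1 * y ^+ 2 - om l ^+ 2) ^+ 2 + om l ^+ 2 * (y ^+ 2 - om l ^+ 2))) ->
  (forall l m, `|al l m| <= K * y) -> (forall l, `|sg l| <= K * y) ->
  (forall l, `|tau l| <= K * S) -> `|rho| <= K * y ^+ 2 ->
  \sum_l f l * (2 * (\sum_m p l m ^+ 2) + \sum_m al l m * p l m + sg l * lam l + tau l)
    + rho <= 0 ->
  y <= C * h.
Proof.
move=> K1 eps0 c10 c00.
have split3 (u v w z : R) : 0 <= u -> 0 <= v -> 0 <= w -> u + v + w < z ->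
    [/\ u < z, v < z & w < z].
  by move=> u0 v0 w0 uz; split; lra.
have half_le (u v : R) : 0 <= u -> 0 <= v -> u <= v -> `|u - 2^-1 * v| <= 2 * v.
  by move=> u0 v0 uv; rewrite ler_norml; apply/andP; split; lra.
have K0 : 0 < K := lt_le_trans ltr01 K1.
(* [M] collects the errors per direction, [M2] adds [rho] by means of [c0 <= \sum_l f l], and [M3]
   pays for replacing [p] by [a]. The summands of [C] ensure [h < y], the smallness required by the
   structural condition and the final contradiction. *)
pose M := (n%:R + 1) * K ^+ 3 + 2 * K ^+ 2 + K.
pose M2 := M + K ^+ 2 / c0.
pose M3 := 2 * M2 + 2 * n%:R * K ^+ 3.
have n0 : 0 <= n%:R :> R by [].
have M0 : 0 < M by rewrite /M ltr_wpDl // addr_ge0 ?mulr_ge0 ?exprn_ge0 ?addr_ge0 // ltW.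
have M20 : 0 < M2 by rewrite /M2 ltr_wpDr // divr_ge0 ?exprn_ge0 // ltW.
have M30 : 0 < M3 by rewrite /M3 ltr_wpDr ?mulr_ge0 ?exprn_ge0 ?mulr_gt0 // ltW.
pose C := 1 + K / eps + 2 * M3 / c1.
have Ke0 : 0 < K / eps by rewrite divr_gt0.
have Mc0 : 0 < 2 * M3 / c1 by rewrite divr_gt0 // mulr_gt0.
have C0 : 0 < C by rewrite /C !addr_gt0.
exists C => // f lam om sg tau p al rho y h a S f0 T0 y1 h0 Kh y2 pa oma Hst Hal Hsg Htau Hrho Hmain.
set T := \sum_l f l in T0 Hst.
have Tpos : 0 < T := lt_le_trans c00 T0.
have y0 : 0 < y := lt_le_trans ltr01 y1.
have omy l : om l ^+ 2 <= y ^+ 2.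
  by rewrite y2 (bigD1 l) //= lerDl sumr_ge0 // => m _; exact: sqr_ge0.
have S0 : 0 < S by rewrite /S addr_gt0 ?mulr_gt0 ?exprn_gt0.
(* Because [1 <= K * h], the quantity [S] dominates [y ^+ 3] and with it the lower order errors. *)
have y3S : y ^+ 3 <= K * S.
  apply: (@le_trans _ _ (K * (y ^+ 3 * h))).
    by rewrite mulrCA ler_peMr // exprn_ge0 // ltW.
  by rewrite ler_wpM2l ?(ltW K0) // /S lerDl mulr_ge0 ?exprn_ge0 // ltW.
have y2S : y ^+ 2 <= K * S by apply: le_trans y3S; apply: ler_weXn2l.
have per_l l : (\sum_m p l m ^+ 2) - M * S <=
    2 * (\sum_m p l m ^+ 2) + \sum_m al l m * p l m + sg l * lam l + tau l.
  set P := \sum_m p l m ^+ 2.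
  (* The eigenvalues have no bound of their own; [lam l] is traded for [p l l], which the quadratic
     term can absorb. *)
  have Hlam : `|lam l| <= `|p l l| + K * y + 2 * y ^+ 2.
    have -> : lam l = p l l - (p l l - a l l) + (om l ^+ 2 - 2^-1 * y ^+ 2).
      by rewrite /a eqxx mulr1 expr2; ring.
    apply: le_trans (ler_normD _ _) _; apply: lerD.
      by apply: le_trans (ler_normB _ _) _; rewrite lerD2l.
    exact: half_le (sqr_ge0 _) (sqr_ge0 _) (omy l).
  (* Young's inequality with two copies of the left sum: one absorbs [al * p], the other the part of
     [sg * lam] with [p l l], at the cost of one of the two squares available. *)
  have Hp : \sum_m `|p l m| * (K * y) *+ 2 <= P + n%:R * (K * y) ^+ 2.
    have -> : n%:R * (K * y) ^+ 2 = \sum_(m < n) (K * y) ^+ 2.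
      by rewrite sumr_const card_ord mulr_natl.
    by rewrite /P -big_split; apply: ler_sum => m _; rewrite [`|p l m| * _]mulrC; exact: young.
  have H1 : - (\sum_m `|p l m| * (K * y)) <= \sum_m al l m * p l m.
    rewrite -sumrN; apply: ler_sum => m _.
    apply: le_trans (lerNnormlW (lexx _)); rewrite lerN2 normrM mulrC.
    by rewrite ler_wpM2l.
  have H2 : - (K * y * (`|p l l| + K * y + 2 * y ^+ 2)) <= sg l * lam l.
    apply: le_trans (lerNnormlW (lexx _)); rewrite lerN2 normrM.
    by apply: ler_pM.
  have H3 : - (K * S) <= tau l by apply: le_trans (lerNnormlW (lexx _)); rewrite lerN2.
  have H4 : `|p l l| * (K * y) <= \sum_m `|p l m| * (K * y).
    rewrite (bigD1 l) //= lerDl sumr_ge0 // => m _.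
    by rewrite mulr_ge0 // mulr_ge0 // ltW.
  have E : K * y * (`|p l l| + K * y + 2 * y ^+ 2) =
      `|p l l| * (K * y) + K ^+ 2 * y ^+ 2 + 2 * K * y ^+ 3 by ring.
  rewrite E in H2; rewrite sumrMnl in Hp.
  have H5 : K ^+ 2 * y ^+ 2 <= K ^+ 2 * (K * S) by rewrite ler_wpM2l // exprn_ge0 // ltW.
  have H6 : K * y ^+ 3 <= K * (K * S) by rewrite ler_wpM2l // ltW.
  have H7 : n%:R * (K ^+ 2 * y ^+ 2) <= n%:R * (K ^+ 2 * (K * S)) by rewrite ler_wpM2l.
  rewrite exprMn mulr2n in Hp.
  have EM : M * S = n%:R * (K ^+ 2 * (K * S)) + K ^+ 2 * (K * S) + 2 * (K * (K * S)) + K * S.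
    by rewrite /M; ring.
  rewrite EM.
  move: H1 H2 H3 H4 H5 H6 H7 Hp.
  move: (\sum_m _) (\sum_m _) (sg l * lam l) (tau l) (`|p l l| * (K * y)) => s1 s2 s3 s4 s5.
  rewrite -[2 * K * y ^+ 3]mulrA.
  move: (n%:R * (K ^+ 2 * y ^+ 2)) (n%:R * (K ^+ 2 * (K * S))) (K ^+ 2 * y ^+ 2)
    (K ^+ 2 * (K * S)) (K * (K * S)) (K * S) (K * y ^+ 3) P => q1 q2 q3 q4 q5 q6 q7 P.
  lra.
have sumP : \sum_l f l * (\sum_m p l m ^+ 2) <= M2 * S * T.
  have H1 : \sum_l f l * ((\sum_m p l m ^+ 2) - M * S) <= K ^+ 2 / c0 * S * T.
    apply: (@le_trans _ _ (- rho)).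
      rewrite -[leRHS]add0r -lerBlDr opprK; apply: le_trans Hmain; rewrite lerD2r.
      by apply: ler_sum => l _; rewrite ler_wpM2l // ltW.
    apply: (@le_trans _ _ (K * y ^+ 2)); first by apply: le_trans Hrho; rewrite -normrN ler_norm.
    apply: (@le_trans _ _ (K * (K * S))); first by rewrite ler_wpM2l // ltW.
    have -> : K * (K * S) = K ^+ 2 / c0 * S * c0 by field; rewrite gt_eqF.
    rewrite ler_wpM2l // mulr_ge0 ?(ltW S0) // divr_ge0 ?exprn_ge0 // ltW //.
  have H2 : \sum_l f l * ((\sum_m p l m ^+ 2) - M * S) =
      \sum_l f l * (\sum_m p l m ^+ 2) - M * S * T.
    rewrite /T [M * S * _]mulrC mulr_suml -sumrB; apply: eq_bigr => l _.
    by rewrite mulrBr.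
  rewrite H2 lerBlDr in H1; apply: le_trans H1 _.
  by rewrite /M2 !mulrDl addrC.
(* The bracket of the structural condition is thus the squared norm of the row [a l]; likewise
   [omaE] identifies the smallness hypothesis with a bound on the contraction of [a] with [om]. *)
have aE l : \sum_m a l m ^+ 2 =
    (lam l + 2^-1 * y ^+ 2 - om l ^+ 2) ^+ 2 + om l ^+ 2 * (y ^+ 2 - om l ^+ 2).
  rewrite (bigD1 l) //= {1}/a eqxx mulr1 -expr2; congr (_ + _).
  have -> : y ^+ 2 - om l ^+ 2 = \sum_(m | m != l) om m ^+ 2.
    by rewrite y2 (bigD1 l) //= addrAC subrr add0r.
  rewrite mulr_sumr; apply: eq_bigr => m ml.
  by rewrite /a eq_sym (negPf ml) mulr0 sub0r sqrrN exprMn.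
have omaE l : \sum_m om m * a l m = om l * (lam l - 2^-1 * y ^+ 2).
  transitivity (\sum_m ((lam l + 2^-1 * y ^+ 2) * (om m * (l == m)%:R) - om l * om m ^+ 2)).
    by apply: eq_bigr => m _; rewrite /a; ring.
  rewrite sumrB -!mulr_sumr -y2 (bigD1 l) //= eqxx mulr1 big1 => [|m ml].
    by field.
  by rewrite eq_sym (negPf ml) mulr0.
have sumA : \sum_l f l * (\sum_m a l m ^+ 2) <= M3 * S * T.
  apply: (@le_trans _ _ (\sum_l f l * (2 * (\sum_m p l m ^+ 2) + 2 * n%:R * K ^+ 3 * S))).
    apply: ler_sum => l _; rewrite ler_wpM2l ?(ltW (f0 l)) //.
    apply: (@le_trans _ _ (\sum_m (2 * p l m ^+ 2 + 2 * (K ^+ 2 * (K * S))))).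
      apply: ler_sum => m _.
      have Hd : (p l m - a l m) ^+ 2 <= K ^+ 2 * (K * S).
        apply: (@le_trans _ _ ((K * y) ^+ 2)).
          rewrite -(real_normK (num_real (_ - _))) ler_sqr ?nnegrE //.
          by rewrite mulr_ge0 // ltW.
        by rewrite exprMn ler_wpM2l // exprn_ge0 // ltW.
      apply: (@le_trans _ _ (2 * p l m ^+ 2 + 2 * (p l m - a l m) ^+ 2)).
        rewrite -subr_ge0.
        have -> : 2 * p l m ^+ 2 + 2 * (p l m - a l m) ^+ 2 - a l m ^+ 2 = (2 * p l m - a l m) ^+ 2.
          by ring.
        exact: sqr_ge0.
      by rewrite lerD2l ler_pM2l.
    rewrite big_split /= -mulr_sumr lerD2l sumr_const card_ord -[_ *+ n]mulr_natl.
    by rewrite le_eqVlt; apply/orP; left; apply/eqP; ring.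
  have -> : \sum_l f l * (2 * (\sum_m p l m ^+ 2) + 2 * n%:R * K ^+ 3 * S) =
     2 * (\sum_l f l * (\sum_m p l m ^+ 2)) + 2 * n%:R * K ^+ 3 * S * T.
    rewrite mulr_sumr [_ * T]mulrC /T mulr_suml -big_split; apply: eq_bigr => l _ /=.
    by rewrite mulrDr mulrCA.
  have -> : M3 * S * T = 2 * (M2 * S * T) + 2 * n%:R * K ^+ 3 * S * T by rewrite /M3; ring.
  by rewrite lerD2r ler_pM2l.
rewrite leNgt; apply/negP => Cy.
have [hy Kehy Mhy] : [/\ h < y, K / eps * h < y & 2 * M3 / c1 * h < y].
  have a1 : 0 <= h := ltW h0.
  have a2 : 0 <= K / eps * h by rewrite mulr_ge0 // ltW.
  have a3 : 0 <= 2 * M3 / c1 * h by rewrite mulr_ge0 // ltW.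
  apply: (split3 _ _ _ _ a1 a2 a3).
  by move: Cy; rewrite /C mulrDl [(1 + _) * h]mulrDl mul1r.
have Khy : K * h < eps * y by move: Kehy; rewrite mulrAC ltr_pdivrMr // [y * _]mulrC.
have := Hst; rewrite (eq_bigr (fun l => f l * (\sum_m a l m ^+ 2))); last by move=> l _; rewrite aE.
have -> : eps^-1 <= y.
  by rewrite -[leLHS]mulr1 ler_pdivrMl // (le_trans Kh) // ltW.
move=> /(_ isT) {}Hst.
have {}Hst : c1 * y ^+ 4 * T <= \sum_l f l * \sum_m a l m ^+ 2.
  apply: Hst => l; rewrite -omaE; apply: le_trans (oma l) _.
  have -> : K * (y ^+ 2 * h) = (K * h) * y ^+ 2 by ring.
  have -> : eps * y ^+ 3 = (eps * y) * y ^+ 2 by ring.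
  by rewrite ler_wpM2r ?exprn_ge0 ?(ltW y0) // ltW.
have := le_trans Hst sumA; rewrite ler_pM2r // leNgt => /negP; apply.
have -> : c1 * y ^+ 4 = c1 * y * y ^+ 3 by ring.
apply: (@le_lt_trans _ _ (2 * M3 * h * y ^+ 3)).
  have -> : 2 * M3 * h * y ^+ 3 = M3 * (y ^+ 3 * h + y ^+ 2 * h * y) by ring.
  rewrite ler_pM2l // /S lerD2l expr2 mulrA ler_wpM2l ?(ltW hy) //.
  by rewrite !mulr_ge0 // ltW.
rewrite ltr_pM2r ?exprn_gt0 //.
by move: Mhy; rewrite mulrAC ltr_pdivrMr // [y * _]mulrC.
Qed.

End final_inequality.

(** * The Bernstein test function *)

(* Unfolding these in unification is prohibitively slow. *)
Opaque partial ginv christoffel schouten mean_curvature.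

Section bernstein_identities.
Variables (R : realType) (n : nat) (L : pred 'I_n) (A : set 'rV[R]_n).
Hypothesis HA : corner_open L A.
Variable G : 'rV[R]_n -> 'M[R]_n.
Hypothesis Gsm : forall i j, smooth A (fun x => G x i j).
Hypothesis Gpos : forall x, A x -> posdef (G x).
Variables (beta gam : 'I_n -> 'rV[R]_n -> R).
Hypothesis beta_sm : forall a, smooth A (beta a).
Hypothesis gam_sm : forall a, smooth A (gam a).
Local Notation dv := (dder A).

(* The covector field [du + e^-u beta + gam], whose squared length is the test
   function of the Bernstein argument. *)
Definition shift_form (u : 'rV[R]_n -> R) a x := expR (- u x) * beta a x + gam a x.
Definition test_form u a x := partial A a u x + shift_form u a x.
Definition test_sq u x := \sum_a \sum_b ginv G x a b * (test_form u a x * test_form u b x).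

Variable u : 'rV[R]_n -> R.
Hypothesis Cu : class_C 3 A u.

Let Cu2 : class_C 2 A u. Proof. exact: class_CW. Qed.
Let Cu1 : class_C 1 A u. Proof. exact: class_CW. Qed.

Lemma class_expu : class_C 3 A (fun y => expR (- u y)).
Proof. by apply: (class_C_exp HA); exact: (class_CN HA). Qed.

Lemma class_shift_form a : class_C 3 A (shift_form u a).
Proof.
apply: (class_CD HA); last exact: gam_sm.
by apply: (class_CM HA); [exact: class_expu | exact: beta_sm].
Qed.

Lemma class_test_form a : class_C 2 A (test_form u a).
Proof.
apply: (class_CD HA); first exact: class_C_partial.
by apply: class_CW; exact: class_shift_form.
Qed.

Lemma class_test_sq : class_C 2 A (test_sq u).
Proof.
apply: (class_C_sum HA) => a _; apply: (class_C_sum HA) => b _.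
apply: (class_CM HA); first exact: (smooth_ginv HA Gsm Gpos).
by apply: (class_CM HA); exact: class_test_form.
Qed.

Lemma dv_expu v y : A y -> dv v (fun y => expR (- u y)) y = - (expR (- u y) * dv v u y).
Proof. by move=> Ay; rewrite (dv_exp HA Ay) ?(dvN HA Ay) ?mulrN //; exact: (class_CN HA). Qed.

Lemma dv_shift_form v a y : A y -> dv v (shift_form u a) y =
  expR (- u y) * (dv v (beta a) y - beta a y * dv v u y) + dv v (gam a) y.
Proof.
move=> Ay; have Ce := class_C_le (leq_addl 2 1) class_expu.
have Cb : class_C 1 A (beta a) := beta_sm a 1.
rewrite (dvD HA Ay); [|by apply: (class_CM HA)|exact: gam_sm].
rewrite (dvM HA Ay) // dv_expu //.
move: (expR _) (dv v u y) (dv v (beta a) y) (beta a y) => e d b' b; ring.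
Qed.

Lemma dd_shift_form v a y : A y -> dv v (dv v (shift_form u a)) y =
  expR (- u y) * (dv v (dv v (beta a)) y - 2 * dv v (beta a) y * dv v u y
     - beta a y * dv v (dv v u) y + beta a y * dv v u y ^+ 2) + dv v (dv v (gam a)) y.
Proof.
move=> Ay; have Ce := class_C_le (leq_addl 2 1) class_expu.
have Cb : class_C 2 A (beta a) := beta_sm a 2.
have Cb1 : class_C 1 A (beta a) := beta_sm a 1.
have Cdb : class_C 1 A (dv v (beta a)) by exact: (class_C_dv HA).
have Cdg : class_C 1 A (dv v (gam a)) by apply: (class_C_dv HA); exact: gam_sm.
have Cdu : class_C 1 A (dv v u) by exact: (class_C_dv HA).
rewrite (dv_congr (A := A) v (fun z => @dv_shift_form v a z)) //.
have Cbu : class_C 1 A (fun z => beta a z * dv v u z) by exact: (class_CM HA).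
rewrite (dvD HA Ay) //; last by apply: (class_CM HA) => //; exact: (class_CB HA).
rewrite (dvM HA Ay) //; last exact: (class_CB HA).
rewrite (dvB HA Ay) // (dvM HA Ay) // dv_expu //.
move: (expR _) (dv v u y) (dv v (beta a) y) (beta a y) (dv v (dv v u) y)
  (dv v (dv v (beta a)) y) => e d b' b d2 b2; ring.
Qed.

Lemma dv_test_form v a y : A y ->
  dv v (test_form u a) y = dv v (partial A a u) y + dv v (shift_form u a) y.
Proof.
move=> Ay; apply: (dvD HA Ay); first exact: class_C_partial.
exact: class_C_le (leq_addl 2 1) (class_shift_form a).
Qed.

Lemma dd_test_form v a y : A y -> dv v (dv v (test_form u a)) y =
  dv v (dv v (partial A a u)) y + dv v (dv v (shift_form u a)) y.
Proof.
move=> Ay; rewrite (dv_congr (A := A) v (fun z => @dv_test_form v a z)) //.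
apply: (dvD HA Ay); apply: (class_C_dv HA); first exact: class_C_partial.
exact: class_CW (class_shift_form a).
Qed.

Variable x : 'rV[R]_n.
Hypothesis Ax : A x.

(** The test covector with its index raised, frozen at the point [x]. *)
Definition test_vec : 'rV[R]_n := \row_b \sum_a ginv G x b a * test_form u a x.

Lemma dv_test_sq v : dv v (test_sq u) x =
  \sum_a \sum_b dv v (fun y => ginv G y a b) x * (test_form u a x * test_form u b x)
  + 2 * \sum_b test_vec 0 b * dv v (test_form u b) x.
Proof.
have CI a b : class_C 1 A (fun y => ginv G y a b) by exact: (smooth_ginv HA Gsm Gpos).
have CW a : class_C 1 A (test_form u a) := class_CW (class_test_form a).
have CWW a b : class_C 1 A (fun y => test_form u a y * test_form u b y) by exact: (class_CM HA).
have E a b : dv v (fun y => ginv G y a b * (test_form u a y * test_form u b y)) x =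
   dv v (fun y => ginv G y a b) x * (test_form u a x * test_form u b x) +
   (ginv G x a b * test_form u b x * dv v (test_form u a) x +
    ginv G x a b * test_form u a x * dv v (test_form u b) x).
  rewrite (dvM HA Ax) // (dvM HA Ax) //.
  move: (dv v (fun y => ginv G y a b) x) (ginv G x a b) (dv v (test_form u a) x)
    (dv v (test_form u b) x) (test_form u a x) (test_form u b x) => g' g a' b' a0 b0; ring.
rewrite (dv_sum HA Ax); last by move=> a _; apply: (class_C_sum HA) => b _; exact: (class_CM HA).
transitivity (\sum_a \sum_b (dv v (fun y => ginv G y a b) x * (test_form u a x * test_form u b x) +
   (ginv G x a b * test_form u b x * dv v (test_form u a) x +
    ginv G x a b * test_form u a x * dv v (test_form u b) x))).
  apply: eq_bigr => a _; rewrite (dv_sum HA Ax); last by move=> b _; exact: (class_CM HA).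
  by apply: eq_bigr => b _; exact: E.
have V1 : \sum_a \sum_b ginv G x a b * test_form u b x * dv v (test_form u a) x =
    \sum_b test_vec 0 b * dv v (test_form u b) x.
  by apply: eq_bigr => a _; rewrite mxE mulr_suml.
have V2 : \sum_a \sum_b ginv G x a b * test_form u a x * dv v (test_form u b) x =
    \sum_b test_vec 0 b * dv v (test_form u b) x.
  rewrite exchange_big /=; apply: eq_bigr => b _; rewrite mxE mulr_suml.
  by apply: eq_bigr => a _; rewrite (ginv_sym Gpos _ _ Ax).
rewrite [2 * _]mulr_natl mulr2n -{1}V1 -V2 -!big_split; apply: eq_bigr => a _.
by rewrite -!big_split.
Qed.

Lemma dd_test_sq v : dv v (dv v (test_sq u)) x =
  \sum_a \sum_b dv v (dv v (fun y => ginv G y a b)) x * (test_form u a x * test_form u b x)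
  + 4 * (\sum_a \sum_b dv v (fun y => ginv G y a b) x * test_form u b x * dv v (test_form u a) x)
  + 2 * (\sum_a \sum_b ginv G x a b * (dv v (test_form u a) x * dv v (test_form u b) x))
  + 2 * \sum_b test_vec 0 b * dv v (dv v (test_form u b)) x.
Proof.
have CI a b : class_C 2 A (fun y => ginv G y a b) by exact: (smooth_ginv HA Gsm Gpos).
have CI1 a b : class_C 1 A (fun y => ginv G y a b) by exact: (smooth_ginv HA Gsm Gpos).
have CW := class_test_form; have CW1 a : class_C 1 A (test_form u a) := class_CW (CW a).
have CWW a b : class_C 2 A (fun y => test_form u a y * test_form u b y) by exact: (class_CM HA).
pose T1 a b := dv v (dv v (fun y => ginv G y a b)) x * (test_form u a x * test_form u b x).
pose T2 a b := dv v (fun y => ginv G y a b) x * test_form u b x * dv v (test_form u a) x.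
pose T3 a b := ginv G x a b * (dv v (test_form u a) x * dv v (test_form u b) x).
pose T4 a b := ginv G x a b * test_form u b x * dv v (dv v (test_form u a)) x.
have sI a b : ginv G x a b = ginv G x b a by exact: (ginv_sym Gpos).
have sdI a b : dv v (fun y => ginv G y a b) x = dv v (fun y => ginv G y b a) x.
  by apply: (dv_congr v _ Ax) => y Ay; exact: (ginv_sym Gpos).
have E a b : dv v (dv v (fun y => ginv G y a b * (test_form u a y * test_form u b y))) x =
   T1 a b + 2 * T2 a b + 2 * T2 b a + 2 * T3 a b + T4 a b + T4 b a.
  rewrite (ddM HA v Ax (CI a b) (CWW a b)) (ddM HA v Ax (CW a) (CW b)).
  rewrite (dvM HA Ax v (CW1 a) (CW1 b)) /T1 /T2 /T3 /T4 (sdI b a) (sI b a).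
  move: (dv v (fun y => ginv G y a b) x) (ginv G x a b) (dv v (test_form u a) x)
    (dv v (test_form u b) x) (test_form u a x) (test_form u b x)
    (dv v (dv v (fun y => ginv G y a b)) x) (dv v (dv v (test_form u a)) x)
    (dv v (dv v (test_form u b)) x) => g' g a' b' a0 b0 g2 a2 b2; ring.
rewrite (@dd_sum _ _ _ _ HA v _ _ _ _ x Ax); last by move=> a _; apply: (class_C_sum HA) => b _; exact: (class_CM HA).
transitivity (\sum_a \sum_b (T1 a b + 2 * T2 a b + 2 * T2 b a + 2 * T3 a b + T4 a b + T4 b a)).
  apply: eq_bigr => a _; rewrite (@dd_sum _ _ _ _ HA v _ _ _ _ x Ax); last by move=> b _; exact: (class_CM HA).
  by apply: eq_bigr => b _; exact: E.
have sp : \sum_a \sum_b (T1 a b + 2 * T2 a b + 2 * T2 b a + 2 * T3 a b + T4 a b + T4 b a) =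
  \sum_a \sum_b T1 a b + 2 * (\sum_a \sum_b T2 a b) + 2 * (\sum_a \sum_b T2 b a)
  + 2 * (\sum_a \sum_b T3 a b) + \sum_a \sum_b T4 a b + \sum_a \sum_b T4 b a.
  rewrite !mulr_sumr -!big_split; apply: eq_bigr => a _ /=.
  by rewrite !mulr_sumr -!big_split.
have fin (s1 s2 s2' s3 s4 s4' s5 : R) : s2' = s2 -> s4' = s4 -> s5 = s4 ->
    s1 + 2 * s2 + 2 * s2' + 2 * s3 + s4 + s4' = s1 + 4 * s2 + 2 * s3 + 2 * s5.
  by move=> -> -> ->; ring.
have ex2 : \sum_a \sum_b T2 b a = \sum_a \sum_b T2 a b by exact: exchange_big.
have ex4 : \sum_a \sum_b T4 b a = \sum_a \sum_b T4 a b by exact: exchange_big.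
have ex5 : \sum_b test_vec 0 b * dv v (dv v (test_form u b)) x = \sum_a \sum_b T4 a b.
  by apply: eq_bigr => a _; rewrite mxE mulr_suml.
exact: (etrans sp (fin _ _ _ _ _ _ _ ex2 ex4 ex5)).
Qed.

Section frame.
Variable E : 'M[R]_n.
Hypothesis EG : E *m G x *m E^T = 1%:M.

Lemma frame_ginv a b : ginv G x a b = \sum_m E m a * E m b.
Proof.
have Gu := Gunit Gpos Ax.
have H : G x *m (E^T *m E) = 1%:M.
  by rewrite mulmxA; apply: mulmx1C; rewrite mulmxA.
have -> : ginv G x = E^T *m E.
  by rewrite -[RHS]mul1mx -(mulVmx Gu) -mulmxA H mulmx1.
by rewrite mxE; apply: eq_bigr => m _; rewrite mxE.
Qed.

(** The inverse of [E]; it converts bounds on frame components into bounds on coordinate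
    components. *)
Definition coframe : 'M[R]_n := G x *m E^T.

Lemma coframeK (w : 'I_n -> R) a : w a = \sum_m coframe a m * \sum_b E m b * w b.
Proof.
have H : coframe *m E = 1%:M by apply: mulmx1C; rewrite /coframe mulmxA.
transitivity (\sum_b (coframe *m E) a b * w b).
  rewrite H (bigD1 a) //= mxE eqxx mul1r big1 ?addr0 // => b ba.
  by rewrite mxE eq_sym (negPf ba) mul0r.
under eq_bigr do rewrite mxE mulr_suml.
rewrite exchange_big /=; apply: eq_bigr => m _; rewrite mulr_sumr.
by apply: eq_bigr => b _; rewrite mulrA.
Qed.

Lemma frame_ginv_form (w z : 'I_n -> R) :
  \sum_a \sum_b ginv G x a b * (w a * z b) =
  \sum_m (\sum_a E m a * w a) * (\sum_b E m b * z b).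
Proof.
have -> : \sum_a \sum_b ginv G x a b * (w a * z b) =
    \sum_a \sum_b \sum_m E m a * E m b * (w a * z b).
  by apply: eq_bigr => a _; apply: eq_bigr => b _; rewrite frame_ginv mulr_suml.
have -> : \sum_a \sum_b \sum_m E m a * E m b * (w a * z b) =
    \sum_m \sum_a \sum_b E m a * E m b * (w a * z b).
  under eq_bigr do rewrite exchange_big /=.
  by rewrite exchange_big.
apply: eq_bigr => m _; rewrite mulr_suml; apply: eq_bigr => a _.
rewrite mulr_sumr; apply: eq_bigr => b _; ring.
Qed.

Definition frame_form m := \sum_a E m a * test_form u a x.

Lemma test_sq_frame : test_sq u x = \sum_m frame_form m ^+ 2.
Proof. by rewrite /test_sq frame_ginv_form; apply: eq_bigr => m _; rewrite expr2. Qed.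

Lemma test_vec_frame b : test_vec 0 b = \sum_m E m b * frame_form m.
Proof.
rewrite mxE /frame_form; under eq_bigr do rewrite frame_ginv mulr_suml.
rewrite exchange_big /=; apply: eq_bigr => m _; rewrite mulr_sumr.
by apply: eq_bigr => a _; rewrite mulrA.
Qed.

(** Coordinate, not covariant, second derivatives; the Christoffel terms are left to [frame_low]. *)
Definition frame_hess l m := \sum_i \sum_j E l i * E m j * partial A i (partial A j u) x.

Lemma dv_partial_frame l (w : 'rV[R]_n) :
  \sum_a w 0 a * dv (row l E) (partial A a u) x =
  \sum_i \sum_j E l i * w 0 j * partial A i (partial A j u) x.
Proof.
rewrite exchange_big /=; apply: eq_bigr => j _; rewrite /dder mulr_sumr.
by apply: eq_bigr => i _; rewrite mxE mulrCA mulrA.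
Qed.

Lemma dd_frame l : dv (row l E) (dv (row l E) u) x = frame_hess l l.
Proof.
have -> : frame_hess l l = \sum_a (row l E) 0 a * dv (row l E) (partial A a u) x.
  by rewrite dv_partial_frame; apply: eq_bigr => i _; apply: eq_bigr => j _; rewrite !mxE.
have Cp a : class_C 1 A (partial A a u) by exact: class_C_partial.
rewrite {2}/dder (dv_sum HA Ax); first by apply: eq_bigr => a _; rewrite (dvZ HA Ax).
by move=> a _; apply: (class_CM HA) => //; exact: (class_C_cst HA).
Qed.

Lemma frame_hess_vec l : \sum_m frame_form m * frame_hess l m =
  \sum_i E l i * \sum_j test_vec 0 j * partial A i (partial A j u) x.
Proof.
have -> : \sum_m frame_form m * frame_hess l m =
   \sum_i \sum_j \sum_m frame_form m * (E l i * E m j * partial A i (partial A j u) x).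
  under eq_bigr do rewrite /frame_hess mulr_sumr.
  rewrite exchange_big /=; apply: eq_bigr => i _.
  under eq_bigr do rewrite mulr_sumr.
  exact: exchange_big.
apply: eq_bigr => i _; rewrite mulr_sumr; apply: eq_bigr => j _.
rewrite test_vec_frame mulr_suml mulr_sumr; apply: eq_bigr => m _.
move: (partial A i _ x) (frame_form m) (E l i) (E m j) => a1 a2 a3 a4; ring.
Qed.

Definition frame_grad m := \sum_a E m a * partial A a u x.

Lemma frame_grad_form m :
  frame_grad m = frame_form m - \sum_a E m a * shift_form u a x.
Proof.
rewrite /frame_form /frame_grad -sumrB; apply: eq_bigr => a _.
by rewrite /test_form mulrDr addrK.
Qed.

Lemma grad_sq_frame : grad_sq A G u x = \sum_m frame_grad m ^+ 2.
Proof. by rewrite /grad_sq frame_ginv_form; apply: eq_bigr => m _; rewrite expr2. Qed.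

Variable lam : 'rV[R]_n.
Hypothesis EU : E *m U_tensor A G u x *m E^T = diag_mx lam.

Lemma mx_conj_entry (H : 'M[R]_n) l m :
  (E *m H *m E^T) l m = \sum_i \sum_j E l i * E m j * H i j.
Proof.
rewrite mxE; under eq_bigr do rewrite mxE mulr_suml.
rewrite exchange_big /=; apply: eq_bigr => i _; apply: eq_bigr => j _.
by rewrite [E^T _ _]mxE mulrAC.
Qed.

Definition frame_low l m := \sum_i \sum_j E l i * E m j *
  (schouten A G x i j - \sum_k christoffel A G k i j x * partial A k u x).

(** Solving [E U E^T = diag lam] for the second derivatives of [u] replaces them by eigenvalues and
    terms of first order in [u]. *)
Lemma frame_hessE l m : frame_hess l m = lam 0 l * (l == m)%:R -
  frame_grad l * frame_grad m + 2^-1 * (\sum_k frame_grad k ^+ 2) * (l == m)%:R - frame_low l m.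
Proof.
have := congr1 (fun H : 'M[R]_n => H l m) EU; rewrite mx_conj_entry [in RHS]mxE mulr_natr => EUlm.
have := congr1 (fun H : 'M[R]_n => H l m) EG; rewrite mx_conj_entry [in RHS]mxE => EGlm.
have Ue i j : U_tensor A G u x i j = partial A i (partial A j u) x
    - \sum_k christoffel A G k i j x * partial A k u x + partial A i u x * partial A j u x
    - 2^-1 * grad_sq A G u x * G x i j + schouten A G x i j.
  by rewrite /U_tensor /hessian /dtensor !mxE.
have gg : frame_grad l * frame_grad m =
    \sum_i \sum_j E l i * E m j * (partial A i u x * partial A j u x).
  rewrite /frame_grad mulr_suml; apply: eq_bigr => i _; rewrite mulr_sumr.
  by apply: eq_bigr => j _; rewrite mulrACA.
rewrite -EUlm gg -grad_sq_frame -EGlm /frame_hess /frame_low mulr_sumr.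
rewrite -sumrB -big_split -sumrB; apply: eq_bigr => i _ /=.
rewrite mulr_sumr -sumrB -big_split -sumrB; apply: eq_bigr => j _ /=.
rewrite Ue; move: (partial A i (partial A j u) x) (\sum_k _) (partial A i u x) (partial A j u x)
  (grad_sq A G u x) (G x i j) (schouten A G x i j) (E l i) (E m j).
by move=> a1 a2 a3 a4 a5 a6 a7 a8 a9; ring.
Qed.

End frame.
End bernstein_identities.

(** * The estimate at an interior maximum *)

Section scales.
Variables (R : realType) (I : Type) (y h : I -> R) (Kh : R).
Hypotheses (y1 : forall i, 1 <= y i) (Kh0 : 0 <= Kh) (Kh1 : forall i, 1 <= Kh * h i).
Hypothesis h0 : forall i, 0 < h i.

(* In the estimates [y] is the length of the test covector and [h] the inverse of
   the cutoff at a maximum point; all terms are compared with powers of both. *)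
Definition big_oh (a b : nat) (F : I -> R) := dominated F (fun i => y i ^+ a * h i ^+ b).

Lemma scale_ge0 a b i : 0 <= y i ^+ a * h i ^+ b.
Proof. by rewrite mulr_ge0 // exprn_ge0 // ?(ltW (h0 i)) // (le_trans ler01). Qed.

(** Raising the power of [y] is free as [y >= 1]; raising that of [h] costs powers of [Kh], since
    [h] is only bounded away from zero. *)
Lemma big_ohW a b a' b' F : big_oh a' b' F -> (a' <= a)%N -> (b' <= b)%N -> big_oh a b F.
Proof.
move=> DF aa bb; apply: dominated_trans DF _; exists (Kh ^+ (b - b')); first exact: exprn_ge0.
move=> i; rewrite ger0_norm ?scale_ge0 // mulrCA ler_pM ?exprn_ge0 ?(ltW (h0 i)) //.
- exact: le_trans ler01 (y1 i).
- exact: ler_weXn2l.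
rewrite -(subnK bb) addnK exprD mulrA -exprMn ler_peMl ?exprn_ge0 ?(ltW (h0 i)) //.
exact: exprn_ege1.
Qed.

Lemma big_ohD a b F1 F2 : big_oh a b F1 -> big_oh a b F2 -> big_oh a b (fun i => F1 i + F2 i).
Proof. exact: dominatedD. Qed.

Lemma big_ohB a b F1 F2 : big_oh a b F1 -> big_oh a b F2 -> big_oh a b (fun i => F1 i - F2 i).
Proof. exact: dominatedB. Qed.

Lemma big_ohN a b F : big_oh a b F -> big_oh a b (fun i => - F i).
Proof. exact: dominatedN. Qed.

Lemma big_ohM a b a' b' c d F1 F2 : big_oh a b F1 -> big_oh a' b' F2 ->
  (a + a' <= c)%N -> (b + b' <= d)%N -> big_oh c d (fun i => F1 i * F2 i).
Proof.
move=> D1 D2; apply: big_ohW; apply: dominated_trans (dominatedM D1 D2) _.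
by exists 1 => // i; rewrite mul1r mulrACA -!exprD ger0_norm ?scale_ge0.
Qed.

Lemma big_oh_cst a b (k : R) : big_oh a b (fun=> k).
Proof.
apply: (@big_ohW _ _ 0 0) => //; apply: dominated_trans (dominated_cst I k) _.
by exists 1 => // i; rewrite !expr0 !mulr1 normr1.
Qed.

Lemma big_ohZ a b (k : R) F : big_oh a b F -> big_oh a b (fun i => k * F i).
Proof. by move=> DF; apply: (big_ohM (big_oh_cst 0 0 k) DF). Qed.

Lemma big_oh_sum a b (J : Type) (r : seq J) (P : pred J) (F : J -> I -> R) :
  (forall j, big_oh a b (F j)) -> big_oh a b (fun i => \sum_(j <- r | P j) F j i).
Proof. by apply: dominated_sum => i; exact: scale_ge0. Qed.

Lemma big_ohX a b k F : big_oh a b F -> big_oh (k * a) (k * b) (fun i => F i ^+ k).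
Proof.
move=> DF; elim: k => [|k IH].
  by apply: dominated_ext (big_oh_cst 0 0 1) => i; rewrite expr0.
apply: (@dominated_ext _ _ (fun i => F i * F i ^+ k)) => [i|]; first by rewrite exprS.
by apply: (big_ohM DF IH); rewrite mulSn.
Qed.

Lemma big_oh_ext a b F1 F2 : F1 =1 F2 -> big_oh a b F1 -> big_oh a b F2.
Proof. exact: dominated_ext. Qed.

Lemma big_oh_common (J : finType) a b (F : J -> I -> R) : (forall j, big_oh a b (F j)) ->
  exists K0 : R, forall K, K0 <= K -> forall j i, `|F j i| <= K * (y i ^+ a * h i ^+ b).
Proof.
move=> /fin_all_exists2[K HK KF].
exists (\sum_j K j) => k Kk j i; apply: le_trans (KF j i) _.
rewrite ler_wpM2r ?scale_ge0 // (le_trans _ Kk) // (bigD1 j) //= lerDl.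
by apply: sumr_ge0.
Qed.

End scales.

Lemma seq_bound (R : realDomainType) (s : seq R) : exists k, forall r, r \in s -> r <= k.
Proof.
elim: s => [|a s [k Hk]]; first by exists 0.
exists (Num.max a k) => r; rewrite inE le_max => /orP[/eqP ->|/Hk ->]; first by rewrite lexx.
by rewrite orbT.
Qed.

(** The level [k] is free because a solution satisfies [f = e^(-2u) <= e^(2 C0)] instead of
    [f <= 1]. *)
Definition structural (R : realType) (n : nat) (Gamma : set 'rV[R]_n) f (k eps c1 : R) :=
  forall mu xi : 'rV[R]_n, Gamma mu -> f mu <= k -> eps^-1 <= enorm xi ->
    (forall l, `|xi 0 l * (mu 0 l - 2^-1 * enorm xi ^+ 2)| <= eps * enorm xi ^+ 3) ->
    c1 * enorm xi ^+ 4 * (\sum_l partial Gamma l f mu) <=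
    \sum_l partial Gamma l f mu *
      ((mu 0 l + 2^-1 * enorm xi ^+ 2 - xi 0 l ^+ 2) ^+ 2
       + xi 0 l ^+ 2 * (enorm xi ^+ 2 - xi 0 l ^+ 2)).

Section interior_estimate.
Variables (R : realType) (n' : nat).
Local Notation n := n'.+1.
Variables (L : pred 'I_n) (A : set 'rV[R]_n).
Hypothesis HA : corner_open L A.
Variable G : 'rV[R]_n -> 'M[R]_n.
Hypothesis Gsm : forall i j, smooth A (fun x => G x i j).
Hypothesis Gpos : forall x, A x -> posdef (G x).
Variables (beta gam : 'I_n -> 'rV[R]_n -> R).
Hypothesis beta_sm : forall a, smooth A (beta a).
Hypothesis gam_sm : forall a, smooth A (gam a).
Local Notation dv := (dder A).
Variable K : set 'rV[R]_n.
Hypothesis KA : K `<=` A.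
Hypothesis Kbd : forall F, smooth A F -> exists b : R, forall x, K x -> `|F x| <= b.
Variables (eta : 'rV[R]_n -> R) (C0 : R).
Hypothesis eta_sm : smooth A eta.
Variables (Gamma : set 'rV[R]_n) (f : 'rV[R]_n -> R).
Hypothesis HGamma : corner_open pred0 Gamma.
Hypothesis f_C1 : class_C 1 Gamma f.
Hypothesis Gamma_sym : forall (s : 'S_n) lam, Gamma lam -> Gamma (col_perm s lam).
Hypothesis f_sym : forall (s : 'S_n) lam, Gamma lam -> f (col_perm s lam) = f lam.

Definition solves (u : 'rV[R]_n -> R) := forall x, A x -> exists lam : 'rV[R]_n,
  [/\ eigenvalues (G x) (U_tensor A G u x) lam, Gamma lam & f lam = expR (- 2 * u x)].

Local Notation W := (test_sq A G beta gam).
Local Notation om := (test_form A beta gam).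
Local Notation shift := (shift_form beta gam).
Local Notation V := (test_vec A G beta gam).
Local Notation "'d_ i" := (partial A i) (at level 8, i at level 2).

Lemma U_entry u y i j : U_tensor A G u y i j = 'd_i ('d_j u) y
  - \sum_k christoffel A G k i j y * 'd_k u y + 'd_i u y * 'd_j u y
  - 2^-1 * grad_sq A G u y * G y i j + schouten A G y i j.
Proof. by rewrite /U_tensor /hessian /dtensor !mxE. Qed.

Lemma class_grad_sq u : class_C 3 A u -> class_C 1 A (grad_sq A G u).
Proof.
move=> Cu; have Cp k : class_C 1 A ('d_k u) by apply: class_CW; exact: class_C_partial.
apply: (class_C_sum HA) => a _; apply: (class_C_sum HA) => b _.
by apply: (class_CM HA); [exact: (smooth_ginv HA Gsm Gpos) | exact: (class_CM HA)].
Qed.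

Lemma class_low u i j : class_C 3 A u -> class_C 1 A (fun y =>
  \sum_k christoffel A G k i j y * 'd_k u y).
Proof.
move=> Cu; have Cp k : class_C 1 A ('d_k u) by apply: class_CW; exact: class_C_partial.
apply: (class_C_sum HA) => k _; apply: (class_CM HA) => //.
exact: (smooth_christoffel HA Gsm Gpos).
Qed.

Lemma class_hess u i j : class_C 3 A u -> class_C 1 A ('d_i ('d_j u)).
Proof. by move=> Cu; apply: class_C_partial; exact: class_C_partial. Qed.

Lemma class_U u i j : class_C 3 A u -> class_C 1 A (fun y => U_tensor A G u y i j).
Proof.
move=> Cu; have Cp k : class_C 1 A ('d_k u) by apply: class_CW; exact: class_C_partial.
apply: (class_C_congr HA (f := fun y => 'd_i ('d_j u) y
  - \sum_k christoffel A G k i j y * 'd_k u y + 'd_i u y * 'd_j u y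
  - 2^-1 * grad_sq A G u y * G y i j + schouten A G y i j)) => [y _|].
  exact/esym/U_entry.
apply: (class_CD HA); last exact: (smooth_schouten HA Gsm Gpos).
apply: (class_CB HA); first apply: (class_CD HA); first apply: (class_CB HA).
- exact: class_hess.
- exact: class_low.
- exact: (class_CM HA).
- apply: (class_CM HA); last exact: Gsm.
  by apply: (class_CM HA); [exact: (class_C_cst HA) | exact: class_grad_sq].
Qed.

Definition dv_mx (v : 'rV[R]_n) (F : 'rV[R]_n -> 'M[R]_n) x : 'M[R]_n :=
  \matrix_(i, j) dv v (fun y => F y i j) x.

Lemma mx_der_dir v (F : 'rV[R]_n -> 'M[R]_n) x : (forall i j, class_C 1 A (fun y => F y i j)) ->
  interior_pt L A x -> mx_der (fun t => F (x + t *: v)) (dv_mx v F x).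
Proof. by move=> CF xint i j; rewrite mxE; exact: (has_der_dir HA). Qed.

(* [(E G) (G^-1 U)(x + t v) E^T] is similar to [G^-1 U] and diagonal at [t = 0],
   so [spectral_derivative] differentiates the equation along [v]. *)
Lemma linearized_equation u x v (E : 'M[R]_n) lam :
  class_C 3 A u -> interior_pt L A x -> solves u ->
  E *m G x *m E^T = 1%:M -> E *m U_tensor A G u x *m E^T = diag_mx lam ->
  Gamma lam ->
  \sum_l partial Gamma l f lam * ((E *m dv_mx v (U_tensor A G u) x *m E^T) l l
     - lam 0 l * (E *m dv_mx v G x *m E^T) l l) = - 2 * expR (- 2 * u x) * dv v u x.
Proof.
move=> Cu xint su EG EU Gl; have [Ax _] := xint.
have Cu1 : class_C 1 A u by do 2 apply: class_CW.
have Cu2 : class_C 2 A u by exact: class_CW.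
have EtEG : E^T *m (E *m G x) = 1%:M by apply: mulmx1C.
pose M (t : R) := (E *m G x) *m (ginv G (x + t *: v) *m U_tensor A G u (x + t *: v)) *m E^T.
have x0 : x + (0 : R) *: v = x by rewrite scale0r addr0.
have ginvE : ginv G x = E^T *m E.
  by apply/matrixP => a b; rewrite (frame_ginv Gpos Ax EG) mxE; apply: eq_bigr => m _; rewrite mxE.
have M0 : M 0 = diag_mx lam.
  rewrite /M x0 ginvE -EU !mulmxA EG mul1mx //.
(* The derivative of [g^-1] contributes [- g^-1 (dG) g^-1 U], which in the frame becomes [dG] times
   [diag lam] with a minus sign. *)
pose B := E *m dv_mx v (U_tensor A G u) x *m E^T - E *m dv_mx v G x *m E^T *m diag_mx lam.
have MB : mx_der M B.
  have dI := mx_der_dir (v := v) (fun a b => smooth_ginv HA Gsm Gpos a b 1) xint.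
  have dU := mx_der_dir (v := v) (fun a b => class_U a b Cu) xint.
  have := mx_derM (mx_derM (mx_der_cst (E *m G x)) (mx_derM dI dU)) (mx_der_cst E^T).
  rewrite mulmx0 addr0 mul0mx add0r /= !x0.
  suff -> : E *m G x *m (dv_mx v (ginv G) x *m U_tensor A G u x + ginv G x *m dv_mx v (U_tensor A G u) x) *m E^T = B by [].
  have -> : dv_mx v (ginv G) x = - (ginv G x *m dv_mx v G x *m ginv G x).
    apply/matrixP => a b; rewrite mxE (dder_ginv HA Gsm Gpos) // !mxE; congr (- _).
    rewrite exchange_big /=; apply: eq_bigr => c _; rewrite !mxE mulr_suml.
    by apply: eq_bigr => d _; rewrite mxE.
  rewrite /B -EU ginvE mulmxDr mulmxDl addrC; congr (_ + _).
    by rewrite !mulmxA EG mul1mx.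
  by rewrite mulNmx mulmxN mulNmx !mulmxA EG mul1mx.
have [d d0 Hd] := interior_dir HA v xint.
have spec : exists2 d : R, 0 < d & forall t, `|t| < d -> exists mu,
    [/\ spectrum (M t) mu, Gamma mu & f mu = expR (- 2 * u (x + t *: v))].
  exists d => // t td; have [At _] := Hd t td; have [mu [ev Gmu fmu]] := su _ At.
  exists mu; split=> //.
  have [P Pu PE] := eigenvalues_similar (Gpos At) (U_tensor_sym HA Gsm Gpos Cu2 At) ev.
  have Etu : E^T \in unitmx by have [] := mulmx1_unit EtEG.
  have Pu' : P *m E^T \in unitmx by rewrite unitmx_mul Pu.
  exists (P *m E^T) => //; apply: (can_inj (mulKmx Pu')).
  rewrite -[invmx (P *m _) *m _ *m _]mulmxA (mulKVmx Pu') /M [ginv G _ *m _]PE.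
  rewrite !mulmxA -[P *m E^T *m E *m _]mulmxA -[P *m E^T *m _]mulmxA EtEG mulmx1.
  by rewrite mulmxV // mul1mx.
have phi_der : has_der setT (fun t => expR (- 2 * u (x + t *: v))) (- 2 * expR (- 2 * u x) * dv v u x).
  have C2u : class_C 1 A (fun z => - 2 * u z) by apply: (class_CM HA) => //; exact: (class_C_cst HA).
  have := has_der_dir HA (v := v) (class_C_exp HA C2u) xint.
  by rewrite (dv_exp HA Ax) // (dvZ HA Ax) // mulrA [expR _ * _]mulrC.
have /has_der_uniq /(_ phi_der) := spectral_derivative MB M0 HGamma f_C1 Gamma_sym f_sym Gl spec.
rewrite /B => <-.
  apply: eq_bigr => l _; congr (_ * _).
  move: (E *m dv_mx v (U_tensor A G u) x *m E^T) (E *m dv_mx v G x *m E^T) => H1 H2.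
  by rewrite mul_mx_diag !mxE mulrC.
move=> e e0; exists (e / 2); split=> //; first by rewrite gt_eqF // divr_gt0.
by rewrite gtr0_norm ?divr_gt0 // ltr_pdivrMr // ltr_pMr // ltr1n.
Qed.

Lemma dv_grad_sq u v y : class_C 3 A u -> A y -> dv v (grad_sq A G u) y =
  \sum_a \sum_b (dv v (fun z => ginv G z a b) y * ('d_a u y * 'd_b u y) +
    ginv G y a b * (dv v ('d_a u) y * 'd_b u y + 'd_a u y * dv v ('d_b u) y)).
Proof.
move=> Cu Ay; have Cp k : class_C 1 A ('d_k u) by apply: class_CW; exact: class_C_partial.
have CI a b : class_C 1 A (fun z => ginv G z a b) by exact: (smooth_ginv HA Gsm Gpos).
have CP a b : class_C 1 A (fun z => 'd_a u z * 'd_b u z) by exact: (class_CM HA).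
rewrite (dv_sum HA Ay); last by move=> a _; apply: (class_C_sum HA) => b _; exact: (class_CM HA).
apply: eq_bigr => a _; rewrite (dv_sum HA Ay); last by move=> b _; exact: (class_CM HA).
by apply: eq_bigr => b _; rewrite (dvM HA Ay v (CI a b) (CP a b)) (dvM HA Ay v (Cp a) (Cp b)).
Qed.

(** The part of the derivative of [U] without third derivatives of [u]. It meets the Hessian only
    contracted with [v], which is harmless for [v = V]. *)
Definition dv_U_low u v i j y :=
  - (\sum_k (dv v (christoffel A G k i j) y * 'd_k u y + christoffel A G k i j y * dv v ('d_k u) y))
  + (dv v ('d_i u) y * 'd_j u y + 'd_i u y * dv v ('d_j u) y)
  - 2^-1 * (dv v (grad_sq A G u) y * G y i j + grad_sq A G u y * dv v (fun z => G z i j) y)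
  + dv v (fun z => schouten A G z i j) y.

Lemma dv_U u v i j y : class_C 3 A u -> A y -> dv v (fun z => U_tensor A G u z i j) y =
  dv v ('d_i ('d_j u)) y + dv_U_low u v i j y.
Proof.
move=> Cu Ay; have Cp k : class_C 1 A ('d_k u) by apply: class_CW; exact: class_C_partial.
have CGa k : class_C 1 A (christoffel A G k i j) by exact: (smooth_christoffel HA Gsm Gpos).
have CH := class_hess i j Cu; have CL := class_low i j Cu; have CP := class_CM HA (Cp i) (Cp j).
have Cg := class_grad_sq Cu; have CG : class_C 1 A (fun z => G z i j) by exact: Gsm.
have CgG := class_CM HA Cg CG.
have CS : class_C 1 A (fun z => schouten A G z i j) by exact: (smooth_schouten HA Gsm Gpos).
have C1 := class_CB HA CH CL; have C2 := class_CD HA C1 CP.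
have C3 := class_CM HA (class_C_cst HA 1 2^-1) CgG; have C4 := class_CB HA C2 C3.
rewrite (@dv_congr _ _ _ v _ (fun z => 'd_i ('d_j u) z - \sum_k christoffel A G k i j z * 'd_k u z
  + 'd_i u z * 'd_j u z - 2^-1 * (grad_sq A G u z * G z i j) + schouten A G z i j) y _ Ay); last first.
  by move=> z _; rewrite U_entry mulrA.
rewrite (dvD HA Ay v C4 CS) (dvB HA Ay v C2 C3) (dvD HA Ay v C1 CP) (dvB HA Ay v CH CL).
rewrite (dvZ HA Ay v 2^-1 CgG) (dvM HA Ay v Cg CG) (dvM HA Ay v (Cp i) (Cp j)) (dv_sum HA Ay).
  rewrite /dv_U_low -!addrA; congr (_ + (- _ + _)).
  by apply: eq_bigr => k _; exact: (dvM HA Ay v (CGa k) (Cp k)).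
by move=> k _; exact: (class_CM HA (CGa k) (Cp k)).
Qed.

(** The left side comes from the second derivative of the test function, the right side from the
    derivative of [U] along [v]; commuting derivatives identifies them and brings in the linearized
    equation. *)
Lemma third_order u (v e : 'rV[R]_n) y : class_C 3 A u -> A y ->
  \sum_b v 0 b * dv e (dv e ('d_b u)) y =
  \sum_i \sum_j e 0 i * e 0 j * dv v ('d_i ('d_j u)) y.
Proof.
move=> Cu Ay; have Cu2 : class_C 2 A u by exact: class_CW.
have Cp k : class_C 2 A ('d_k u) by exact: class_C_partial.
have Cc w : class_C 2 A (fun=> w : R) by exact: (class_C_cst HA).
have Cdv w : class_C 2 A (dv w u) by exact: (class_C_dv HA).
have CH i j := class_hess i j Cu.
transitivity (dv e (dv e (dv v u)) y).
  rewrite (@dd_sum _ _ _ _ HA e _ _ _ _ y Ay); last by move=> b _; exact: (class_CM HA).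
  apply: eq_bigr => b _; have Cdp : class_C 1 A (dv e ('d_b u)) by exact: (class_C_dv HA).
  rewrite -(dvZ HA Ay e (v 0 b) Cdp); apply: (dv_congr e _ Ay) => z Az.
  exact/esym/(dvZ HA Az e (v 0 b) (class_CW (Cp b))).
rewrite (@dv_congr _ _ _ e _ (dv v (dv e u)) y _ Ay); last by move=> z Az; exact: (dv_comm HA).
rewrite (dv_comm HA e v Ay (Cdv e)).
rewrite (@dv_congr _ _ _ v _ _ y (fun z Az => dv_dv HA e e Az Cu2) Ay).
rewrite (dv_sum HA Ay) => [|i _]; last first.
  by apply: (class_C_sum HA) => j _; apply: (class_CM HA) => //; exact: (class_C_cst HA).
apply: eq_bigr => i _; rewrite (dv_sum HA Ay) => [|j _]; last first.
  by apply: (class_CM HA) => //; exact: (class_C_cst HA).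
by apply: eq_bigr => j _; exact: (dvZ HA Ay).
Qed.

Lemma partial_zero_slice F N b y : b != N -> A y -> y 0 N = 0 ->
  (forall z, A z -> z 0 N = 0 -> F z = 0) -> 'd_b F y = 0.
Proof.
move=> bN Ay yN F0; apply: (partial_eq HA Ay).
apply: (has_der_eq_near (f := cst 0)); last exact: has_der_cst.
  by rewrite line0 F0.
exists 1 => // t _ At; rewrite F0 // lineE yN add0r eq_sym (negPf bN) mulr0 //.
Qed.

(** * Orders of magnitude at a maximum point, uniform in all data *)

Section estimates.
Variables (I : Type) (u : I -> 'rV[R]_n -> R) (x : I -> 'rV[R]_n).
Variables (E : I -> 'M[R]_n) (lam : I -> 'rV[R]_n).
Hypothesis Cu : forall i, class_C 3 A (u i).
Hypothesis Kx : forall i, K (x i).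
Hypothesis xi : forall i, interior_pt L A (x i).
Hypothesis ui : forall i, solves (u i).
Hypothesis u_lb : forall i, - C0 <= u i (x i).
Hypothesis EG : forall i, E i *m G (x i) *m (E i)^T = 1%:M.
Hypothesis EU : forall i, E i *m U_tensor A G (u i) (x i) *m (E i)^T = diag_mx (lam i).
Hypothesis lamG : forall i, Gamma (lam i).
Hypothesis eta0 : forall i, 0 < eta (x i).
Hypothesis xmax : forall i, local_max A (fun z => eta z * eta z * W (u i) z) (x i).
Hypothesis W1 : forall i, 1 <= W (u i) (x i).

Let y i := Num.sqrt (W (u i) (x i)).
Let h i := (eta (x i))^-1.
Let Ax i : A (x i). Proof. exact: KA. Qed.
Let Cu2 i : class_C 2 A (u i). Proof. exact: class_CW. Qed.
Let Cu1 i : class_C 1 A (u i). Proof. exact: class_CW. Qed.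

Let y1 i : 1 <= y i.
Proof. by rewrite -sqrtr1 ler_wsqrtr. Qed.

Let y2 i : y i ^+ 2 = W (u i) (x i).
Proof. by rewrite sqr_sqrtr // (le_trans ler01). Qed.

Let h0 i : 0 < h i. Proof. by rewrite invr_gt0. Qed.

(** [eta] is bounded on [K], so [h = 1 / eta] stays away from zero. *)
Let Kh_ex : exists2 Kh : R, 0 <= Kh & forall i, 1 <= Kh * h i.
Proof.
have [b Hb] := Kbd eta_sm; exists `|b| => // i.
rewrite ler_pdivlMr // mul1r (le_trans _ (ler_norm b)) //.
exact: le_trans (ler_norm _) (Hb _ (Kx i)).
Qed.

Let Kh := s2val (cid2 Kh_ex).
Let Kh0 : 0 <= Kh := s2valP (cid2 Kh_ex).
Let Kh1 : forall i, 1 <= Kh * h i := s2valP' (cid2 Kh_ex).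

Let D a b F := big_oh y h a b F.
Let DW a b a' b' F := @big_ohW _ _ _ _ _ y1 Kh0 Kh1 h0 a b a' b' F.
Let DD a b F1 F2 := @big_ohD _ _ y h a b F1 F2.
Let DB a b F1 F2 := @big_ohB _ _ y h a b F1 F2.
Let DN a b F := @big_ohN _ _ y h a b F.
Let DM a b a' b' c d F1 F2 := @big_ohM _ _ _ _ _ y1 Kh0 Kh1 h0 a b a' b' c d F1 F2.
Let DZ a b k F := @big_ohZ _ _ _ _ _ y1 Kh0 Kh1 h0 a b k F.
Let DX a b k F := @big_ohX _ _ _ _ _ y1 Kh0 Kh1 h0 a b k F.
Let Dsum a b J r P F := @big_oh_sum _ _ _ _ y1 h0 a b J r P F.
Let Dext a b F1 F2 := @big_oh_ext _ _ y h a b F1 F2.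

Let Dcst a b k : D a b (fun=> k).
Proof. exact: (big_oh_cst y1 Kh0 Kh1 h0). Qed.

Let Dsm F : smooth A F -> D 0 0 (fun i => F (x i)).
Proof.
move=> /Kbd[b Hb]; exists `|b| => // i; rewrite !expr0 !mulr1.
exact: le_trans (Hb _ (Kx i)) (ler_norm _).
Qed.

(** The lower bound on [u] controls [e^(-u)], the form in which undifferentiated [u] enters the
    error terms. *)
Let Dexp : D 0 0 (fun i => expR (- u i (x i))).
Proof.
exists (expR C0); first exact: expR_ge0.
move=> i; rewrite !expr0 !mulr1 ger0_norm ?expR_ge0 // ler_expR.
by rewrite lerNl; exact: u_lb.
Qed.

Let sq_bound (s b : R) : s ^+ 2 <= b -> `|s| <= b + 1.
Proof.
move=> sb; rewrite -(ler_pXn2r (ltn0Sn 1)) ?nnegrE //; last by rewrite addr_ge0 // (le_trans _ sb) ?sqr_ge0.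
rewrite real_normK ?num_real // (le_trans sb) //.
have b0 : 0 <= b := le_trans (sqr_ge0 _) sb.
by rewrite sqrrD1; move: b0 (sqr_ge0 b); rewrite -mulr_natl; lra.
Qed.

(** Whatever the orthonormal frame, the squares in column [a] of [E] add up to [g^aa], which is
    bounded on [K]. *)
Let DE l a : D 0 0 (fun i => E i l a).
Proof.
have [k k0 Hk] := Dsm (smooth_ginv HA Gsm Gpos a a).
exists (k + 1); first exact: addr_ge0.
move=> i; have := Hk i; rewrite !expr0 !mulr1 => {}Hk.
apply: sq_bound => //; apply: le_trans (le_trans (ler_norm _) Hk).
rewrite (frame_ginv Gpos (Ax i) (EG i)) (bigD1 l) //= -expr2 lerDl.
by apply: sumr_ge0 => m _; rewrite -expr2 sqr_ge0.
Qed.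

Let Dco a m : D 0 0 (fun i => coframe G (x i) (E i) a m).
Proof.
apply: (@Dext _ _ (fun i => \sum_b G (x i) a b * E i m b)) => [i|].
  by rewrite mxE; apply: eq_bigr => b _; rewrite [in RHS]mxE.
by apply: Dsum => b; apply: (DM (Dsm (Gsm a b)) (DE m b)).
Qed.

Let Dframe m : D 1 0 (fun i => frame_form A beta gam (u i) (x i) (E i) m).
Proof.
exists 1 => // i; rewrite mul1r expr0 mulr1 expr1.
rewrite -(ler_pXn2r (ltn0Sn 1)) ?nnegrE ?sqrtr_ge0 // real_normK ?num_real // y2.
rewrite (test_sq_frame Gpos beta gam (u i) (Ax i) (EG i)) (bigD1 m) //= lerDl.
by apply: sumr_ge0 => k _; exact: sqr_ge0.
Qed.

Let Dom a : D 1 0 (fun i => om (u i) a (x i)).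
Proof.
apply: (@Dext _ _ (fun i => \sum_m coframe G (x i) (E i) a m *
    frame_form A beta gam (u i) (x i) (E i) m)) => [i|].
  exact/esym/(coframeK (EG i)).
by apply: Dsum => m; apply: (DM (Dco a m) (Dframe m)).
Qed.

Let Dshift a : D 0 0 (fun i => shift (u i) a (x i)).
Proof. by apply: DD; [apply: (DM Dexp (Dsm (beta_sm a))) | exact: Dsm]. Qed.

Let Du a : D 1 0 (fun i => 'd_a (u i) (x i)).
Proof.
apply: (@Dext _ _ (fun i => om (u i) a (x i) - shift (u i) a (x i))) => [i|].
  by rewrite /test_form addrK.
by apply: DB; [exact: Dom | exact: (DW (Dshift a))].
Qed.

Let DV b : D 1 0 (fun i => V (u i) (x i) 0 b).
Proof.
apply: (@Dext _ _ (fun i => \sum_a ginv G (x i) b a * om (u i) a (x i))) => [i|].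
  by rewrite mxE.
by apply: Dsum => a; apply: (DM (Dsm (smooth_ginv HA Gsm Gpos b a)) (Dom a)).
Qed.

Let Ddv a (w : I -> 'rV[R]_n) F : (forall k, D a 0 (fun i => w i 0 k)) ->
  smooth A F -> D a 0 (fun i => dv (w i) F (x i)).
Proof.
move=> Dw sF; apply: Dsum => k; apply: (DM (Dw k) (Dsm (smooth_partial k sF))) => //.
by rewrite addn0.
Qed.

Let Ddd (w : I -> 'rV[R]_n) F : (forall k, D 0 0 (fun i => w i 0 k)) ->
  smooth A F -> D 0 0 (fun i => dv (w i) (dv (w i) F) (x i)).
Proof.
move=> Dw sF.
apply: (@Dext _ _ (fun i => \sum_k \sum_l w i 0 k * w i 0 l * 'd_k ('d_l F) (x i))) => [i|].
  by rewrite (dv_dv HA _ _ (Ax i)).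
apply: Dsum => k; apply: Dsum => l; apply: (DM (DM (Dw k) (Dw l) (leqnn _) (leqnn _)) (Dsm _)) => //.
by apply: smooth_partial; exact: smooth_partial.
Qed.

Let Drow l k : D 0 0 (fun i => row l (E i) 0 k).
Proof. by apply: Dext (DE l k) => i; rewrite mxE. Qed.

Let Ddvu (w : I -> 'rV[R]_n) : (forall k, D 0 0 (fun i => w i 0 k)) ->
  D 1 0 (fun i => dv (w i) (u i) (x i)).
Proof. by move=> Dw; apply: Dsum => k; apply: (DM (Dw k) (Du k)). Qed.

Let Ddshift (w : I -> 'rV[R]_n) a : (forall k, D 0 0 (fun i => w i 0 k)) ->
  D 1 0 (fun i => dv (w i) (shift (u i) a) (x i)).
Proof.
move=> Dw; apply: (@Dext _ _ (fun i => expR (- u i (x i)) *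
    (dv (w i) (beta a) (x i) - beta a (x i) * dv (w i) (u i) (x i)) + dv (w i) (gam a) (x i))) => [i|].
  by rewrite (dv_shift_form HA beta_sm gam_sm (Cu i)).
apply: DD; last exact: (DW (Ddv Dw (gam_sm a))).
apply: (DM Dexp (_ : D 1 0 _)) => //; apply: DB; first exact: (DW (Ddv Dw (beta_sm a))).
by apply: (DM (Dsm (beta_sm a)) (Ddvu Dw)).
Qed.

Section boundary.
Variables (nu : 'I_n -> 'rV[R]_n -> R) (N : 'I_n).
Hypothesis nu_sm : forall k, smooth A (nu k).
Hypothesis xN : forall i, x i 0 N = 0.
Hypothesis nu_om : forall i z, A z -> z 0 N = 0 -> \sum_k nu k z * om (u i) k z = 0.
Hypothesis VN : forall i, V (u i) (x i) 0 N = 0.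

Let nuv i : 'rV[R]_n := \row_k nu k (x i).

Let Dnu k : D 0 0 (fun i => nuv i 0 k).
Proof. by apply: Dext (Dsm (nu_sm k)) => i; rewrite mxE. Qed.

Let Dbasis b k : D 0 0 (fun i => (basis_vec R b : 'rV[R]_n) 0 k).
Proof. exact: Dcst. Qed.

(* The second derivatives of [u] in one normal and one tangential direction are
   controlled by differentiating [nu_om] along the boundary. *)
Let nu_tangential b i : b != N -> dv (nuv i) (om (u i) b) (x i) =
  dv (nuv i) (shift (u i) b) (x i)
  - \sum_k (dv (basis_vec R b) (nu k) (x i) * om (u i) k (x i)
             + nu k (x i) * dv (basis_vec R b) (shift (u i) k) (x i)).
Proof.
move=> bN; rewrite (dv_test_form HA beta_sm gam_sm (Cu i) _ _ (Ax i)) addrC; apply: congrD; first by [].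
have Cn k : class_C 1 A (nu k) by exact: nu_sm.
have Co k : class_C 1 A (om (u i) k) := class_CW (class_test_form HA beta_sm gam_sm (Cu i) k).
have := partial_zero_slice bN (Ax i) (xN i) (@nu_om i).
rewrite -dv_basis (dv_sum HA (Ax i)) => [H|k _]; last exact: (class_CM HA).
transitivity (\sum_k nu k (x i) * dv (basis_vec R b) ('d_k (u i)) (x i)).
  apply: eq_bigr => k _; rewrite [nuv i 0 k]mxE dv_basis; apply: congrM; first by [].
  exact: (partial_comm HA _ _ (Cu2 i) (Ax i)).
apply/eqP; rewrite -addr_eq0 -big_split /=; apply/eqP; rewrite -[RHS]H; apply: eq_bigr => k _.
rewrite (dvM HA (Ax i) _ (Cn k) (Co k)) (dv_test_form HA beta_sm gam_sm (Cu i) _ _ (Ax i)).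
move: (nu k (x i)) (dv _ (nu k) _) (om _ _ _) (dv _ ('d_k _) _) (dv _ (shift _ _) _).
move=> s1 s2 s3 s4 s5; ring.
Qed.

(** No power of [h] appears, so the bound can precede the choice of the cutoff. As [V] has no normal
    component, only normal derivatives of tangential components of [om] occur, and [nu_tangential]
    handles these. *)
Lemma big_oh_boundary : big_oh y h 2 0 (fun i => dv (nuv i) (W (u i)) (x i)).
Proof.
apply: (Dext (fun i => esym (dv_test_sq HA Gsm Gpos beta_sm gam_sm (Cu i) (Ax i) (nuv i)))).
apply: DD.
  apply: Dsum => b; apply: Dsum => c.
  by apply: (DM (Ddv Dnu (smooth_ginv HA Gsm Gpos b c)) (DM (Dom b) (Dom c) (leqnn _) (leqnn _))).
apply: DZ; apply: Dsum => b; have [->|bN] := eqVneq b N.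
  by apply: (@Dext _ _ (fun=> 0)) => [i|]; [rewrite VN mul0r | exact: Dcst].
apply: (DM (DV b) (_ : D 1 0 _)) => //.
apply: (Dext (fun i => esym (nu_tangential i bN))).
apply: DB; first exact: Ddshift Dnu.
apply: Dsum => k; apply: DD.
  by apply: (DM (Ddv (Dbasis b) (nu_sm k)) (Dom k)).
by apply: (DM (Dsm (nu_sm k)) (Ddshift k (Dbasis b))).
Qed.

Lemma boundary_bound : exists k, forall i, `|dv (nuv i) (W (u i)) (x i)| <= k * W (u i) (x i).
Proof.
by have [k _ Hk] := big_oh_boundary; exists k => i; rewrite -y2; have := Hk i; rewrite expr0 mulr1.
Qed.

End boundary.

Let D_W : D 2 0 (fun i => W (u i) (x i)).
Proof. by exists 1 => // i; rewrite y2 expr0 mulr1 mul1r ger0_norm // (le_trans ler01). Qed.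

Let CW i : class_C 2 A (W (u i)).
Proof. exact: (class_test_sq HA Gsm Gpos beta_sm gam_sm). Qed.

Let Ceta k : class_C k A eta. Proof. exact: eta_sm. Qed.

Let Ceta2 k : class_C k A (fun z => eta z * eta z). Proof. exact: (class_CM HA). Qed.

Let first_order i v :
  dv v (W (u i)) (x i) = - (2 * (dv v eta (x i) * h i)) * W (u i) (x i).
Proof.
have H : dv v (fun z => eta z * eta z * W (u i) z) (x i) = 0.
  apply: big1 => k _; rewrite (local_max_partial_eq0 HA _ (Ax i) (xmax i)) ?mulr0 //.
    by apply: (class_CM HA) => //; exact: class_CW (CW i).
  by case: (xi i) => _; exact.
rewrite (dvM HA (Ax i) v (Ceta2 1) (class_CW (CW i))) in H.
rewrite (dvM HA (Ax i) v (Ceta 1) (Ceta 1)) in H.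
rewrite /h; move: (eta0 i) H; move: (eta (x i)) (dv v eta (x i)) (dv v (W (u i)) (x i)).
move=> e e' w' e0 /eqP H; apply: (mulfI (lt0r_neq0 (mulr_gt0 e0 e0))).
move: H; rewrite addrC addr_eq0 => /eqP ->; field; exact: lt0r_neq0.
Qed.

(** The first order condition turns the mixed term into [- 8] multiples of [(dv v eta)^2], against
    [2] from the second derivative of [eta^2]; hence the constant 6. *)
Let second_order i v : dv v (dv v (W (u i))) (x i) <=
  h i ^+ 2 * (6 * dv v eta (x i) ^+ 2 - 2 * (eta (x i) * dv v (dv v eta) (x i))) * W (u i) (x i).
Proof.
have := local_max_dd HA v (class_CM HA (Ceta2 2) (CW i)) (xi i) (xmax i).
rewrite (ddM HA v (Ax i) (Ceta2 2) (CW i)) (ddM HA v (Ax i) (Ceta 2) (Ceta 2)).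
rewrite (dvM HA (Ax i) v (Ceta 1) (Ceta 1)) first_order /h.
move: (eta0 i); move: (eta (x i)) (dv v eta (x i)) (dv v (dv v eta) (x i)) (dv v (dv v (W (u i))) (x i)).
move: (W (u i) (x i)) => w e e' e2 w2 e0 H.
rewrite -(ler_pM2l (mulr_gt0 e0 e0)) -subr_le0; apply: le_trans H.
rewrite le_eqVlt; apply/orP; left; apply/eqP; field; exact: lt0r_neq0.
Qed.

Let DdW (w : I -> 'rV[R]_n) : (forall k, D 0 0 (fun i => w i 0 k)) ->
  D 2 1 (fun i => dv (w i) (W (u i)) (x i)).
Proof.
move=> Dw.
apply: (@Dext _ _ (fun i => - (2 * (dv (w i) eta (x i) * h i)) * W (u i) (x i))) => [i|].
  exact/esym/first_order.
have Dh : D 0 1 h by exists 1 => // i; rewrite expr0 expr1 !mul1r gtr0_norm.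
by apply: (DM (DN (DZ 2 (DM (Ddv Dw eta_sm) Dh (leqnn _) (leqnn _)))) D_W).
Qed.

(** The derivative of [W] contains twice the contraction of [V] with the derivative of [om]. The
    first order condition therefore controls the Hessian of [u] contracted with [V], although the
    Hessian itself is not bounded. *)
Let DVform (w : I -> 'rV[R]_n) : (forall k, D 0 0 (fun i => w i 0 k)) ->
  D 2 1 (fun i => \sum_b V (u i) (x i) 0 b * dv (w i) ('d_b (u i)) (x i)).
Proof.
move=> Dw.
apply: (@Dext _ _ (fun i => 2^-1 * (dv (w i) (W (u i)) (x i) -
  \sum_a \sum_b dv (w i) (fun z => ginv G z a b) (x i) * (om (u i) a (x i) * om (u i) b (x i))) -
  \sum_b V (u i) (x i) 0 b * dv (w i) (shift (u i) b) (x i))) => [i|].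
  rewrite (dv_test_sq HA Gsm Gpos beta_sm gam_sm (Cu i) (Ax i)).
  have cancel (s t : R) : 2^-1 * (s + 2 * t - s) = t by field.
  rewrite cancel -sumrB; apply: eq_bigr => b _.
  by rewrite (dv_test_form HA beta_sm gam_sm (Cu i) _ _ (Ax i)) mulrDr addrK.
apply: DB; first apply: DZ.
  apply: DB; first exact: DdW.
  apply: Dsum => a; apply: Dsum => b.
  apply: (DM (Ddv Dw (smooth_ginv HA Gsm Gpos a b)) (DM (Dom a) (Dom b) (leqnn _) (leqnn _))) => //.
by apply: Dsum => b; apply: (DM (DV b) (Ddshift b Dw)).
Qed.

(** By symmetry of the Hessian, contraction in the other slot has the same size. *)
Let Dq k : D 2 1 (fun i => dv (V (u i) (x i)) ('d_k (u i)) (x i)).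
Proof.
apply: (@Dext _ _ (fun i => \sum_b V (u i) (x i) 0 b * dv (basis_vec R k) ('d_b (u i)) (x i))) => [i|].
  apply: eq_bigr => b _; rewrite dv_basis; apply: congrM; first by [].
  exact: (partial_comm HA _ _ (Cu2 i) (Ax i)).
by apply: DVform => j; apply: Dext (Dcst 0 0 (basis_vec R k 0 j)).
Qed.

Let fr i m := frame_form A beta gam (u i) (x i) (E i) m.
Let gr i m := frame_grad A (u i) (x i) (E i) m.
Let fh i l m := frame_hess A (u i) (x i) (E i) l m.
Let low i l m := frame_low A G (u i) (x i) (E i) l m.
Let sh i m := \sum_a E i m a * shift (u i) a (x i).
Let p i l m := \sum_a E i m a * dv (row l (E i)) (om (u i) a) (x i).
Let a i l m := (lam i 0 l + 2^-1 * y i ^+ 2) * (l == m)%:R - fr i l * fr i m.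

Let Dsh m : D 0 0 (fun i => sh i m).
Proof. by apply: Dsum => b; apply: (DM (DE m b) (Dshift b)). Qed.

Let Dgr m : D 1 0 (fun i => gr i m).
Proof. by apply: Dsum => b; apply: (DM (DE m b) (Du b)). Qed.

Let Dlow l m : D 1 0 (fun i => low i l m).
Proof.
apply: Dsum => b; apply: Dsum => c; apply: (DM (DM (DE l b) (DE m c) (leqnn _) (leqnn _)) (_ : D 1 0 _)) => //.
apply: DB; first exact: (DW (Dsm (smooth_schouten HA Gsm Gpos b c))).
by apply: Dsum => k; apply: (DM (Dsm (smooth_christoffel HA Gsm Gpos k b c)) (Du k)).
Qed.

Let grE i m : gr i m = fr i m - sh i m.
Proof. exact: frame_grad_form. Qed.

(** [a] is the leading part of the Hessian formula with [du] replaced by [om]; the bounded shift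
    between the two costs one power of [y], and so does [frame_low]. *)
Let fh_a l m : D 1 0 (fun i => fh i l m - a i l m).
Proof.
apply: (@Dext _ _ (fun i => (fr i l * sh i m + sh i l * gr i m) -
   2^-1 * (\sum_k (fr i k * sh i k + sh i k * gr i k)) * (l == m)%:R - low i l m)) => [i|].
  have sE : \sum_k (fr i k * sh i k + sh i k * gr i k) = y i ^+ 2 - \sum_k gr i k ^+ 2.
    rewrite y2 (test_sq_frame Gpos beta gam (u i) (Ax i) (EG i)) -sumrB.
    by apply: eq_bigr => k _; rewrite grE -/(fr i k); move: (fr i k) (sh i k) => s t; ring.
  rewrite sE /fh (frame_hessE Gpos (Ax i) (EG i) (EU i)) -/(gr i l) -/(gr i m) -/(low i l m) /a.
  rewrite -/(\sum_k gr i k ^+ 2).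
  have -> : gr i m = fr i m - sh i m := grE i m.
  have -> : gr i l = fr i l - sh i l := grE i l.
  move: (\sum_k gr i k ^+ 2) (y i ^+ 2) (low i l m) (fr i l) (fr i m) (sh i l) (sh i m) (lam i 0 l).
  by move=> s1 s2 s3 s4 s5 s6 s7 s8; ring.
apply: DB; last exact: Dlow.
apply: DB.
  by apply: DD; [apply: (DM (Dframe l) (Dsh m)) | apply: (DM (Dsh l) (Dgr m))].
apply: (DM (DZ 2^-1 (_ : D 1 0 _)) (Dcst 0 0 _)) => //; apply: Dsum => k.
by apply: DD; [apply: (DM (Dframe k) (Dsh k)) | apply: (DM (Dsh k) (Dgr k))].
Qed.

Let p_fh l m : D 1 0 (fun i => p i l m - fh i l m).
Proof.
apply: (@Dext _ _ (fun i => \sum_b E i m b * dv (row l (E i)) (shift (u i) b) (x i))) => [i|].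
  have -> : fh i l m = \sum_b row m (E i) 0 b * dv (row l (E i)) ('d_b (u i)) (x i).
    rewrite dv_partial_frame; apply: eq_bigr => b _; apply: eq_bigr => c _.
    by rewrite [in RHS]mxE.
  rewrite -sumrB; apply: eq_bigr => b _.
  rewrite (dv_test_form HA beta_sm gam_sm (Cu i) _ _ (Ax i)) [row m _ _ _]mxE.
  move: (E i m b) (dv _ ('d_b _) _) (dv _ (shift _ _) _) => s1 s2 s3; ring.
by apply: Dsum => b; apply: (DM (DE m b) (Ddshift b (Drow l))).
Qed.

Let p_a l m : D 1 0 (fun i => p i l m - a i l m).
Proof.
apply: Dext (DD (p_fh l m) (fh_a l m)) => i.
by move: (p i l m) (fh i l m) (a i l m) => s1 s2 s3; ring.
Qed.

Let fr_a l : D 2 1 (fun i => \sum_m fr i m * a i l m).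
Proof.
apply: (@Dext _ _ (fun i => \sum_b V (u i) (x i) 0 b * dv (row l (E i)) ('d_b (u i)) (x i) -
   \sum_m fr i m * (fh i l m - a i l m))) => [i|].
  rewrite dv_partial_frame.
  have -> : \sum_b \sum_c E i l b * V (u i) (x i) 0 c * 'd_b ('d_c (u i)) (x i) = \sum_m fr i m * fh i l m.
    rewrite (frame_hess_vec Gpos beta gam (u i) (Ax i) (EG i) l); apply: eq_bigr => b _.
    by rewrite mulr_sumr; apply: eq_bigr => c _; rewrite mulrA.
  by rewrite -sumrB; apply: eq_bigr => m _; rewrite -mulrBr opprB addrC subrK.
apply: DB; first exact: (DVform (Drow l)).
by apply: Dsum => m; apply: (DM (Dframe m) (fh_a l m)).
Qed.

Let fh_lam l : D 2 0 (fun i => fh i l l - lam i 0 l).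
Proof.
apply: (@Dext _ _ (fun i => (fh i l l - a i l l) + (2^-1 * W (u i) (x i) - fr i l * fr i l))) => [i|].
  rewrite -y2 /a eqxx mulr1.
  by move: (fh i l l) (y i ^+ 2) (fr i l) (lam i 0 l) => s1 s2 s3 s4; ring.
apply: DD; first exact: (DW (fh_a l l)).
apply: DB; first exact: (DZ 2^-1 D_W).
by apply: (DM (Dframe l) (Dframe l)).
Qed.

Let Dgs (w : I -> 'rV[R]_n) : (forall k, D 1 0 (fun i => w i 0 k)) ->
  (forall k, D 2 1 (fun i => dv (w i) ('d_k (u i)) (x i))) ->
  D 3 1 (fun i => dv (w i) (grad_sq A G (u i)) (x i)).
Proof.
move=> Dw Dwu; apply: (Dext (fun i => esym (dv_grad_sq (w i) (Cu i) (Ax i)))).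
apply: Dsum => b; apply: Dsum => c; apply: DD.
  apply: (DM (Ddv Dw (smooth_ginv HA Gsm Gpos b c)) (DM (Du b) (Du c) (leqnn _) (leqnn _))) => //.
apply: (DM (Dsm (smooth_ginv HA Gsm Gpos b c)) (_ : D 3 1 _)) => //.
by apply: DD; [apply: (DM (Dwu b) (Du c)) | apply: (DM (Du b) (Dwu c))].
Qed.

Let rest i l := \sum_b \sum_c E i l b * E i l c * dv_U_low (u i) (V (u i) (x i)) b c (x i).

(** Hessian entries occur here only contracted with [V], so they are [O(y^2 h)], and they carry at
    most one further factor [du]. *)
Let Drest l : D 3 1 (fun i => rest i l).
Proof.
apply: Dsum => b; apply: Dsum => c.
apply: (DM (DM (DE l b) (DE l c) (leqnn _) (leqnn _)) (_ : D 3 1 _)) => //.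
have Dg : D 2 0 (fun i => grad_sq A G (u i) (x i)).
  apply: Dsum => a1; apply: Dsum => a2.
  by apply: (DM (Dsm (smooth_ginv HA Gsm Gpos a1 a2)) (DM (Du a1) (Du a2) (leqnn _) (leqnn _))).
apply: DD; last exact: (DW (Ddv DV (smooth_schouten HA Gsm Gpos b c))).
apply: DB; last first.
  apply: DZ; apply: DD; first by apply: (DM (Dgs DV Dq) (Dsm (Gsm b c))).
  by apply: (DM Dg (Ddv DV (Gsm b c))).
apply: DD; last by apply: DD; [apply: (DM (Dq b) (Du c)) | apply: (DM (Du b) (Dq c))].
apply: DN; apply: Dsum => k; have sC := smooth_christoffel HA Gsm Gpos k b c.
by apply: DD; [apply: (DM (Ddv DV sC) (Du k)) | apply: (DM (Dsm sC) (Dq k))].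
Qed.

Let eDG i l := (E i *m dv_mx (V (u i) (x i)) G (x i) *m (E i)^T) l l.
Let eDU i l := (E i *m dv_mx (V (u i) (x i)) (U_tensor A G (u i)) (x i) *m (E i)^T) l l.

Let DeDG l : D 1 0 (fun i => eDG i l).
Proof.
apply: (@Dext _ _ (fun i => \sum_b \sum_c E i l b * E i l c *
    dv (V (u i) (x i)) (fun z => G z b c) (x i))) => [i|].
  rewrite /eDG mx_conj_entry; apply: eq_bigr => b _; apply: eq_bigr => c _.
  by rewrite [in RHS]mxE.
apply: Dsum => b; apply: Dsum => c.
by apply: (DM (DM (DE l b) (DE l c) (leqnn _) (leqnn _)) (Ddv DV (Gsm b c))).
Qed.

Let third i l : \sum_b V (u i) (x i) 0 b * dv (row l (E i)) (dv (row l (E i)) ('d_b (u i))) (x i) =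
  eDU i l - rest i l.
Proof.
rewrite (third_order _ _ (Cu i) (Ax i)) /eDU mx_conj_entry -sumrB.
apply: eq_bigr => b _; rewrite -sumrB; apply: eq_bigr => c _.
rewrite [X in _ = _ * X - _]mxE (dv_U _ _ _ (Cu i) (Ax i)) mulrDr addrK.
by rewrite ![row l (E i) _ _]mxE.
Qed.

Let cb i := \sum_b V (u i) (x i) 0 b * beta b (x i).
(** What remains of the second derivative of the shift once [u_ll] is split into [lam_l] and an
    error; the eigenvalue part is collected in [sg]. *)
Let sh2 i l b := expR (- u i (x i)) * (dv (row l (E i)) (dv (row l (E i)) (beta b)) (x i)
    - 2 * dv (row l (E i)) (beta b) (x i) * dv (row l (E i)) (u i) (x i)
    - beta b (x i) * (fh i l l - lam i 0 l)
    + beta b (x i) * dv (row l (E i)) (u i) (x i) ^+ 2)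
  + dv (row l (E i)) (dv (row l (E i)) (gam b)) (x i).

Let Dsh2 l b : D 2 0 (fun i => sh2 i l b).
Proof.
have Db := Dsm (beta_sm b); have De := Ddvu (Drow l).
apply: DD; last exact: (DW (Ddd (Drow l) (gam_sm b))).
apply: (DM Dexp (_ : D 2 0 _)) => //; apply: DD; last by apply: (DM Db (DX 2 De)).
apply: DB; last by apply: (DM Db (fh_lam l)).
apply: DB; first exact: (DW (Ddd (Drow l) (beta_sm b))).
by apply: (DM (DZ 2 (Ddv (Drow l) (beta_sm b))) De).
Qed.

Let shift2 i l : \sum_b V (u i) (x i) 0 b * dv (row l (E i)) (dv (row l (E i)) (shift (u i) b)) (x i) =
  \sum_b V (u i) (x i) 0 b * sh2 i l b - expR (- u i (x i)) * cb i * lam i 0 l.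
Proof.
rewrite /cb mulr_sumr mulr_suml -sumrB; apply: eq_bigr => b _.
rewrite (dd_shift_form HA beta_sm gam_sm (Cu i)) // (dd_frame HA (Cu i) (Ax i)) /sh2 /fh.
move: (expR _) (dv _ (dv _ (beta b)) _) (dv _ (dv _ (gam b)) _) (dv _ (beta b) _) (beta b _) (dv _ (u i) _)
  (frame_hess _ _ _ _ _ _) (lam i 0 l) (V (u i) (x i) 0 b) => s1 s2 s3 s4 s5 s6 s7 s8 s9; ring.
Qed.

(** Coefficients of the term mixing derivatives of [g^-1] and of [om]; the coframe expresses the
    latter through [p]. *)
Let al i l m := 4 * \sum_b \sum_c dv (row l (E i)) (fun z => ginv G z b c) (x i) *
  om (u i) c (x i) * coframe G (x i) (E i) b m.

Let Dal l m : D 1 0 (fun i => al i l m).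
Proof.
apply: DZ; apply: Dsum => b; apply: Dsum => c.
by apply: (DM (DM (Ddv (Drow l) (smooth_ginv HA Gsm Gpos b c)) (Dom c) (leqnn _) (leqnn _)) (Dco b m)).
Qed.

Let alE i l : 4 * (\sum_b \sum_c dv (row l (E i)) (fun z => ginv G z b c) (x i) * om (u i) c (x i) *
    dv (row l (E i)) (om (u i) b) (x i)) = \sum_m al i l m * p i l m.
Proof.
have -> : \sum_m al i l m * p i l m = 4 * \sum_m \sum_b \sum_c
    dv (row l (E i)) (fun z => ginv G z b c) (x i) * om (u i) c (x i) * coframe G (x i) (E i) b m * p i l m.
  rewrite mulr_sumr; apply: eq_bigr => m _; rewrite /al -mulrA; apply: congrM; first by [].
  by rewrite mulr_suml; apply: eq_bigr => b _; rewrite mulr_suml.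
apply: congrM; first by []; rewrite [RHS]exchange_big /=; apply: eq_bigr => b _.
rewrite [RHS]exchange_big /=; apply: eq_bigr => c _.
rewrite (coframeK (EG i) (fun b => dv (row l (E i)) (om (u i) b) (x i)) b) mulr_sumr.
by apply: eq_bigr => m _; rewrite mulrA.
Qed.

Let sqE i l : \sum_b \sum_c ginv G (x i) b c * (dv (row l (E i)) (om (u i) b) (x i) *
    dv (row l (E i)) (om (u i) c) (x i)) = \sum_m p i l m ^+ 2.
Proof.
by rewrite (frame_ginv_form Gpos (Ax i) (EG i)); apply: eq_bigr => m _; rewrite expr2.
Qed.

Let t1 i l := \sum_b \sum_c dv (row l (E i)) (dv (row l (E i)) (fun z => ginv G z b c)) (x i) *
  (om (u i) b (x i) * om (u i) c (x i)).
Let z i l := h i ^+ 2 * (6 * dv (row l (E i)) eta (x i) ^+ 2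
  - 2 * (eta (x i) * dv (row l (E i)) (dv (row l (E i)) eta) (x i))) * W (u i) (x i).
Let sg i l := 2 * (eDG i l - expR (- u i (x i)) * cb i).
Let tau1 i l := t1 i l + 2 * ((\sum_b V (u i) (x i) 0 b * sh2 i l b) - rest i l).
Let rho i := 2 * (- 2 * expR (- 2 * u i (x i)) * dv (V (u i) (x i)) (u i) (x i)).

(** Arranged in the shape of [gradient_inequality]; the last summand, weighted by [f_l] and summed
    over [l], is [rho] by the linearized equation. *)
Let dd_eq i l : dv (row l (E i)) (dv (row l (E i)) (W (u i))) (x i) =
  2 * (\sum_m p i l m ^+ 2) + \sum_m al i l m * p i l m + sg i l * lam i 0 l + tau1 i l
  + 2 * (eDU i l - lam i 0 l * eDG i l).
Proof.
rewrite (dd_test_sq HA Gsm Gpos beta_sm gam_sm (Cu i) (Ax i)) -/(t1 i l) alE sqE.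
have -> : \sum_b V (u i) (x i) 0 b * dv (row l (E i)) (dv (row l (E i)) (om (u i) b)) (x i) =
    (eDU i l - rest i l) + (\sum_b V (u i) (x i) 0 b * sh2 i l b - expR (- u i (x i)) * cb i * lam i 0 l).
  rewrite -third -shift2 -big_split; apply: eq_bigr => b _ /=.
  by rewrite (dd_test_form HA beta_sm gam_sm (Cu i) _ _ (Ax i)) mulrDr.
rewrite /sg /tau1.
move: (\sum_m _ * _) (\sum_m _) (\sum_b _) (t1 i l) (eDU i l) (eDG i l) (rest i l) (expR _) (cb i) (lam i 0 l).
move=> s1 s2 s3 s4 s5 s6 s7 s8 s9 s10; ring.
Qed.

Let Dsg l : D 1 0 (fun i => sg i l).
Proof.
apply: DZ; apply: DB; first exact: DeDG.
apply: (DM Dexp (_ : D 1 0 _)) => //; apply: Dsum => b.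
by apply: (DM (DV b) (Dsm (beta_sm b))).
Qed.

Let Dtau1 l : D 3 1 (fun i => tau1 i l).
Proof.
apply: DD.
  apply: Dsum => b; apply: Dsum => c.
  by apply: (DM (Ddd (Drow l) (smooth_ginv HA Gsm Gpos b c)) (DM (Dom b) (Dom c) (leqnn _) (leqnn _))).
apply: DZ; apply: DB; last exact: Drest.
by apply: Dsum => b; apply: (DM (DV b) (Dsh2 l b)).
Qed.

Let Dz l : D 2 2 (fun i => z i l).
Proof.
have Dh : D 0 1 h by exists 1 => // i; rewrite expr0 expr1 !mul1r gtr0_norm.
apply: (DM (DM (DX 2 Dh) (_ : D 0 0 _) (leqnn _) (leqnn _)) D_W) => //.
have De := Ddv (Drow l) eta_sm.
apply: DB; first by apply: DZ; apply: (DX 2 De).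
by apply: DZ; apply: (DM (Dsm eta_sm) (Ddd (Drow l) eta_sm)).
Qed.

Let Drho : D 2 0 rho.
Proof.
apply: DZ; apply: (DM (DZ (- 2) (_ : D 0 0 _)) (_ : D 2 0 _)) => //.
  apply: Dext (DX 2 Dexp) => i.
  rewrite expr2 -expRD; congr expR; ring.
by apply: Dsum => b; apply: (DM (DV b) (Du b)).
Qed.

Variables (c0 c1 eps : R).
Hypotheses (c0_gt0 : 0 < c0) (c1_gt0 : 0 < c1) (eps_gt0 : 0 < eps).
Hypothesis f_mono : forall l mu, Gamma mu -> 0 < partial Gamma l f mu.
Hypothesis f_trace : forall mu, Gamma mu -> c0 <= \sum_l partial Gamma l f mu.
Hypothesis f_st : structural Gamma f (expR (2 * C0)) eps c1.
Hypothesis flam : forall i, f (lam i) = expR (- 2 * u i (x i)).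

Lemma estimate_at_max : exists C : R, forall i, eta (x i) * Num.sqrt (W (u i) (x i)) <= C.
Proof.
have [k1 H1] := big_oh_common y1 h0 (fun lm : 'I_n * 'I_n => p_a lm.1 lm.2).
have [k2 H2] := big_oh_common y1 h0 fr_a.
have [k3 H3] := big_oh_common y1 h0 (fun lm : 'I_n * 'I_n => Dal lm.1 lm.2).
have [k4 H4] := big_oh_common y1 h0 Dsg.
have [k5 H5] := big_oh_common y1 h0 Dtau1.
have [k6 H6] := big_oh_common y1 h0 Dz.
have [k7 H7] := big_oh_common y1 h0 (fun _ : unit => Drho).
have [k Hk] := seq_bound [:: 1; Kh; k1; k2; k3; k4; k5; k6; k7].
have [k_1 kh kk1] : [/\ 1 <= k, Kh <= k & k1 <= k] by split; apply: Hk; rewrite !inE eqxx ?orbT.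
have [kk2 kk3 kk4] : [/\ k2 <= k, k3 <= k & k4 <= k] by split; apply: Hk; rewrite !inE eqxx ?orbT.
have [kk5 kk6 kk7] : [/\ k5 <= k, k6 <= k & k7 <= k] by split; apply: Hk; rewrite !inE eqxx ?orbT.
have [C C_gt0 HC] := gradient_inequality n k_1 eps_gt0 c1_gt0 c0_gt0.
exists C => i; rewrite -/(y i) mulrC -ler_pdivlMr //.
(* The upper bound [z] of the second order condition is moved to the left and becomes part of
   [tau]. *)
apply: (HC (fun l => partial Gamma l f (lam i)) (fun l => lam i 0 l) (fr i) (sg i)
  (fun l => tau1 i l - z i l) (p i) (al i) (rho i)) => //.
- by move=> l; exact: f_mono.
- exact: f_trace.
- exact: h0.
- by apply: le_trans (Kh1 i) _; rewrite ler_wpM2r // ltW.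
- by rewrite y2 (test_sq_frame Gpos beta gam (u i) (Ax i) (EG i)).
- by move=> l m; have := H1 k kk1 (l, m) i; rewrite expr1 expr0 mulr1.
- by move=> l; have := H2 k kk2 l i; rewrite expr1.
- pose xv : 'rV[R]_n := \row_l fr i l.
  have xvE l : xv 0 l = fr i l by rewrite mxE.
  have yE : enorm xv = y i.
    rewrite /enorm /y (test_sq_frame Gpos beta gam (u i) (Ax i) (EG i)) /sqnorm.
    by congr (Num.sqrt _); apply: eq_bigr => l _; rewrite xvE.
  have fl : f (lam i) <= expR (2 * C0).
    by rewrite flam ler_expR; have := u_lb i; lra.
  move=> ey Hl; have := @f_st (lam i) xv (lamG i) fl; rewrite yE => /(_ ey).
  move=> Hf; apply: (le_trans (Hf _)); first by move=> l; rewrite xvE.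
  by rewrite le_eqVlt; apply/orP; left; apply/eqP/eq_bigr => l _; rewrite xvE.
- by move=> l m; have := H3 k kk3 (l, m) i; rewrite expr1 expr0 mulr1.
- by move=> l; have := H4 k kk4 l i; rewrite expr1 expr0 mulr1.
- move=> l; apply: le_trans (ler_normB _ _) _; rewrite mulrDr; apply: lerD; last exact: H6.
  by have := H5 k kk5 l i; rewrite expr1.
- by have := H7 k kk7 tt i; rewrite expr0 mulr1.
- rewrite /rho -(linearized_equation _ (Cu i) (xi i) (ui i) (EG i) (EU i) (lamG i)).
  rewrite mulr_sumr -big_split; apply: sumr_le0 => l _ /=.
  have := second_order i (row l (E i)); rewrite dd_eq -/(z i l) => H.
  have fl := f_mono l (lamG i).
  rewrite mulrCA -mulrDr pmulr_rle0 // -/(eDU i l) -/(eDG i l).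
  move: H; move: (\sum_m p i l m ^+ 2) (\sum_m al i l m * p i l m) (sg i l) (lam i 0 l) (tau1 i l) (z i l) (eDU i l) (eDG i l).
  move=> s1 s2 s3 s4 s5 s6 s7 s8; lra.
Qed.

End estimates.

Lemma frame_exists u x : class_C 2 A u -> solves u -> A x -> exists E lam,
  [/\ E *m G x *m E^T = 1%:M, E *m U_tensor A G u x *m E^T = diag_mx lam, Gamma lam &
     f lam = expR (- 2 * u x)].
Proof.
move=> Cu su Ax; have [lam [ev Gl fl]] := su x Ax.
have [E [EG EU]] := simultaneous_diag (Gpos Ax) (U_tensor_sym HA Gsm Gpos Cu Ax) ev.
by exists E, lam.
Qed.

(** The index type of the estimates becomes the type of all triples of a function, a point and a
    frame that satisfy the hypotheses, which makes [k] uniform. *)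
Lemma normal_derivative_estimate (nu : 'I_n -> 'rV[R]_n -> R) (N : 'I_n) :
  (forall k, smooth A (nu k)) -> (forall z, K z -> 0 < eta z) ->
  exists k, forall u x, class_C 3 A u -> solves u -> (forall z, A z -> - C0 <= u z) ->
    (forall z, A z -> z 0 N = 0 -> \sum_k nu k z * om u k z = 0) ->
    K x -> x 0 N = 0 -> V u x 0 N = 0 -> 1 <= W u x ->
    `|dv (\row_k nu k x) (W u) x| <= k * W u x.
Proof.
move=> nu_sm eta0.
pose P (d : ('rV[R]_n -> R) * 'rV[R]_n * 'M[R]_n) := let: (u, x, E) := d in
  [/\ class_C 3 A u, - C0 <= u x & forall z, A z -> z 0 N = 0 -> \sum_k nu k z * om u k z = 0] /\
  [/\ K x, x 0 N = 0, V u x 0 N = 0, 1 <= W u x & E *m G x *m E^T = 1%:M].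
have [|||||||||k Hk] := @boundary_bound {d | P d} (fun d => (sval d).1.1) (fun d => (sval d).1.2)
  (fun d => (sval d).2) _ _ _ _ _ _ nu N nu_sm.
all: try by case=> -[[u x] E] /= [[? ? ?] [? ? ? ? ?]] //; exact: eta0.
exists k => u x Cu su ulb bc Kx xN VN W1.
have [E [lam [EG _ _ _]]] := frame_exists (class_CW Cu) su (KA Kx).
have Pd : P (u, x, E) by split; split=> //; exact/ulb/KA.
exact: (Hk (exist _ _ Pd)).
Qed.

Lemma interior_max_estimate (c0 c1 eps : R) : 0 < c0 -> 0 < c1 -> 0 < eps ->
  (forall l mu, Gamma mu -> 0 < partial Gamma l f mu) ->
  (forall mu, Gamma mu -> c0 <= \sum_l partial Gamma l f mu) ->
  (structural Gamma f (expR (2 * C0)) eps c1) ->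
  exists C, forall u x, class_C 3 A u -> solves u -> (forall z, A z -> - C0 <= u z) ->
    K x -> interior_pt L A x -> 0 < eta x -> local_max A (fun z => eta z * eta z * W u z) x ->
    1 <= W u x -> eta x * Num.sqrt (W u x) <= C.
Proof.
move=> c0_gt0 c1_gt0 eps_gt0 f_mono f_trace f_st.
pose P (d : ('rV[R]_n -> R) * 'rV[R]_n * 'M[R]_n * 'rV[R]_n) := let: (u, x, E, lam) := d in
  [/\ class_C 3 A u, solves u, - C0 <= u x, K x & interior_pt L A x] /\
  [/\ 0 < eta x, local_max A (fun z => eta z * eta z * W u z) x & 1 <= W u x] /\
  [/\ E *m G x *m E^T = 1%:M, E *m U_tensor A G u x *m E^T = diag_mx lam, Gamma lam &
     f lam = expR (- 2 * u x)].
have [||||||||||||k Hk] := @estimate_at_max {d | P d} (fun d => (sval d).1.1.1) (fun d => (sval d).1.1.2)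
  (fun d => (sval d).1.2) (fun d => (sval d).2) _ _ _ _ _ _ _ _ _ _ _ c0 c1 eps c0_gt0 c1_gt0 eps_gt0 f_mono f_trace f_st.
all: try by case=> -[[[u x] E] lam] /= [[? ? ? ? ?] [[? ? ?] [? ? ? ?]]].
exists k => u x Cu su ulb Kx xint eta0 xmax W1.
have [E [lam [EG EU Gl fl]]] := frame_exists (class_CW Cu) su (KA Kx).
have Pd : P (u, x, E, lam) by split; [split=> //; exact/ulb/KA | split].
exact: (Hk (exist _ _ Pd)).
Qed.

End interior_estimate.

(** * Boundary maxima and the local estimate *)

Section local_estimate.
Variables (R : realType) (n' : nat).
Local Notation n := n'.+1.
Variables (N : 'I_n) (A : set 'rV[R]_n).
Hypothesis HA : corner_open (pred1 N) A.
Variable G : 'rV[R]_n -> 'M[R]_n.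
Hypothesis Gsm : forall i j, smooth A (fun x => G x i j).
Hypothesis Gpos : forall x, A x -> posdef (G x).
Local Notation dv := (dder A).
Local Notation "'d_ i" := (partial A i) (at level 8, i at level 2).
Variables (Gamma : set 'rV[R]_n) (f : 'rV[R]_n -> R).
Hypothesis HGamma : corner_open pred0 Gamma.
Hypothesis f_C1 : class_C 1 Gamma f.
Hypothesis Gamma_sym : forall (s : 'S_n) lam, Gamma lam -> Gamma (col_perm s lam).
Hypothesis f_sym : forall (s : 'S_n) lam, Gamma lam -> f (col_perm s lam) = f lam.
Variables (c C0 c0 c1 eps : R).
Hypotheses (c0_gt0 : 0 < c0) (c1_gt0 : 0 < c1) (eps_gt0 : 0 < eps).
Hypothesis f_mono : forall l mu, Gamma mu -> 0 < partial Gamma l f mu.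
Hypothesis f_trace : forall mu, Gamma mu -> c0 <= \sum_l partial Gamma l f mu.
Hypothesis f_st : structural Gamma f (expR (2 * C0)) eps c1.

(* With these coefficients [test_form] is [du - (c e^-u - h) nu^b] extended off
   the boundary, so the boundary condition makes it vanish on the normal. *)
Definition bd_beta (a : 'I_n) y : R := - c * (a == N)%:R * (Num.sqrt (ginv G y N N))^-1.
Definition bd_gam (a : 'I_n) y : R :=
  mean_curvature A G N y * (a == N)%:R * (Num.sqrt (ginv G y N N))^-1.

Lemma bd_beta_sm a : smooth A (bd_beta a).
Proof. by apply: (smoothM HA); [exact: (smooth_cst HA) | exact: (smooth_sqrt_ginvNN HA Gsm Gpos)]. Qed.

Lemma bd_gam_sm a : smooth A (bd_gam a).
Proof.
apply: (smoothM HA); last exact: (smooth_sqrt_ginvNN HA Gsm Gpos).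
by apply: (smoothM HA); [exact: (smooth_mean_curvature HA Gsm Gpos) | exact: (smooth_cst HA)].
Qed.

Local Notation W := (test_sq A G bd_beta bd_gam).
Local Notation om := (test_form A bd_beta bd_gam).
Local Notation shift := (shift_form bd_beta bd_gam).
Local Notation V := (test_vec A G bd_beta bd_gam).
Local Notation nu := (unit_normal G N).

Definition admissible u := [/\ class_C 3 A u, solves A G Gamma f u,
  forall z, A z -> - C0 <= u z &
  forall z, A z -> z 0 N = 0 ->
    normal_deriv A G N u z = c * expR (- u z) - mean_curvature A G N z].

Lemma normal_test_form u z : admissible u -> A z -> z 0 N = 0 -> \sum_k nu k z * om u k z = 0.
Proof.
move=> [_ _ _ bc] Az zN; have g0 := ginvNN_gt0 Gpos N Az.
have s0 : Num.sqrt (ginv G z N N) != 0 by rewrite gt_eqF // sqrtr_gt0.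
have nuN : nu N z * (Num.sqrt (ginv G z N N))^-1 = 1.
  by rewrite /unit_normal -{1}(sqr_sqrtr (ltW g0)) expr2 mulfK // divff.
have -> : \sum_k nu k z * om u k z = normal_deriv A G N u z + \sum_k nu k z * shift u k z.
  by rewrite -big_split; apply: eq_bigr => k _ /=; rewrite -mulrDr.
have -> : \sum_k nu k z * shift u k z = - (c * expR (- u z) - mean_curvature A G N z).
  rewrite (bigD1 N) //= big1 => [|k kN]; last first.
    by rewrite /shift_form /bd_beta /bd_gam (negPf kN) !mulr0 !mul0r mulr0 addr0 mulr0.
  rewrite addr0 /shift_form /bd_beta /bd_gam eqxx !mulr1.
  rewrite -[RHS]mul1r -nuN.
  move: (nu N z) (Num.sqrt _)^-1 (mean_curvature A G N z) (expR _) => s1 s2 s3 s4; ring.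
by rewrite bc // subrr.
Qed.

(** Up to a factor the [N]-component of the raised covector is its value on the normal, so the
    boundary condition makes [V] tangential. *)
Lemma test_vec_normal u z : A z -> V u z 0 N = Num.sqrt (ginv G z N N) * \sum_k nu k z * om u k z.
Proof.
move=> Az; have g0 := ginvNN_gt0 Gpos N Az.
have s0 : Num.sqrt (ginv G z N N) != 0 by rewrite gt_eqF // sqrtr_gt0.
rewrite mxE mulr_sumr; apply: eq_bigr => k _; rewrite /unit_normal (ginv_sym Gpos N k Az).
move: (ginv G z k N) (Num.sqrt _) s0 (om u k z) => s1 s2 s0 s3; field; exact: s0.
Qed.

(** Along the inward normal [eta^2 W] has derivative [eta (2 eta' W + eta W')], positive if
    [eta' > k eta] and [|W'| <= k W]; at a boundary maximum it could be at most zero. *)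
Lemma no_boundary_max u x (eta : 'rV[R]_n -> R) k : class_C 3 A u -> smooth A eta -> A x -> x 0 N = 0 ->
  0 < eta x -> 1 <= W u x -> `|dv (\row_k nu k x) (W u) x| <= k * W u x ->
  k * eta x < dv (\row_k nu k x) eta x ->
  ~ local_max A (fun z => eta z * eta z * W u z) x.
Proof.
move=> Cu Ceta Ax xN eta0 W1 kW keta xmax; set v : 'rV[R]_n := \row_k nu k x in kW keta.
have C2 : class_C 1 A (fun z => eta z * eta z) by apply: (class_CM HA); exact: Ceta.
have CW : class_C 1 A (W u) := class_CW (class_test_sq HA Gsm Gpos bd_beta_sm bd_gam_sm Cu).
have CQ := class_CM HA C2 CW.
have : dv v (fun z => eta z * eta z * W u z) x <= 0.
  rewrite /dder (bigD1 N) //= big1 ?addr0 => [|b bN].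
    rewrite mxE pmulr_rle0; last exact: normal_inward (Gpos Ax).
    exact: (local_max_partial_le0 HA).
  by rewrite (local_max_partial_eq0 HA CQ Ax xmax) ?mulr0 //= => /eqP b_N; rewrite b_N eqxx in bN.
rewrite (dvM HA Ax v C2 CW) (dvM HA Ax v (Ceta 1) (Ceta 1)).
have W0 : 0 < W u x := lt_le_trans ltr01 W1.
have k0 : 0 <= k by rewrite -(pmulr_lge0 _ W0) (le_trans _ kW).
move: kW; rewrite ler_norml => /andP[kW _].
move: (dv v (W u) x) (dv v eta x) (eta x) (W u x) W0 kW keta eta0 => w' e' e w w0 kw ke e0 H.
have : e * (2 * e' * w + e * w') <= 0.
  by apply: le_trans H; rewrite le_eqVlt; apply/orP; left; apply/eqP; ring.
rewrite pmulr_rle0 // leNgt => /negP; apply.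
have H1 : - (e * (k * w)) <= e * w' by rewrite -mulrN ler_pM2l.
have H2 : k * e * w < e' * w by rewrite ltr_pM2r.
have H3 : 0 <= k * e * w by rewrite !mulr_ge0 // ltW.
have E1 : e * (k * w) = k * e * w by ring.
have E2 : 2 * e' * w + e * w' = e' * w + (e' * w + e * w') by ring.
rewrite E2; rewrite E1 in H1; move: (k * e * w) (e' * w) (e * w') H1 H2 H3 => s1 s2 s3; lra.
Qed.

(** Written as a product of segments to get compactness; in the slot [N] the half-space constraint
    is built into the left endpoint. *)
Definition box (p : 'rV[R]_n) (rho : R) : set 'rV[R]_n :=
  [set y | forall i, y 0 i \in `[(if i == N then Num.max 0 (p 0 i - rho) else p 0 i - rho), p 0 i + rho]].

Lemma boxP p rho y : box p rho y <-> (forall i, `|y 0 i - p 0 i| <= rho) /\ 0 <= y 0 N.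
Proof.
split=> [H|[H yN] i].
  split=> [i|]; last by have := H N; rewrite eqxx in_itv /= ge_max => /andP[/andP[]].
  have := H i; rewrite in_itv /= ler_norml => /andP[H1 H2].
  have {}H1 : p 0 i - rho <= y 0 i.
    by move: H1; case: ifP => // _; rewrite ge_max => /andP[].
  by apply/andP; split; lra.
have := H i; rewrite ler_norml in_itv /= => /andP[].
case: eqVneq => [->|_] H1 H2; last by apply/andP; split; lra.
by rewrite ge_max yN /=; apply/andP; split; lra.
Qed.

Lemma compact_box p rho : compact (box p rho).
Proof.
have := @rV_compact R n (fun i => `[(if i == N then Num.max 0 (p 0 i - rho) else p 0 i - rho), p 0 i + rho]%classic).
by apply=> i; exact: segment_compact.
Qed.

Lemma within_sub (B : set 'rV[R]_n) (F : 'rV[R]_n -> R) : B `<=` A -> {within A, continuous F} -> {within B, continuous F}.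
Proof. by move=> BA; apply: continuous_subspaceW. Qed.

Lemma smooth_bounded p rho F : box p rho `<=` A -> smooth A F ->
  exists b : R, forall y, box p rho y -> `|F y| <= b.
Proof.
move=> BA sF; have [[y0 By0]|nB] := pselect (exists y, box p rho y); last first.
  by exists 0 => y By; case: nB; exists y.
have cF : {within box p rho, continuous (fun y => `|F y|)}.
  apply: continuous_comp1; last by move=> y _; exact: norm_continuous.
  by apply: within_sub (class_C_continuous (sF 0)).
have [|z zB Hz] := EVT_max_rV _ (@compact_box p rho) cF; first by exists y0.
by exists `|F z| => y By; apply: Hz; rewrite inE.
Qed.

Lemma smooth_bounded_fin p rho (J : finType) (F : J -> 'rV[R]_n -> R) : box p rho `<=` A ->
  (forall j, smooth A (F j)) -> exists2 b : R, 0 <= b & forall j y, box p rho y -> `|F j y| <= b.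
Proof.
move=> BA sF; have [b Hb] := fin_all_exists (fun j => smooth_bounded BA (sF j)).
exists (\sum_j `|b j|); first exact: sumr_ge0.
move=> j y By; apply: le_trans (Hb j y By) _; apply: le_trans (ler_norm _) _.
by rewrite (bigD1 j) //= lerDl sumr_ge0.
Qed.

(* The concave term confines [cutoff > 0] to the box of radius [rho] for any slope
   [B] at the boundary, and a large [B] rules out a maximum there. *)
Definition cutoff (p : 'rV[R]_n) (rho B : R) (y : 'rV[R]_n) : R :=
  rho ^+ 2 / 4 + B * y 0 N - (B / rho) ^+ 2 * (y 0 N * y 0 N)
  - \sum_i (y 0 i - p 0 i) * (y 0 i - p 0 i).

Lemma smooth_cutoff p rho B : smooth A (cutoff p rho B).
Proof.
have sc k : smooth A (fun y => y 0 k) by exact: (smooth_coord HA).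
have scst r : smooth A (fun=> r : R) by exact: (smooth_cst HA).
apply: (smoothB HA); last by apply: (smooth_sum HA) => i _; apply: (smoothM HA); apply: (smoothB HA).
apply: (smoothB HA); last by apply: (smoothM HA) => //; apply: (smoothM HA).
by apply: (smoothD HA) => //; apply: (smoothM HA).
Qed.

Lemma cutoff_pos p rho B y : 0 < rho -> 0 < cutoff p rho B y -> forall i, `|y 0 i - p 0 i| < rho.
Proof.
move=> rho0 + i; rewrite /cutoff (bigD1 i) //=.
have : 0 <= \sum_(j | j != i) (y 0 j - p 0 j) * (y 0 j - p 0 j).
  by apply: sumr_ge0 => j _; rewrite -expr2 sqr_ge0.
move: (\sum_(j | _) _) (y 0 i - p 0 i) (y 0 N) => s e t s0 H.
(* Completing the square: the terms in [y 0 N] contribute at most [rho^2 / 4] whatever [B] is, so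
   positivity forces [|y - p|^2 < rho^2 / 2]. *)
have H1 : B * t - (B / rho) ^+ 2 * (t * t) <= rho ^+ 2 / 4.
  rewrite -subr_ge0.
  have -> : rho ^+ 2 / 4 - (B * t - (B / rho) ^+ 2 * (t * t)) = (B / rho * t - rho / 2) ^+ 2.
    by field; rewrite gt_eqF.
  exact: sqr_ge0.
have : `|e| ^+ 2 < rho ^+ 2.
  rewrite real_normK ?num_real // expr2.
  have r2 : 0 < rho ^+ 2 by rewrite exprn_gt0.
  lra.
by rewrite ltr_pXn2r // nnegrE // ltW.
Qed.

Lemma cutoff_center (p : 'rV[R]_n) (rho B : R) : (p 0 N = 0 \/ B = 0) -> cutoff p rho B p = rho ^+ 2 / 4.
Proof.
move=> pB; rewrite /cutoff big1 => [|i _]; last by rewrite subrr mul0r.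
by case: pB => ->; rewrite ?mulr0 ?mul0r ?expr0n /= ?mul0r ?subr0 ?addr0.
Qed.

Lemma dv_cutoff v p rho B y : A y -> y 0 N = 0 ->
  dv v (cutoff p rho B) y = B * v 0 N - 2 * \sum_i v 0 i * (y 0 i - p 0 i).
Proof.
move=> Ay yN.
have Cc k : class_C 1 A (fun z => z 0 k) by exact: (class_C_coord HA).
have Ccst r : class_C 1 A (fun=> r : R) by exact: (class_C_cst HA).
have Cd i := class_CB HA (Cc i) (Ccst (p 0 i)).
have Csq i := class_CM HA (Cd i) (Cd i).
have C1 := class_CM HA (Ccst B) (Cc N); have C2 := class_CM HA (Cc N) (Cc N).
have C3 := class_CD HA (Ccst (rho ^+ 2 / 4)) C1; have C4 := class_CM HA (Ccst ((B / rho) ^+ 2)) C2.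
have C5 : class_C 1 A (fun y => \sum_i (y 0 i - p 0 i) * (y 0 i - p 0 i)) by exact: (class_C_sum HA).
rewrite (dvB HA Ay v (class_CB HA C3 C4) C5) (dvB HA Ay v C3 C4) (dvD HA Ay v (Ccst _) C1).
rewrite (dv_cst HA) // (dvZ HA Ay v B (Cc N)) (dvZ HA Ay v _ C2) (dvM HA Ay v (Cc N) (Cc N)).
rewrite (dv_coord HA) // yN mulr0 mul0r addr0 mulr0 subr0 add0r; congr (_ - _).
rewrite (dv_sum HA Ay) // mulr_sumr; apply: eq_bigr => i _.
rewrite (dvM HA Ay v (Cd i) (Cd i)) (dvB HA Ay v (Cc i) (Ccst _)) (dv_cst HA) // (dv_coord HA) //.
by rewrite subr0; ring.
Qed.

Lemma cutoff_exists p : A p -> exists rho B k, [/\ 0 < rho, box p rho `<=` A,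
  cutoff p rho B p = rho ^+ 2 / 4,
  forall x, box p rho x -> x 0 N = 0 -> 0 < cutoff p rho B x ->
    k * cutoff p rho B x < dv (\row_k nu k x) (cutoff p rho B) x &
  forall u x, admissible u -> box p rho x -> x 0 N = 0 -> 1 <= W u x ->
    `|dv (\row_k nu k x) (W u) x| <= k * W u x].
Proof.
move=> Ap; have [d0 d00 H0] := corner_open_near HA Ap.
have pN : 0 <= p 0 N by apply: (corner_open_sub HA Ap) => /=.
(* At an interior [p] the radius stays below [p 0 N], which keeps the box off the boundary; at a
   boundary point the value 1 is arbitrary. *)
pose r0 := if p 0 N == 0 then 1 else p 0 N.
have r00 : 0 < r0 by rewrite /r0; case: eqVneq => // pN0; rewrite lt_def pN0.
pose rho := Num.min (Num.min d0 1) r0 / 2.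
have m0 : 0 < Num.min (Num.min d0 1) r0 by rewrite !lt_min d00 ltr01.
have rho0 : 0 < rho by rewrite divr_gt0.
have : rho < Num.min (Num.min d0 1) r0 by rewrite ltr_pdivrMr // ltr_pMr // ltr1n.
rewrite !lt_min => /andP[/andP[rhod rho1] rhor].
have BA : box p rho `<=` A.
  move=> y /boxP[yp yN]; apply: H0 => [i|i /eqP ->] //; exact: le_lt_trans (yp i) rhod.
have nu_sm k : smooth A (nu k) by exact: (smooth_unit_normal HA Gsm Gpos).
have nuN_gt0 y : A y -> 0 < nu N y by move=> Ay; exact: normal_inward (Gpos Ay).
(* The boundary estimate is taken with the constant cutoff 1, so [k] is independent of [B] and [B]
   may be chosen in terms of [k]. *)
have [|k Hk] := @normal_derivative_estimate R n' (pred1 N) A HA G Gsm Gpos bd_beta bd_gam bd_beta_sm bd_gam_sm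
  (box p rho) BA (fun F => @smooth_bounded p rho F BA) (fun=> 1) C0 (smooth_cst HA 1) Gamma f nu N nu_sm.
  by move=> _ _; exact: ltr01.
have [b1 b10 Hb1] := smooth_bounded_fin BA nu_sm.
have nuV_sm : smooth A (fun y => (nu N y)^-1).
  by apply: (smoothV HA) => // y Ay; rewrite gt_eqF // nuN_gt0.
have [b2 Hb2] := smooth_bounded BA nuV_sm.
(* [b2] bounds the inverse of the normal component of [nu], [|k|] bounds [k eta] since [eta <= 1] at
   boundary points, [2 n b1] bounds the derivative of the quadratic term, and [+ 1] makes the
   inequality strict. *)
pose B := if p 0 N == 0 then b2 * (`|k| + 2 * (n%:R * b1) + 1) else 0.
exists rho, B, k; split => //.
- by apply: cutoff_center; rewrite /B; case: eqVneq => [->|]; [left | right].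
- move=> x Bx xN eta0; have [xp _] := (boxP _ _ _).1 Bx; have Ax := BA x Bx.
  have pN0 : p 0 N == 0.
    apply/negPn/negP => pN0; have := xp N; rewrite xN sub0r normrN ger0_norm //.
    by move: rhor; rewrite /r0 (negPf pN0) => /lt_geF ->.
  rewrite (dv_cutoff _ _ _ _ Ax xN) mxE /B pN0.
  have eta1 : cutoff p rho (if p 0 N == 0 then b2 * (`|k| + 2 * (n%:R * b1) + 1) else 0) x <= 1.
    rewrite /cutoff xN mulr0 mul0r mulr0 subr0 addr0 lerBlDr.
    apply: (@le_trans _ _ 1); last by rewrite lerDl; apply: sumr_ge0 => i _; rewrite -expr2 sqr_ge0.
    rewrite ler_pdivrMr // mul1r; apply: (@le_trans _ _ 1); last by rewrite ler1n.
    by rewrite exprn_ile1 // ltW.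
  have keta : k * cutoff p rho (if p 0 N == 0 then b2 * (`|k| + 2 * (n%:R * b1) + 1) else 0) x <= `|k|.
    apply: le_trans (ler_norm _) _; rewrite normrM ler_piMr // ger0_norm // ltW //.
  rewrite pN0 in keta; apply: le_lt_trans keta _.
  have Hs : \sum_i (\row_k nu k x) 0 i * (x 0 i - p 0 i) <= n%:R * b1.
    apply: (@le_trans _ _ (\sum_(i < n) b1)); last by rewrite sumr_const card_ord mulr_natl.
    apply: ler_sum => i _; apply: le_trans (ler_norm _) _; rewrite normrM mxE -[leRHS]mulr1.
    apply: ler_pM => //; first exact: Hb1.
    by apply: le_trans (xp i) _; exact: ltW.
  have nb : 1 <= b2 * nu N x.
    rewrite -ler_pdivrMr ?nuN_gt0 // mul1r; apply: le_trans (ler_norm _) _; exact: Hb2.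
  have S0 : 0 <= `|k| + 2 * (n%:R * b1) + 1 by rewrite !addr_ge0 // !mulr_ge0.
  have := ler_wpM2r S0 nb; rewrite mul1r.
  have -> : b2 * nu N x * (`|k| + 2 * (n%:R * b1) + 1) = b2 * (`|k| + 2 * (n%:R * b1) + 1) * nu N x by ring.
  move: Hs; move: (\sum_i (\row_k nu k x) 0 i * (x 0 i - p 0 i)) (b2 * (`|k| + 2 * (n%:R * b1) + 1) * nu N x).
  by move: (n%:R * b1) => s3 s1 s2; lra.
- move=> u x Au Bx xN W1; have [Cu su ulb bc] := Au; apply: Hk => //.
    by move=> z Az zN; exact: normal_test_form.
  by rewrite test_vec_normal ?normal_test_form ?mulr0 //; exact: BA.
Qed.

Lemma local_test_bound p : A p -> exists2 d : R, 0 < d & exists C : R, forall u, admissible u ->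
  forall y, A y -> (forall i, `|y 0 i - p 0 i| < d) -> W u y <= C.
Proof.
move=> Ap; have [rho [B [k [rho0 BA etap bd Wb]]]] := cutoff_exists Ap.
set eta := cutoff p rho B in etap bd.
have eta_sm : smooth A eta by exact: smooth_cutoff.
have Bbd F := @smooth_bounded p rho F BA.
have [C HC] := @interior_max_estimate R n' (pred1 N) A HA G Gsm Gpos bd_beta bd_gam bd_beta_sm bd_gam_sm
  (box p rho) BA Bbd eta C0 eta_sm Gamma f HGamma f_C1 Gamma_sym f_sym c0 c1 eps c0_gt0 c1_gt0 eps_gt0
  f_mono f_trace f_st.
have [b Hb] := Bbd eta eta_sm.
(* Half the value of the cutoff at [p], which will bound the cutoff from below near [p]. *)
have e8 : 0 < rho ^+ 2 / 8 by rewrite divr_gt0 ?exprn_gt0.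
have [d1 d10 H1] := (withinP _ _).1 (class_C_continuous (eta_sm 0)) p Ap _ e8.
exists (Num.min d1 rho); first by rewrite lt_min d10.
(* [C] serves the maxima with [W >= 1], [b] those with [W < 1], where [eta sqrt W <= eta]. *)
pose M := `|C| + `|b|.
have M0 : 0 <= M by rewrite addr_ge0.
exists ((M / (rho ^+ 2 / 8)) ^+ 2) => u Au y Ay yd.
have [Cu su ulb _] := Au.
have CW : class_C 2 A (W u) := class_test_sq HA Gsm Gpos bd_beta_sm bd_gam_sm Cu.
have yp i : `|y 0 i - p 0 i| < rho by have := yd i; rewrite lt_min => /andP[].
have By : box p rho y.
  apply/boxP; split=> [i|]; first exact/ltW/yp.
  by apply: (corner_open_sub HA Ay) => /=.
have ety : rho ^+ 2 / 8 <= eta y.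
  have := H1 y (fun i => _) Ay; rewrite etap ler_norml.
  have yd1 i : `|y 0 i - p 0 i| < d1 by have := yd i; rewrite lt_min => /andP[].
  by move=> /(_ yd1)/andP[+ _]; lra.
have ety0 : 0 < eta y by exact: lt_le_trans ety.
have [Wy0|Wy0] := leP (W u y) 0; first by apply: le_trans Wy0 _; exact: sqr_ge0.
suff HM : eta y * Num.sqrt (W u y) <= M.
  have Md : 0 <= M / (rho ^+ 2 / 8) by rewrite divr_ge0 // ltW.
  rewrite -[leLHS](sqr_sqrtr (ltW Wy0)) ler_pXn2r ?nnegrE ?sqrtr_ge0 //.
  rewrite ler_pdivlMr // (le_trans _ HM) // mulrC.
  by rewrite ler_wpM2r // sqrtr_ge0.
(* Twice the positive part of [eta]. The square of [eta] itself may also be large where [eta] is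
   negative; with [ep] the maximum over the compact box lies where [eta > 0]. *)
pose ep z := eta z + `|eta z|.
have epE z : 0 < eta z -> ep z = 2 * eta z by move=> z0; rewrite /ep gtr0_norm // mulr_natl mulr2n.
have cF : {within box p rho, continuous (fun z => ep z * ep z * W u z)}.
  have ce : {within box p rho, continuous eta} by apply: within_sub BA _; exact: class_C_continuous (eta_sm 0).
  have cep : {within box p rho, continuous ep}.
    by apply: withinD => //; apply: continuous_comp1 => // x _; exact: norm_continuous.
  apply: withinM; first exact: withinM.
  by apply: within_sub BA _; exact: class_C_continuous CW.
have [|x] := EVT_max_rV _ (@compact_box p rho) cF; first by exists y.
rewrite inE => Bx Hx; have Ax := BA x Bx.
have {}Hx z : box p rho z -> ep z * ep z * W u z <= ep x * ep x * W u x by move=> Bz; apply: Hx; rewrite inE.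
have Fx0 : 0 < ep x * ep x * W u x.
  by apply: lt_le_trans (Hx y By); rewrite epE // !mulr_gt0.
have etx0 : 0 < eta x.
  rewrite ltNge; apply/negP => etx; move: Fx0; rewrite /ep ler0_norm // subrr !mul0r ltxx //.
have {}Hx z : box p rho z -> 0 < eta z -> eta z * eta z * W u z <= eta x * eta x * W u x.
  move=> Bz etz; have := Hx z Bz; rewrite !epE //.
  move: (eta z) (eta x) (W u z) (W u x) => s1 s2 s3 s4.
  have -> : 2 * s1 * (2 * s1) * s3 = 4 * (s1 * s1 * s3) by ring.
  have -> : 2 * s2 * (2 * s2) * s4 = 4 * (s2 * s2 * s4) by ring.
  by rewrite ler_pM2l.
have Wx0 : 0 < W u x by move: Fx0; rewrite epE // pmulr_rgt0 // !mulr_gt0.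
suff HMx : eta x * Num.sqrt (W u x) <= M.
  apply: le_trans HMx; rewrite -(ler_pXn2r (ltn0Sn 1)) ?nnegrE ?mulr_ge0 ?sqrtr_ge0 ?(ltW ety0) ?(ltW etx0) //.
  by rewrite !exprMn (sqr_sqrtr (ltW Wy0)) (sqr_sqrtr (ltW Wx0)) !expr2; exact: Hx.
have [W1|W1] := leP 1 (W u x); last first.
  apply: (@le_trans _ _ `|b|); last by rewrite /M lerDr.
  apply: (@le_trans _ _ (eta x)).
    by rewrite ler_piMr ?(ltW etx0) // -sqrtr1 ler_wsqrtr // ltW.
  by apply: le_trans (ler_norm _) _; apply: le_trans (Hb x Bx) (ler_norm _).
(* Positivity of the cutoff puts [x] strictly inside the cube, so the maximum over the box is a
   local maximum relative to [A]. *)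
have xmax : local_max A (fun z => eta z * eta z * W u z) x.
  have xp := cutoff_pos rho0 etx0.
  have [d2 d20 H2] : exists2 d : R, 0 < d & forall t, `|t| < d -> forall i,
      (fun i (t : R) => `|t| <= rho - `|x 0 i - p 0 i|) i t.
    apply: common_delta => i; exists (rho - `|x 0 i - p 0 i|); first by rewrite subr_gt0.
    by move=> t /ltW.
  have ex2 : 0 < eta x / 2 by rewrite divr_gt0.
  have [d3 d30 H3] := (withinP _ _).1 (class_C_continuous (eta_sm 0)) x Ax _ ex2.
  exists (Num.min d2 d3); first by rewrite lt_min d20.
  move=> z zd Az; apply: Hx.
    apply/boxP; split=> [i|]; last by apply: (corner_open_sub HA Az) => /=.
    have := zd i; rewrite lt_min => /andP[/H2 /(_ i) H4 _].
    rewrite -(subrK (x 0 i) (z 0 i)) -addrA; apply: le_trans (ler_normD _ _) _.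
    by rewrite -lerBrDr.
  have := H3 z (fun i => _) Az; rewrite ler_norml.
  have zd3 i : `|z 0 i - x 0 i| < d3 by have := zd i; rewrite lt_min => /andP[].
  by move=> /(_ zd3)/andP[+ _]; lra.
have [xN|xN] := eqVneq (x 0 N) 0.
  case: (@no_boundary_max u x eta k Cu eta_sm Ax xN etx0 W1 _ _ xmax); first exact: Wb.
  exact: bd.
apply: (@le_trans _ _ C); last by rewrite (le_trans (ler_norm C)) // lerDl.
apply: HC => //; split=> // i /eqP ->; rewrite lt_def xN /=.
by apply: (corner_open_sub HA Ax) => /=.
Qed.

(** [du] is the test covector minus a shift that [u >= - C0] keeps bounded, and
    [|a - b|^2 <= 2 |a|^2 + 2 |b|^2] in an orthonormal frame. *)
Lemma local_gradient_bound p : A p -> exists2 d : R, 0 < d & exists C : R, forall u, admissible u ->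
  forall y, A y -> (forall i, `|y 0 i - p 0 i| < d) -> grad_sq A G u y <= C.
Proof.
move=> Ap; have [rho [_ [_ [rho0 BA _ _ _]]]] := cutoff_exists Ap.
have [d d0 [C HC]] := local_test_bound Ap.
have [bI bI0 HI] := smooth_bounded_fin BA (fun ab : 'I_n * 'I_n => smooth_ginv HA Gsm Gpos ab.1 ab.2).
have [bb bb0 Hb] := smooth_bounded_fin BA bd_beta_sm.
have [bg bg0 Hg] := smooth_bounded_fin BA bd_gam_sm.
pose s := expR C0 * bb + bg.
exists (Num.min d rho); first by rewrite lt_min d0.
exists (2 * C + 2 * (n%:R * (n%:R * (bI * (s * s))))) => u Au y Ay yd.
have [Cu su ulb _] := Au.
have By : box p rho y.
  apply/boxP; split=> [i|]; last by apply: (corner_open_sub HA Ay) => /=.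
  by have := yd i; rewrite lt_min => /andP[_ /ltW].
have sb a : `|shift u a y| <= s.
  apply: le_trans (ler_normD _ _) _; apply: lerD; last exact: Hg.
  rewrite normrM; apply: ler_pM => //; last exact: Hb.
  by rewrite ger0_norm ?expR_ge0 // ler_expR lerNl; exact: ulb.
have s0 : 0 <= s by rewrite addr_ge0 // mulr_ge0 // expR_ge0.
have [E [lam [EG _ _ _]]] := frame_exists HA Gsm Gpos (class_CW Cu) su Ay.
pose sh m := \sum_a E m a * shift u a y.
have shE : \sum_m sh m ^+ 2 <= n%:R * (n%:R * (bI * (s * s))).
  have -> : \sum_m sh m ^+ 2 = \sum_a \sum_b ginv G y a b * (shift u a y * shift u b y).
    by rewrite (frame_ginv_form Gpos Ay EG); apply: eq_bigr => m _; rewrite expr2.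
  rewrite mulr_natl -[X in _ *+ X]card_ord -sumr_const; apply: ler_sum => a _.
  rewrite mulr_natl -[X in _ *+ X]card_ord -sumr_const; apply: ler_sum => b _.
  apply: le_trans (ler_norm _) _; rewrite normrM; apply: ler_pM => //; first exact: (HI (a, b)).
  by rewrite normrM; apply: ler_pM.
rewrite (grad_sq_frame Gpos u Ay EG).
apply: (@le_trans _ _ (\sum_m (2 * frame_form A bd_beta bd_gam u y E m ^+ 2 + 2 * sh m ^+ 2))).
  apply: ler_sum => m _; rewrite (frame_grad_form A bd_beta bd_gam) -/(sh m).
  move: (frame_form _ _ _ _ _ _ _) (sh m) => a b; rewrite -subr_ge0.
  have -> : 2 * a ^+ 2 + 2 * b ^+ 2 - (a - b) ^+ 2 = (a + b) ^+ 2 by ring.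
  exact: sqr_ge0.
rewrite big_split /= -!mulr_sumr; apply: lerD; last by rewrite ler_pM2l.
rewrite ler_pM2l // -(test_sq_frame Gpos _ _ u Ay EG); apply: HC => // i.
by have := yd i; rewrite lt_min => /andP[].
Qed.

End local_estimate.

(** * From charts to the manifold *)

Section charts.
Variables (R : realType) (n : nat) (T : topologicalType) (M : smooth_structure R n T).
Local Notation N := (bd_axis M).
Implicit Types (phi psi : chart R T N) (O : set T).

Lemma chart_img_open phi O : open O -> corner_open (pred1 N) (chart_img phi O).
Proof.
move=> oO; have [W oW codE] := cod_open phi.
exists (W `&` [set x | nbhs x (fun y => cod phi y -> O (bwd phi y))]).
  by apply: openI => //; exact: open_interior.
have halfE x : half_space N x <-> corner (pred1 N) x.
  by split=> [xN i /eqP ->|] //; apply => /=.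
apply/seteqP; split=> x.
  move=> [cx Ox]; have [Wx /halfE hx] : (W `&` half_space N) x by rewrite -codE.
  split=> //; split=> //.
  have /subspace_continuousP/(_ x cx) := @bwd_continuous _ _ _ _ phi.
  by move=> /(_ O (open_nbhs_nbhs (conj oO Ox))).
move=> [[Wx] /nbhs_singleton Ox /halfE hx].
have cx : cod phi x by rewrite codE.
by split=> //; exact: Ox.
Qed.

Lemma chart_img_cod phi O : chart_img phi O `<=` cod phi.
Proof. by move=> x []. Qed.

Lemma cod_corner phi : corner_open (pred1 N) (cod phi).
Proof.
have -> : cod phi = chart_img phi setT by apply/seteqP; split=> x // [].
exact: chart_img_open openT.
Qed.

Variable g : riemannian_metric M.

(** Estimates are obtained in one chart around each point, whereas the conclusion concerns every
    chart of the atlas. The differential transforms by the Jacobian [J] and the metric by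
    [J^T G2 J], so the norms agree. *)
Lemma grad_sq_chart O (u : T -> R) phi psi q : open O -> class_C_on M 1 O u ->
  atlas M phi -> atlas M psi -> O q -> dom phi q -> dom psi q ->
  grad_sq (cod phi) (metric g phi) (u \o bwd phi) (fwd phi q) =
  grad_sq (cod psi) (metric g psi) (u \o bwd psi) (fwd psi q).
Proof.
move=> oO Cu aphi apsi Oq qphi qpsi; set x := fwd phi q.
have bx : bwd phi x = q by exact: fwdK.
pose tau k := transition phi psi k.
pose B := chart_img phi (dom psi); pose C := chart_img phi (O `&` dom psi).
have HB : corner_open (pred1 N) B by apply: chart_img_open; exact: dom_open.
have HC : corner_open (pred1 N) C by apply: chart_img_open; apply: openI => //; exact: dom_open.
have HO := chart_img_open psi oO.
have CB : C `<=` B by move=> y [cy [_ dy]].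
have Cx : C x by split; [exact: fwd_cod | rewrite /= bx].
have Bx : B x by exact: CB.
pose J k i := partial B i (tau k) x.
pose z k := partial (cod psi) k (u \o bwd psi) (fwd psi q).
have wE i : partial (cod phi) i (u \o bwd phi) x = \sum_k J k i * z k.
  rewrite (partial_restrict_id HC (cod_corner phi) (@chart_img_cod _ _)) //.
  apply: (partial_eq HC Cx).
  have X0 : fwd psi (bwd phi (x + (0 : R) *: basis_vec R i)) = fwd psi q by rewrite line0 bx.
  (* The transition map bends the coordinate line into a curve that may be one-sided at the
     boundary, hence the chain rule along curves. *)
  have HX := @has_der_curve _ _ _ _ HO (line C i x) (fun t => fwd psi (bwd phi (x + t *: basis_vec R i)))
    (J ^~ i) (u \o bwd psi) (Cu psi apsi).
  have Xin t : line C i x t -> chart_img psi O (fwd psi (bwd phi (x + t *: basis_vec R i))).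
    move=> [_ [Ot dt]]; split; first exact: fwd_cod.
    by rewrite /= fwdK.
  have {}HX : has_der (line C i x) (fun t => u (bwd psi (fwd psi (bwd phi (x + t *: basis_vec R i)))))
      (\sum_k J k i * z k).
    have -> : \sum_k J k i * z k = \sum_k J k i *
        partial (chart_img psi O) k (u \o bwd psi) (fwd psi (bwd phi (x + (0 : R) *: basis_vec R i))).
      apply: eq_bigr => k _; rewrite X0; apply: congrM; first by [].
      apply: (partial_restrict_id HO (cod_corner psi) (@chart_img_cod _ _)).
      by split; [exact: fwd_cod | rewrite /= fwdK].
    apply: HX.
    - by apply: Xin; rewrite /line /= line0.
    - by exists 1 => // t _; exact: Xin.
    - move=> k; have := class_C_is_partial (i := i) (atlas_smooth aphi apsi k 1) Bx.
      apply: has_der_sub; exists 1 => // t _; exact: CB.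
  apply: has_der_eq_near HX; first by rewrite X0 /= line0 bx fwdK.
  by exists 1 => // t _ [_ [_ dt]]; rewrite /= fwdK.
pose Jm : 'M[R]_n := \matrix_(k, i) J k i.
pose G1 := metric g phi x; pose G2 := metric g psi (fwd psi q).
have GE : G1 = Jm^T *m G2 *m Jm.
  apply/matrixP => i j; rewrite /G1 (metric_change g aphi apsi Bx) bx -/G2 mxE.
  rewrite exchange_big /=; apply: eq_bigr => l _; rewrite !mxE mulr_suml.
  by apply: eq_bigr => k _; rewrite !mxE mulrAC.
have U1 : G1 \in unitmx by apply: posdef_unitmx; apply: metric_posdef => //; exact: fwd_cod.
have U2 : G2 \in unitmx by apply: posdef_unitmx; apply: metric_posdef => //; exact: fwd_cod.
(* Invertibility of the Jacobian is read off from the transformation law of the metric. *)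
have UJ : Jm \in unitmx by move: U1; rewrite GE unitmx_mul => /andP[].
have gradE (A : set 'rV[R]_n) (G : 'rV[R]_n -> 'M[R]_n) v y :
    grad_sq A G v y = ((\row_i partial A i v y) *m invmx (G y) *m (\row_i partial A i v y)^T) 0 0.
  rewrite /grad_sq [RHS]mxE [LHS]exchange_big /=; apply: eq_bigr => j _; rewrite !mxE mulr_suml.
  by apply: eq_bigr => i _; rewrite !mxE mulrCA mulrA.
rewrite !gradE -/G1 -/G2.
have -> : \row_i partial (cod phi) i (u \o bwd phi) x = (\row_k z k) *m Jm.
  by apply/rowP => i; rewrite !mxE wE; apply: eq_bigr => k _; rewrite !mxE mulrC.
rewrite trmx_mul !mulmxA; congr ((_ *m _) 0 0); rewrite -!mulmxA; congr (_ *m _).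
apply: (can_inj (mulmxK U2)); rewrite mulVmx //.
apply: (can_inj (mulmxK UJ)); rewrite mul1mx -!mulmxA (mulmxA Jm^T) -GE mulVmx // mulmx1 //.
Qed.

End charts.

(** * From local bounds to a bound on compact sets *)

Section manifold_estimate.
Variables (R : realType) (n' : nat).
Local Notation n := n'.+1.
Variables (T : topologicalType) (M : smooth_structure R n T) (g : riemannian_metric M).
Local Notation N := (bd_axis M).
Variables (Gamma : set 'rV[R]_n) (f : 'rV[R]_n -> R).
Hypothesis HGamma : corner_open pred0 Gamma.
Hypothesis f_C1 : class_C 1 Gamma f.
Hypothesis Gamma_sym : forall (s : 'S_n) lam, Gamma lam -> Gamma (col_perm s lam).
Hypothesis f_sym : forall (s : 'S_n) lam, Gamma lam -> f (col_perm s lam) = f lam.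
Variables (c C0 c0 c1 eps : R).
Hypotheses (c0_gt0 : 0 < c0) (c1_gt0 : 0 < c1) (eps_gt0 : 0 < eps).
Hypothesis f_mono : forall l mu, Gamma mu -> 0 < partial Gamma l f mu.
Hypothesis f_trace : forall mu, Gamma mu -> c0 <= \sum_l partial Gamma l f mu.
Hypothesis f_st : structural Gamma f (expR (2 * C0)) eps c1.
Variable O1 : set T.
Hypothesis O1_open : open O1.

Definition solution (u : T -> R) := [/\ class_C_on M 3 O1 u,
  forall p, O1 p -> forall phi, atlas M phi -> dom phi p ->
    exists lam : 'rV[R]_n,
      [/\ eigenvalues (metric g phi (fwd phi p))
            (U_tensor (cod phi) (metric g phi) (u \o bwd phi) (fwd phi p)) lam,
          Gamma lam & f lam = expR (- 2 * u p)],
  forall p, (O1 `&` boundary M) p -> forall phi, atlas M phi -> dom phi p ->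
    normal_deriv (cod phi) (metric g phi) N (u \o bwd phi) (fwd phi p)
    = c * expR (- u p) - mean_curvature (cod phi) (metric g phi) N (fwd phi p) &
  forall p, O1 p -> - C0 <= u p].

Lemma solution_admissible phi u : atlas M phi -> solution u ->
  admissible N (chart_img phi O1) (metric g phi) Gamma f c C0 (u \o bwd phi).
Proof.
move=> aphi [Cu su bc lb].
have HA := chart_img_open phi O1_open; have HB := cod_corner phi.
have AB := @chart_img_cod _ _ _ _ phi O1.
split; first exact: Cu.
- move=> x Ax; have [cx Ox] := Ax.
  have [lam [ev Gl fl]] := su _ Ox phi aphi (bwd_dom cx).
  rewrite (bwdK cx) (U_tensor_restrict HA HB AB _ _ Ax) in ev.
  by exists lam; split; [exact: ev | exact: Gl | exact: fl].
- by move=> x [_ Ox]; exact: lb.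
- move=> x Ax xN; have [cx Ox] := Ax.
  have bdx : (O1 `&` boundary M) (bwd phi x).
    by split=> //; exists phi; split; [exact: aphi | exact: bwd_dom | rewrite bwdK].
  have := bc _ bdx phi aphi (bwd_dom cx); rewrite (bwdK cx).
  by rewrite (normal_deriv_restrict HA HB AB _ _ _ Ax) (mean_curvature_restrict HA HB AB _ _ Ax).
Qed.

Lemma chart_bound phi p : atlas M phi -> O1 p -> dom phi p -> exists C : R,
  \forall q \near p, [/\ O1 q, dom phi q & forall u, solution u ->
    grad_sq (cod phi) (metric g phi) (u \o bwd phi) (fwd phi q) <= C].
Proof.
move=> aphi Op dp.
have HA := chart_img_open phi O1_open; have HB := cod_corner phi.
have AB := @chart_img_cod _ _ _ _ phi O1.
have inA q : O1 q -> dom phi q -> chart_img phi O1 (fwd phi q).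
  by move=> Oq dq; split; [exact: fwd_cod | rewrite /= fwdK].
have Gsm i j : smooth (chart_img phi O1) (fun x => metric g phi x i j).
  by move=> k; apply: (class_C_restrict HA HB AB); exact: metric_smooth.
have Gpos x : chart_img phi O1 x -> posdef (metric g phi x).
  by move=> [cx _]; exact: metric_posdef.
have [d d0 [C HC]] := local_gradient_bound HA Gsm Gpos HGamma f_C1 Gamma_sym f_sym c
  c0_gt0 c1_gt0 eps_gt0 f_mono f_trace f_st (inA p Op dp).
exists C.
have nO : nbhs p O1 by exact: open_nbhs_nbhs.
have nd : nbhs p (dom phi) by apply: open_nbhs_nbhs; split=> //; exact: dom_open.
have nf : nbhs p (fun q => dom phi q -> forall i, `|fwd phi q 0 i - fwd phi p 0 i| < d).
  have /subspace_continuousP/(_ p dp) := @fwd_continuous _ _ _ _ phi.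
  move=> /(_ [set y | forall i, `|y 0 i - fwd phi p 0 i| < d]); apply.
  by apply/nbhs_coord; exists d.
apply: filterS3 nO nd nf => q Oq dq fq; split=> // u su.
rewrite (grad_sq_restrict HA HB AB) //; last exact: inA.
by apply: HC; [exact: solution_admissible | exact: inA | exact: fq].
Qed.

Lemma near_bound p : O1 p -> exists C : R, \forall q \near p, forall u, solution u ->
  forall psi, atlas M psi -> dom psi q ->
    grad_sq (cod psi) (metric g psi) (u \o bwd psi) (fwd psi q) <= C.
Proof.
move=> Op; have [phi aphi dp] := atlas_cover M p.
have [C HC] := chart_bound aphi Op dp; exists C.
apply: filterS HC => q [Oq dq HC] u su psi apsi dpsi.
have [Cu _ _ _] := su.
have Cu1 : class_C_on M 1 O1 u.
  by move=> rho arho; apply: (class_C_le (k' := 3)) => //; exact: Cu.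
by rewrite (grad_sq_chart g O1_open Cu1 apsi aphi Oq dpsi dq); exact: HC.
Qed.

(** Compactness in near-covering form, with the filter at [+oo] on the constants: near each point
    every large [C] works, so one large [C] works on all of [K]. *)
Lemma compact_bound K : compact K -> K `<=` O1 -> exists2 C : R, 0 < C &
  forall u, solution u -> forall p, K p -> forall phi, atlas M phi -> dom phi p ->
    grad_norm (cod phi) (metric g phi) (u \o bwd phi) (fwd phi p) <= C.
Proof.
move=> /compact_near_coveringP cK KO.
pose P (C : R) q := forall u, solution u -> forall psi, atlas M psi -> dom psi q ->
    grad_sq (cod psi) (metric g psi) (u \o bwd psi) (fwd psi q) <= C.
have [|C0' [_ HC]] := cK R +oo%R P _.
  move=> p Kp; have [C HC] := near_bound (KO p Kp).
  exists ([set q | P C q], [set C' | C < C']) => /=.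
    split=> //; exists C; split; [exact: num_real | by []].
  move=> [q C'] [/= Pq CC'] u su psi apsi dpsi.
  exact: le_trans (Pq u su psi apsi dpsi) (ltW CC').
pose C := `|C0'| + 1; have C_gt0 : 0 < C by rewrite ltr_wpDl.
exists (Num.sqrt C); first by rewrite sqrtr_gt0.
move=> u su p Kp phi aphi dp; rewrite /grad_norm ler_wsqrtr //.
apply: (HC C _ p Kp u su phi aphi dp).
by rewrite /C (le_lt_trans (ler_norm _)) // ltrDl.
Qed.

End manifold_estimate.

(** * Homogeneity and the level in the structural condition *)

Section structural_condition.
Variables (R : realType) (n : nat) (Gamma : set 'rV[R]_n) (f : 'rV[R]_n -> R).
Hypothesis Gamma_open : open Gamma.
Hypothesis Gamma_cone : forall (t : R) (lam : 'rV[R]_n), 0 < t -> Gamma lam -> Gamma (t *: lam).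
Hypothesis f_homog : forall (t : R) (lam : 'rV[R]_n), 0 < t -> Gamma lam -> f (t *: lam) = t * f lam.
Hypothesis f_C1 : class_C 1 Gamma f.

Lemma open_corner : corner_open pred0 Gamma.
Proof.
exists Gamma => //; apply/seteqP; split=> x; last by case.
by move=> Gx; split.
Qed.

Lemma partial_open i mu : Gamma mu -> partial Gamma i f mu = 'D_(basis_vec R i) f mu.
Proof. by move=> Gm; apply: partial_interior; exact: open_nbhs_nbhs. Qed.

(** First derivatives of [f] are homogeneous of degree zero, so both sides of the structural
    condition scale by the same power of [s]. *)
Lemma partial_homog i mu (s : R) : 0 < s -> Gamma mu ->
  partial Gamma i f (s *: mu) = partial Gamma i f mu.
Proof.
move=> s0 Gm; have Gs := Gamma_cone s0 Gm; have sn0 := lt0r_neq0 s0.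
apply: (partial_eq open_corner Gs).
have lin t : s *: mu + t *: basis_vec R i = s *: (mu + (t * s^-1) *: basis_vec R i).
  by rewrite scalerDr scalerA mulrCA divff // mulr1.
have tol t : line Gamma i (s *: mu) t -> line Gamma i mu (t * s^-1).
  rewrite /line /= lin => /(Gamma_cone (t := s^-1)); rewrite invr_gt0 => /(_ s0).
  by rewrite scalerA mulVf // scale1r.
have tol' : exists2 d : R, 0 < d & forall t, `|t| < d -> line Gamma i (s *: mu) t ->
    line Gamma i mu (t * s^-1) by exists 1 => // t _; exact: tol.
have := has_derZ (a := s) (has_der_scale tol' (class_C_is_partial (i := i) f_C1 Gm)).
rewrite mulrCA divff // mulr1; apply: has_der_eq_near.
  by rewrite mul0r !line0 f_homog.
by exists 1 => // t _ /tol Gt; rewrite lin f_homog.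
Qed.

(* Homogeneity trades the normalization [f <= 1] for [f <= k]: apply the
   condition to [s *: lam] and [sqrt s *: xi] with [s = min 1 k^-1]. *)
Lemma structural_rescale (k eps c1 : R) : 0 < k -> 0 < eps ->
  (forall lam xi : 'rV[R]_n, Gamma lam -> f lam <= 1 -> eps^-1 <= enorm xi ->
     (forall i, `|xi 0 i * (lam 0 i - 2^-1 * enorm xi ^+ 2)| <= eps * enorm xi ^+ 3) ->
     c1 * enorm xi ^+ 4 * (\sum_i 'D_(basis_vec R i) f lam) <=
     \sum_i 'D_(basis_vec R i) f lam *
       ((lam 0 i + 2^-1 * enorm xi ^+ 2 - xi 0 i ^+ 2) ^+ 2
        + xi 0 i ^+ 2 * (enorm xi ^+ 2 - xi 0 i ^+ 2))) ->
  exists2 e : R, 0 < e & structural Gamma f k e c1.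
Proof.
move=> k0 eps0 H; pose s := Num.min 1 k^-1; pose r := Num.sqrt s.
have s0 : 0 < s by rewrite lt_min ltr01 invr_gt0.
have r0 : 0 < r by rewrite sqrtr_gt0.
have r2 : r ^+ 2 = s by rewrite sqr_sqrtr // ltW.
have r1 : r <= 1 by rewrite -sqrtr1 ler_wsqrtr // ge_min lexx.
have sk : s * k <= 1 by rewrite -ler_pdivlMr // mul1r ge_min lexx orbT.
exists (eps * r) => [|mu xi Gm fk exi Hxi]; first exact: mulr_gt0.
have nE : enorm (r *: xi) = r * enorm xi.
  rewrite /enorm /sqnorm -[X in X * _](ger0_norm (ltW r0)) -sqrtr_sqr -sqrtrM ?sqr_ge0 //.
  by congr Num.sqrt; rewrite mulr_sumr; apply: eq_bigr => i _; rewrite mxE exprMn.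
have Gs := Gamma_cone s0 Gm.
have dE l : 'D_(basis_vec R l) f (s *: mu) = partial Gamma l f mu.
  by rewrite -partial_open // partial_homog.
have := H (s *: mu) (r *: xi) Gs; rewrite nE f_homog //.
have -> : s * f mu <= 1 by apply: le_trans sk; rewrite ler_pM2l.
have -> : eps^-1 <= r * enorm xi.
  by move: exi; rewrite invfM ler_pdivrMr // mulrC.
move=> /(_ isT isT) {}H.
have rs l : (s *: mu) 0 l - 2^-1 * (r * enorm xi) ^+ 2 = s * (mu 0 l - 2^-1 * enorm xi ^+ 2).
  by rewrite mxE exprMn r2; ring.
have {}H := H _; rewrite (eq_bigr _ (fun l _ => dE l)) in H.
rewrite -(ler_pM2l (exprn_gt0 2 s0)).
have -> : s ^+ 2 * (c1 * enorm xi ^+ 4 * \sum_l partial Gamma l f mu) =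
    c1 * (r * enorm xi) ^+ 4 * \sum_l partial Gamma l f mu.
  by rewrite exprMn (exprM r 2 2) r2; ring.
apply: (le_trans (H _)) => [l|].
  rewrite rs mxE.
  have -> : r * xi 0 l * (s * (mu 0 l - 2^-1 * enorm xi ^+ 2)) =
      (r * s) * (xi 0 l * (mu 0 l - 2^-1 * enorm xi ^+ 2)) by ring.
  rewrite normrM ger0_norm ?mulr_ge0 ?(ltW r0) ?(ltW s0) //.
  have -> : eps * (r * enorm xi) ^+ 3 = (r * s) * (eps * enorm xi ^+ 3) by rewrite -r2; ring.
  rewrite ler_pM2l ?mulr_gt0 //; apply: le_trans (Hxi l) _.
  rewrite ler_wpM2r ?exprn_ge0 ?sqrtr_ge0 // ler_piMr // ltW //.
rewrite mulr_sumr le_eqVlt; apply/orP; left; apply/eqP; apply: eq_bigr => l _.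
rewrite dE !mxE !exprMn r2; ring.
Qed.

End structural_condition.

Theorem theorem1p4 (R : realType) (n : nat) (hn : (3 <= n)%N) (c : R)
  (Gamma : set 'rV[R]_n)
  (Gamma_open : open Gamma)
  (Gamma_convex : convex_set Gamma)
  (Gamma_sym : forall (s : 'S_n) (lam : 'rV[R]_n),
     Gamma lam -> Gamma (col_perm s lam))
  (Gamma_cone : forall (t : R) (lam : 'rV[R]_n),
     0 < t -> Gamma lam -> Gamma (t *: lam))
  (Gamma_n_sub : [set lam : 'rV[R]_n | forall i, 0 < lam 0 i] `<=` Gamma)
  (Gamma_sub_1 : Gamma `<=` [set lam : 'rV[R]_n | 0 < \sum_i lam 0 i])
  (f : 'rV[R]_n -> R)
  (f_smooth : smooth Gamma f)
  (f_cont : {within closure Gamma, continuous f})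
  (f_sym : forall (s : 'S_n) (lam : 'rV[R]_n),
     closure Gamma lam -> f (col_perm s lam) = f lam)
  (f_pos : forall lam, Gamma lam -> 0 < f lam)
  (f_homog : forall (t : R) (lam : 'rV[R]_n),
     0 < t -> Gamma lam -> f (t *: lam) = t * f lam)
  (f_mono : forall (lam : 'rV[R]_n) (i : 'I_n),
     Gamma lam -> 0 < 'D_(basis_vec R i) f lam)
  (f_trace : exists2 c0 : R, 0 < c0 &
     forall lam : 'rV[R]_n, Gamma lam ->
       c0 <= \sum_i 'D_(basis_vec R i) f lam)
  (f_struct : exists eps1 c1 : R, [/\ 0 < eps1, 0 < c1 &
     forall lam xi : 'rV[R]_n, Gamma lam ->
       f lam <= 1 ->
       eps1^-1 <= enorm xi ->
       (forall i, `|xi 0 i * (lam 0 i - 2^-1 * enorm xi ^+ 2)|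
                  <= eps1 * enorm xi ^+ 3) ->
       c1 * enorm xi ^+ 4 * (\sum_i 'D_(basis_vec R i) f lam) <=
       \sum_i 'D_(basis_vec R i) f lam *
         ((lam 0 i + 2^-1 * enorm xi ^+ 2 - xi 0 i ^+ 2) ^+ 2
          + xi 0 i ^+ 2 * (enorm xi ^+ 2 - xi 0 i ^+ 2))])
  (T : topologicalType)
  (T_hausdorff : hausdorff_space T)
  (T_compact : compact [set: T])
  (M : smooth_structure R n T)
  (bd_nonempty : boundary M !=set0)
  (g : riemannian_metric M)
  (O1 O2 : set T) (O1_open : open O1) (O2_open : open O2)
  (O2_sub : closure O2 `<=` O1)
  (C0 : R) :
  exists2 C : R, 0 < C &
    forall u : T -> R,
      class_C_on M 3 O1 u ->
      (forall p, O1 p -> forall phi, atlas M phi -> dom phi p ->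
         exists lam : 'rV[R]_n,
           [/\ eigenvalues (metric g phi (fwd phi p))
                 (U_tensor (cod phi) (metric g phi) (u \o bwd phi) (fwd phi p))
                 lam,
               Gamma lam
             & f lam = expR (- 2 * u p)]) ->
      (forall p, (O1 `&` boundary M) p ->
         forall phi, atlas M phi -> dom phi p ->
         normal_deriv (cod phi) (metric g phi) (bd_axis M) (u \o bwd phi)
           (fwd phi p)
         = c * expR (- u p)
           - mean_curvature (cod phi) (metric g phi) (bd_axis M) (fwd phi p)) ->
      (forall p, O1 p -> - C0 <= u p) ->
      forall p, O2 p -> forall phi, atlas M phi -> dom phi p ->
        grad_norm (cod phi) (metric g phi) (u \o bwd phi) (fwd phi p) <= C.
Proof.
destruct n as [|n']; first by [].
have f_C1 : class_C 1 Gamma f by exact: f_smooth.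
have HG := open_corner Gamma_open.
have f_symG (s : 'S_n'.+1) lam : Gamma lam -> f (col_perm s lam) = f lam.
  by move=> Gl; apply: f_sym; exact: subset_closure.
have [c0 c0_gt0 Hc0] := f_trace.
have [eps1 [c1 [eps1_gt0 c1_gt0 Hst]]] := f_struct.
(* The level is [e^(2 C0)], the bound on [f = e^(-2u)] along a solution. *)
have [eps eps_gt0 {}Hst] :=
  structural_rescale Gamma_open Gamma_cone f_homog f_C1 (expR_gt0 (2 * C0)) eps1_gt0 Hst.
have f_monoG l mu : Gamma mu -> 0 < partial Gamma l f mu.
  by move=> Gm; rewrite partial_open //; exact: f_mono.
have f_traceG mu : Gamma mu -> c0 <= \sum_l partial Gamma l f mu.
  move=> Gm; apply: le_trans (Hc0 mu Gm) _; rewrite le_eqVlt; apply/orP; left; apply/eqP.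
  by apply: eq_bigr => l _; rewrite partial_open.
have cO2 : compact (closure O2).
  by apply: (subclosed_compact _ T_compact) => //; exact: closed_closure.
have [C C_gt0 HC] := compact_bound g HG f_C1 Gamma_sym f_symG c c0_gt0 c1_gt0
  eps_gt0 f_monoG f_traceG Hst O1_open cO2 O2_sub.
exists C => // u Cu su bc lb p O2p phi aphi dp.
apply: HC => //; exact: subset_closure.
Qed.
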